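(* Let $d\ge1$, $M>0$ and $\delta>0$. Let $X_1,\dots,X_n$ ($n\ge2$) be i.i.d. from $P=(1-\epsilon)P_{f_\pi}+\epsilon Q$, where $\epsilon\in[0,1)$, $\pi$ is a probability measure with $\mathrm{supp}(\pi)\subseteq[-M,M]^d$, $P_{f_\pi}$ is the distribution with density $f_\pi$, and $Q$ is an arbitrary probability distribution on $\mathbb R^d$. Then the Yatracos' estimator $\widehat f$ satisfies $$\sup_{\pi,Q}\mathbb E\big[H^2(f_\pi,\widehat f)\big]\lesssim\mathcal E^2(\epsilon,n),\qquad \mathcal E^2(\epsilon,n):=\epsilon^{2\left(1-\frac{2+\delta}{\log(\log(1/\epsilon)\vee e)}\right)}+\frac1{n^{1-o_d(1)}},$$ where the supremum is over all $Q$ and all $\pi$ with $\mathrm{supp}(\pi)\subseteq[-M,M]^d$, the expectation is over $X_1,\dots,X_n$ drawn i.i.d. from $P=(1-\epsilon)P_{f_\pi}+\epsilon Q$, and $o_d(1)$ is a positive real-valued function of $n$ and $d$ which converges to zero as $n\to\infty$.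
   Context: $f_\pi(x)=\int_{\mathbb R^d}\phi_d(x-\theta)\,d\pi(\theta)$ with $\phi_d$ the standard Gaussian density on $\mathbb R^d$; $\mathcal P_{M,d}$ is the set of distributions with density $f_\pi$, $\mathrm{supp}(\pi)\subseteq[-M,M]^d$. $H(p,q)=\sqrt{\frac12\int(\sqrt p-\sqrt q)^2}$, $\mathrm{TV}(p,q)=\frac12\int|p-q|$. Yatracos' estimator: let $\{Q_1,\dots,Q_N\}$ be a minimal-cardinality $\eta$-covering of $\mathcal P_{M,d}$ in total variation (every element of $\mathcal P_{M,d}$ is within TV distance $\eta$ of some $Q_i$), with $\eta\asymp\log^{d/2}(n)/\sqrt n$. Let $A_{ij}=\{x:\frac{dQ_i}{d(Q_i+Q_j)}(x)\ge\frac{dQ_j}{d(Q_i+Q_j)}(x)\}$, $\mathcal A=\{A_{ij}:i\ne j\in[N]\}$, and $\mathrm{dist}(P_1,P_2)=\sup_{A\in\mathcal A}|P_1(A)-P_2(A)|$. With $\widehat P_n=\frac1n\sum_{i=1}^n\delta_{X_i}$ the empirical distribution, the estimator is $\widehat P:=\operatorname{argmin}_{P'\in\mathcal P_{M,d}}\mathrm{dist}(P',\widehat P_n)$, and $\widehat f$ is its density. $a\vee b=\max\{a,b\}$. At $\epsilon=0$ the first term of $\mathcal E^2$ is read as $0$. The notation $\lesssim$ hides multiplicative constants depending on $M$, $d$ (and the fixed $\delta$), not on $\epsilon$ or $n$. *)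

(* Defs.v *)
From HB Require Import structures.
From mathcomp Require Import all_boot all_order all_algebra.
From mathcomp Require Import all_classical all_reals all_analysis.

Set Implicit Arguments.
Unset Strict Implicit.
Unset Printing Implicit Defensive.
Import Order.TTheory GRing.Theory Num.Def Num.Theory.
Import numFieldNormedType.Exports.

Local Open Scope classical_set_scope.
Local Open Scope ring_scope.

(* R^d; the sigma-algebra carried by tuples is generated by the coordinates,
   so it is the Borel sigma-algebra of R^d. *)
Notation rspace R d := (d.-tuple (measurableTypeR R)).

(* The library has no Lebesgue measure on R^d: it is built here by recursion on
   d, transporting the binary product lebesgue_measure \x m along the
   identification of R * R^d with R^d.+1. *)
Section lebesgue_product.
Context {R : realType}.
Local Open Scope ereal_scope.

Definition tcons d (p : measurableTypeR R * rspace R d) : rspace R d.+1 :=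
  [the d.+1.-tuple _ of p.1 :: p.2].

Definition tuncons d (t : rspace R d.+1) : measurableTypeR R * rspace R d :=
  (thead t, [tuple of behead t]).

Lemma tconsK d : cancel (@tcons d) (@tuncons d).
Proof. by move=> [x t]; congr pair; apply/val_inj. Qed.

Lemma measurable_tcons d : measurable_fun [set: _] (@tcons d).
Proof. exact: measurable_cons. Qed.

Lemma measurable_tuncons d : measurable_fun [set: _] (@tuncons d).
Proof.
apply: measurable_fun_pair; last exact: measurable_behead.
exact: measurable_tnth.
Qed.

Section step.
Context d (m : {sigma_finite_measure set (rspace R d) -> \bar R}).

Definition leb_step : set (rspace R d.+1) -> \bar R :=
  pushforward (@lebesgue_measure R \x m) (@tcons d).

Lemma leb_step0 : leb_step set0 = 0.
Proof. by rewrite /leb_step /pushforward preimage_set0 measure0. Qed.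

Lemma leb_step_ge0 A : 0 <= leb_step A.
Proof. by rewrite /leb_step /pushforward; exact: measure_ge0. Qed.

Lemma leb_step_sigma_additive : semi_sigma_additive leb_step.
Proof.
have mf := @measurable_tcons d.
move=> F mF tF mUF; rewrite /leb_step /pushforward preimage_bigcup.
apply: measure_semi_sigma_additive.
- by move=> n; rewrite -[X in measurable X]setTI; exact: mf.
- apply/trivIsetP => /= i j _ _ ij; rewrite -preimage_setI.
  by move/trivIsetP : tF => /(_ _ _ _ _ ij) ->//; rewrite preimage_set0.
- by rewrite -preimage_bigcup -[X in measurable X]setTI; exact: mf.
Qed.

HB.instance Definition _ := isMeasure.Build _ _ _ leb_step
  leb_step0 leb_step_ge0 leb_step_sigma_additive.

Lemma leb_step_sigma_finite : sigma_finite setT leb_step.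
Proof.
have /sigma_finiteP[F [TF ndF Foo]] := sigma_finiteT (@lebesgue_measure R).
have /sigma_finiteP[G [TG ndG Goo]] := sigma_finiteT m.
exists (fun n => @tuncons d @^-1` (F n `*` G n)).
  apply/esym/seteqP; split=> // t _.
  have [k _ Fk] : (\bigcup_k F k) (tuncons t).1 by rewrite -TF.
  have [l _ Gl] : (\bigcup_k G k) (tuncons t).2 by rewrite -TG.
  exists (maxn k l) => //; split.
    by move: Fk; exact/subsetPset/ndF/leq_maxl.
  by move: Gl; exact/subsetPset/ndG/leq_maxr.
move=> n; have [mF Fnoo] := Foo n; have [mG Gnoo] := Goo n; split.
  rewrite -[X in measurable X]setTI.
  by apply: measurable_tuncons => //; exact: measurableX.
rewrite /leb_step /pushforward.
rewrite (_ : _ @^-1` _ = F n `*` G n); last first.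
  by rewrite -comp_preimage (_ : _ \o _ = id)//; apply/funext => p /=; rewrite tconsK.
by rewrite product_measure1E// lte_mul_pinfty// ge0_fin_numE.
Qed.

HB.instance Definition _ := Measure_isSigmaFinite.Build _ _ _ leb_step
  leb_step_sigma_finite.

End step.

Fixpoint leb d : {sigma_finite_measure set (rspace R d) -> \bar R} :=
  if d is d'.+1 then leb_step (leb d') else @dirac _ (rspace R 0) [tuple] R.

Lemma leb_box d (A : 'I_d -> set (measurableTypeR R)) :
  (forall i, measurable (A i)) ->
  leb d [set x | forall i, A i (tnth x i)] =
    \prod_(i < d) @lebesgue_measure R (A i).
Proof.
elim: d A => [|d IHd] A mA /=.
  by rewrite big_ord0 diracE mem_set//= => -[].
rewrite /leb_step /pushforward.
rewrite (_ : _ @^-1` _ =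
    A ord0 `*` [set x | forall i, A (lift ord0 i) (tnth x i)]).
  rewrite product_measure1E//; last first.
    rewrite (_ : [set _ | _] = \bigcap_(i in [set: 'I_d])
        ((fun x : rspace R d => tnth x i) @^-1` A (lift ord0 i))).
      apply: fin_bigcap_measurable => // i _.
      by rewrite -[X in measurable X]setTI; exact: measurable_tnth.
    by apply/seteqP; split => x /= h i; [move=> _|]; exact: h.
  by rewrite big_ord_recl; congr (_ * _)%E; exact: (IHd (fun i => A (lift ord0 i))).
apply/seteqP; split => -[x t] /=.
  by move=> h; split=> [|i]; [exact: (h ord0)|have := h (lift ord0 i); rewrite tnthS].
move=> [h0 h] i; case: (unliftP ord0 i) => [j|] -> //.
by rewrite tnthS; exact: h.
Qed.

End lebesgue_product.

Section gaussian_mixtures.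
Context {R : realType} (d : nat).

Definition std_gauss (z : rspace R d) : R :=
  (2 * pi) `^ (- (d%:R / 2)) * expR (- (\sum_(i < d) tnth z i ^+ 2) / 2).

Definition rsub (x y : rspace R d) : rspace R d :=
  [tuple tnth x i - tnth y i | i < d].

(* f_pi *)
Definition mixture (prior : probability (rspace R d) R) (x : rspace R d) : R :=
  \int[prior]_theta std_gauss (rsub x theta).

(* Topological support: points all of whose neighbourhoods (here, open cubes)
   have positive mass. *)
Definition supp (P : probability (rspace R d) R) : set (rspace R d) :=
  [set x | forall r : R, 0 < r ->
    (0 < P [set y : rspace R d | forall i, (`|tnth y i - tnth x i| < r)%R])%E].

Definition cube (M : R) : set (rspace R d) :=
  [set x | forall i, `|tnth x i| <= M].

Definition is_density (P : probability (rspace R d) R) (f : rspace R d -> R) :=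
  [/\ measurable_fun setT f, forall x, 0 <= f x &
      forall A, measurable A -> P A = (\int[leb d]_(x in A) (f x)%:E)%E].

(* the class P_{M,d} *)
Definition mixtures (M : R) : set (probability (rspace R d) R) :=
  [set P | exists2 prior : probability (rspace R d) R,
    supp prior `<=` cube M & is_density P (mixture prior)].

Definition hellinger (p q : rspace R d -> R) : R :=
  Num.sqrt (2^-1 * \int[leb d]_x (Num.sqrt (p x) - Num.sqrt (q x)) ^+ 2).

End gaussian_mixtures.

Section total_variation.
Local Open Scope charge_scope.
Context {disp : measure_display} {T : measurableType disp} {R : realType}.
Local Open Scope ereal_scope.
Variables P Q : probability T R.

Definition padd : set T -> \bar R := measure_add P Q.

HB.instance Definition _ := Measure.on padd.

Lemma padd_finite : fin_num_fun padd.
Proof.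
by move=> A mA; rewrite /padd measure_addE fin_numD !fin_num_measure.
Qed.

HB.instance Definition _ := Measure_isFinite.Build _ _ _ padd padd_finite.

(* Both laws are given by their densities with respect to P + Q, so that the
   definition applies to laws which have no Lebesgue density. *)
Definition tv : \bar R :=
  (2^-1)%:E * \int[padd]_x
    `| ('d (charge_of_finite_measure P) '/d padd) x -
       ('d (charge_of_finite_measure Q) '/d padd) x |.

(* the set A_{ij} for Q_i = P and Q_j = Q *)
Definition yatracos_set : set T :=
  [set x | ('d (charge_of_finite_measure Q) '/d padd) x <=
           ('d (charge_of_finite_measure P) '/d padd) x].

End total_variation.

Section yatracos.
Context {disp : measure_display} {T : measurableType disp} {R : realType}.
Implicit Types (model : set (probability T R)) (eta : R).

(* The centers of a covering are arbitrary laws, not necessarily members of model. *)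
Definition tv_covering model eta N (c : 'I_N -> probability T R) :=
  forall P, model P -> exists i, (tv P (c i) <= eta%:E)%E.

Definition minimal_tv_covering model eta N (c : 'I_N -> probability T R) :=
  tv_covering model eta c /\
    forall N' (c' : 'I_N' -> probability T R),
    tv_covering model eta c' -> (N <= N')%N.

Definition yatracos_class N (c : 'I_N -> probability T R) : set (set T) :=
  [set A | exists i j, i != j /\ A = yatracos_set (c i) (c j)].

(* [sup] is 0 on the empty set, which is only used when N = 1. *)
Definition class_dist (cls : set (set T)) (P1 P2 : set T -> \bar R) : R :=
  sup [set `|fine (P1 A) - fine (P2 A)| | A in cls].

Definition empirical n (s : n.-tuple T) (A : set T) : \bar R :=
  ((n%:R^-1)%:E * \sum_(i < n) \d_(tnth s i) A)%E.

(* est s is the law selected from the sample s; the minimizer need not be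
   unique, and any choice of it is allowed. *)
Definition yatracos_estimator model N (c : 'I_N -> probability T R) n
    (est : n.-tuple T -> probability T R) :=
  forall s, model (est s) /\
    forall P, model P ->
      class_dist (yatracos_class c) (est s) (empirical s) <=
      class_dist (yatracos_class c) P (empirical s).

End yatracos.

Section sampling.
Context {disp disp' : measure_display} {Omega : measurableType disp}
  {T : measurableType disp'} {R : realType} (Pr : probability Omega R).
Local Open Scope ereal_scope.

Definition mutually_independent n (X : 'I_n -> {RV Pr >-> T}) :=
  forall (J : {set 'I_n}) (A : 'I_n -> set T),
    (forall i, measurable (A i)) ->
    Pr (\bigcap_(i in [set` J]) (X i @^-1` A i)) =
      \prod_(i in J) Pr (X i @^-1` A i).

Definition contaminated (eps : R) (P Q : probability T R) (A : set T) : \bar R :=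
  (1 - eps)%:E * P A + eps%:E * Q A.

Definition iid_from n (X : 'I_n -> {RV Pr >-> T}) (P : set T -> \bar R) :=
  mutually_independent X /\
  forall i A, measurable A -> distribution Pr (X i) A = P A.

Definition sample n (X : 'I_n -> {RV Pr >-> T}) (w : Omega) : n.-tuple T :=
  [tuple X i w | i < n].

End sampling.

(* The rate E^2(eps, n); o is the o_d(1) of its second term. *)
Definition rate {R : realType} (delta : R) (o : nat -> R) (eps : R) (n : nat) : R :=
  (if eps == 0 then 0 else
     eps `^ (2 * (1 - (2 + delta) / ln (Num.max (ln (eps^-1)) (expR 1)))))
  + (n%:R `^ (1 - o n))^-1.

(* Main.v *)
Require Import Defs.
From mathcomp Require Import all_boot all_order all_algebra.
From mathcomp Require Import all_classical all_reals all_analysis.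
From mathcomp Require Import measurable_realfun.
From mathcomp Require Import zify ring lra.
Set Implicit Arguments.
Unset Strict Implicit.
Unset Printing Implicit Defensive.
Import Order.TTheory GRing.Theory Num.Def Num.Theory.
Import numFieldNormedType.Exports.
Local Open Scope classical_set_scope.
Local Open Scope ring_scope.

(* Write f, g for two mixtures and nu for the difference of their priors. The
   squared Hellinger distance is at most a sum, over the corners t0 of the cube,
   of the chi-square integrals of (f - g)^2 / phi(. - t0), and each of these is
   a multiple of the quadratic form of nu with kernel
   exp (<theta - t0, theta' - t0>). The form with kernel
   exp (- |theta - theta'|^2 / 6), which is the integral of f - g against a
   Gaussian smoothing of it, is at most a multiple of |f - g|_1^2. Expanding both
   kernels into moments of nu and comparing them degree by degree up to order K,
   the first form is at most 4^K K^(3d) times the second one, plus an error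
   K^-K exp (c K).

   On the other hand a minimum distance law is within O(eta + eps + u) of the
   true mixture in L^1 whenever all Yatracos sets deviate by at most u. Rounding
   the first B^d moments of the prior, with B of order log n, covers the class by
   exp (O(log^(d+1) n)) balls, so that Chernoff's bound and a union bound allow
   u^2 of order log^(d+1) n / n. Finally K of order x / log x, with x the
   logarithm of the inverse of max (eps, n^(-1/2)), turns 4^K into the factors
   of the rate. *)

(** For general densities the squared Hellinger distance is controlled only by the first power of
    the L^1 distance. Nearly a square is possible here because the two kernels differ, at degree n,
    by a factor exponential in n, while the bounded support makes the degrees beyond K
    super-exponentially small. The error K^-K is negligible once K ln K exceeds 2x, and the price is
    then exp (O(x / ln x)), which is the shape of the rate.

    Constants. Smoothing f - g leaves a Gaussian kernel of variance 3, whose expansion carries the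
    weights 1 / (3^n n!), and 4^n bounds a term of (1 + 3)^n. With its polynomial factor 4^K stays
    below a multiple of exp (8K/5). For K about (9/4) x / ln x this is exp ((18/5) x / ln x), within
    the budget 2 (2 + delta) of the exponent.

    The corners appear because no Gaussian of unit variance lies, up to a constant, below all the
    mixtures, and dividing by a narrower one would spoil the chi-square integral.

    The selected law need not depend measurably on the sample, so the whole analysis of the
    estimator is deterministic, on the event where no Yatracos set deviates. *)

Lemma measurable_ge0_set disp (T : measurableType disp) (R : realType)
  (g : T -> R) : measurable_fun setT g -> measurable [set x | 0 <= g x].
Proof.
move=> mg; rewrite (_ : [set _ | _] = setT `&` g @^-1` `[0, +oo[).
  exact: mg.
by rewrite setTI; apply/seteqP; split=> x /=; rewrite in_itv/= andbT.
Qed.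

(** * Total variation and Yatracos sets *)

Section scheffe.
Context {disp : measure_display} {T : measurableType disp} {R : realType}.
Variables (mu : {measure set T -> \bar R}) (g : T -> R).
Hypothesis ig : mu.-integrable setT (EFin \o g).
Hypothesis g0 : \int[mu]_x g x = 0.

Let igA A : measurable A -> mu.-integrable A (EFin \o g).
Proof. by move=> mA; exact: integrableS ig. Qed.

Lemma RintegralTE A (f : T -> R) : measurable A ->
  mu.-integrable setT (EFin \o f) ->
  \int[mu]_x f x = \int[mu]_(x in A) f x + \int[mu]_(x in ~` A) f x.
Proof.
move=> mA if_; rewrite -(setUv A) Rintegral_setU//.
- exact: measurableC.
- by rewrite setUv.
- exact/disj_setPCl.
Qed.

(** Since [g] integrates to 0, its negative part has the same mass as its positive part. [A] is free
    where [g] vanishes, so Yatracos sets, which contain the ties, qualify. *)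
Lemma Rintegral_norm_split A : measurable A ->
  (forall x, A x -> 0 <= g x) -> (forall x, ~ A x -> g x <= 0) ->
  \int[mu]_x `|g x| = 2 * \int[mu]_(x in A) g x.
Proof.
move=> mA gA gN; have := g0; rewrite (RintegralTE mA ig) => e0.
rewrite (RintegralTE mA); last exact: integrable_norm.
rewrite (@eq_Rintegral _ _ _ mu A g)//; last first.
  by move=> x; rewrite inE => /gA /ger0_norm.
rewrite (@eq_Rintegral _ _ _ mu (~` A) (fun x => -1 * g x)); last first.
  by move=> x; rewrite inE => /gN /ler0_norm ->; rewrite mulN1r.
rewrite RintegralZl//; [lra|exact: measurableC|exact/igA/measurableC].
Qed.

Lemma norm_Rintegral_le A : measurable A ->
  `|\int[mu]_(x in A) g x| <= 2^-1 * \int[mu]_x `|g x|.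
Proof.
move=> mA; have := g0; rewrite (RintegralTE mA ig) => e0.
rewrite (RintegralTE mA (integrable_norm ig)).
have := le_normr_Rintegral mA (igA mA).
have := le_normr_Rintegral (measurableC mA) (igA (measurableC mA)).
rewrite (_ : \int[mu]_(t in ~` A) g t = - \int[mu]_(t in A) g t) ?normrN; lra.
Qed.

End scheffe.

Section tv_theory.
Local Open Scope charge_scope.
Context {disp : measure_display} {T : measurableType disp} {R : realType}.
Variables P Q : probability T R.

Let rn (P0 : probability T R) x :=
  ('d (charge_of_finite_measure P0) '/d (padd P Q)) x.

Let domP : charge_of_finite_measure P `<< padd P Q.
Proof.
apply/null_content_dominatesP => A mA.
rewrite [X in X = _ -> _](_ : _ = P A + Q A)%E; last exact: measure_addE.
move=> /eqP; by rewrite padde_eq0// => /andP[/eqP ? _].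
Qed.

Let domQ : charge_of_finite_measure Q `<< padd P Q.
Proof.
apply/null_content_dominatesP => A mA.
rewrite [X in X = _ -> _](_ : _ = P A + Q A)%E; last exact: measure_addE.
move=> /eqP; by rewrite padde_eq0// => /andP[_ /eqP ?].
Qed.

Let rnP := fun x => fine (rn P x).
Let rnQ := fun x => fine (rn Q x).

Let rnPE x : rn P x = (rnP x)%:E.
Proof. by rewrite /rnP fineK// Radon_Nikodym_fin_num. Qed.
Let rnQE x : rn Q x = (rnQ x)%:E.
Proof. by rewrite /rnQ fineK// Radon_Nikodym_fin_num. Qed.

Let irnP : (padd P Q).-integrable setT (EFin \o rnP).
Proof.
rewrite (_ : EFin \o _ = rn P); first exact: Radon_Nikodym_integrable.
by apply/funext => x /=; rewrite -rnPE.
Qed.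

Let irnQ : (padd P Q).-integrable setT (EFin \o rnQ).
Proof.
rewrite (_ : EFin \o _ = rn Q); first exact: Radon_Nikodym_integrable.
by apply/funext => x /=; rewrite -rnQE.
Qed.

Let irnB : (padd P Q).-integrable setT (EFin \o (fun x => rnP x - rnQ x)).
Proof.
rewrite (_ : EFin \o _ = (EFin \o rnP) \- (EFin \o rnQ))%E; last first.
  by apply/funext => x /=; rewrite EFinB.
exact: integrableB.
Qed.

Let rn_int A : measurable A ->
  fine (P A) - fine (Q A) = \int[padd P Q]_(x in A) (rnP x - rnQ x).
Proof.
move=> mA; rewrite RintegralB//; [|exact: integrableS irnP|exact: integrableS irnQ].
congr (fine _ - fine _).
  rewrite -[LHS]/(charge_of_finite_measure P A) (Radon_Nikodym_integral domP)//.
  by apply: eq_integral => x _; rewrite -rnPE.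
rewrite -[LHS]/(charge_of_finite_measure Q A) (Radon_Nikodym_integral domQ)//.
by apply: eq_integral => x _; rewrite -rnQE.
Qed.

Let rn_int0 : \int[padd P Q]_x (rnP x - rnQ x) = 0.
Proof. by rewrite -rn_int// !probability_setT subrr. Qed.

Lemma tvE : tv P Q = (2^-1 * \int[padd P Q]_x `|rnP x - rnQ x|)%:E.
Proof.
rewrite /tv EFinM /Rintegral fineK; last first.
  exact: (integrable_fin_num measurableT (integrable_norm irnB)).
congr *%E; apply: eq_integral => x _.
by rewrite -/(rn P x) -/(rn Q x) rnPE rnQE.
Qed.

Lemma tv_fin_num : tv P Q \is a fin_num.
Proof. by rewrite tvE. Qed.

Lemma measurable_yatracos_set : measurable (yatracos_set P Q).
Proof.
rewrite /yatracos_set -/(rn P) -/(rn Q).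
rewrite (_ : [set _ | _] = [set x | 0 <= rnP x - rnQ x]).
  apply: measurable_ge0_set; apply/measurable_EFinP; exact: measurable_int irnB.
apply/seteqP; split => x /=; rewrite -/(rn P x) -/(rn Q x) rnPE rnQE lee_fin; lra.
Qed.

(** Scheffe's identity: the bound of [le_tv] is attained on the Yatracos set of the pair, so testing
    two laws on that single set recovers their whole distance. *)
Lemma tv_yatracosE :
  fine (tv P Q) = fine (P (yatracos_set P Q)) - fine (Q (yatracos_set P Q)).
Proof.
rewrite tvE rn_int; last exact: measurable_yatracos_set.
rewrite (@Rintegral_norm_split _ _ _ _ _ irnB rn_int0 (yatracos_set P Q)).
- by rewrite mulKf.
- exact: measurable_yatracos_set.
- by move=> x; rewrite /yatracos_set /= -/(rn P x) -/(rn Q x) rnPE rnQE lee_fin; lra.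
- move=> x; rewrite /yatracos_set /= -/(rn P x) -/(rn Q x) rnPE rnQE lee_fin.
  by move/negP; rewrite -ltNge; lra.
Qed.

Lemma le_tv A : measurable A -> `|fine (P A) - fine (Q A)| <= fine (tv P Q).
Proof. by move=> mA; rewrite tvE rn_int//; exact: norm_Rintegral_le. Qed.

End tv_theory.

Lemma ge0_integralZ_EFin disp (T : measurableType disp) (R : realType)
    (mu : {measure set T -> \bar R}) (f : T -> R) (k : R) :
  0 <= k -> (forall x, 0 <= f x) -> measurable_fun setT f ->
  (\int[mu]_x (k * f x)%:E = k%:E * \int[mu]_x (f x)%:E)%E.
Proof.
move=> k0 f0 mf; rewrite -ge0_integralZl_EFin//.
- by move=> x _; rewrite lee_fin.
- exact/measurable_EFinP.
Qed.

(** * Integration on the product space *)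

Section lebesgue_integrals.
Context {R : realType}.
Local Open Scope ereal_scope.

Lemma integral_lebS d (f : rspace R d.+1 -> \bar R) :
  measurable_fun setT f -> (forall x, 0 <= f x) ->
  \int[leb d.+1]_x f x =
  \int[lebesgue_measure]_x \int[leb d]_t f (tcons (x, t)).
Proof.
move=> mf f0.
transitivity (\int[@lebesgue_measure R \x leb d]_z (f \o @tcons R d) z).
  by rewrite -(@ge0_integral_pushforward _ _ _ _ _ _ (@measurable_tcons R d) _ setT).
rewrite (fubini_tonelli1 (f \o @tcons R d))//.
  exact: measurableT_comp (@measurable_tcons R d).
by move=> x; exact: f0.
Qed.

Lemma measurable_prod_tnth d (g : 'I_d -> measurableTypeR R -> R) :
  (forall i, measurable_fun setT (g i)) ->
  measurable_fun setT (fun x : rspace R d => \prod_(i < d) g i (tnth x i))%R.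
Proof.
move=> mg; apply: measurable_prod => i _.
exact: (measurableT_comp (mg i) (@measurable_tnth _ (measurableTypeR R) d i)).
Qed.

Lemma integral_leb_prod d (g : 'I_d -> measurableTypeR R -> R) :
  (forall i, measurable_fun setT (g i)) -> (forall i x, (0 <= g i x)%R) ->
  \int[leb d]_x (\prod_(i < d) g i (tnth x i))%:E =
  \prod_(i < d) \int[lebesgue_measure]_x (g i x)%:E.
Proof.
elim: d g => [|d IH] g mg g0.
  under eq_integral do rewrite big_ord0.
  by rewrite big_ord0 integral_cst//= diracT mule1.
rewrite integral_lebS; last 2 first.
- by apply/measurable_EFinP; exact: measurable_prod_tnth.
- by move=> x; rewrite lee_fin prodr_ge0.
rewrite big_ord_recl -(IH (fun i => g (lift ord0 i)))//.
transitivity (\int[lebesgue_measure]_x ((g ord0 x)%:E *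
   \int[leb d]_t (\prod_(i < d) g (lift ord0 i) (tnth t i))%:E)).
  apply: eq_integral => x _; rewrite -ge0_integralZl_EFin//.
  - apply: eq_integral => t _; rewrite -EFinM big_ord_recl; congr (_ * _)%:E.
    by apply: eq_bigr => i _; rewrite tnthS.
  - by move=> t _; rewrite lee_fin prodr_ge0.
  - apply/measurable_EFinP.
    exact: (measurable_prod_tnth (fun i => mg (lift ord0 i))).
rewrite ge0_integralZr//.
- exact/measurable_EFinP.
- by move=> x _; rewrite lee_fin.
- by apply: integral_ge0 => t _; rewrite lee_fin prodr_ge0.
Qed.

Lemma measurable_gauss (a m : R) : measurable_fun setT
  (fun z : measurableTypeR R => expR (- (z - m) ^+ 2 / a)).
Proof.
apply: measurableT_comp => //.
apply: measurable_funM => //; apply: measurableT_comp => //.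
by apply: measurable_funX; exact: measurable_funB.
Qed.

(** Read off from the total mass 1 of the normal density of variance [a / 2]. *)
Lemma integral_gauss1 (a m : R) : (0 < a)%R ->
  \int[lebesgue_measure]_x (expR (- (x - m) ^+ 2 / a))%:E =
  (Num.sqrt (pi * a))%:E.
Proof.
move=> a0; have mexp := measurable_gauss a m.
pose s := Num.sqrt (a / 2).
have s0 : (s != 0)%R by rewrite gt_eqF// sqrtr_gt0 divr_gt0.
have s2 : (s ^+ 2 *+ 2 = a)%R.
  by rewrite sqr_sqrtr ?divr_ge0 ?ltW// -mulr_natr divfK.
have := integral_normal_pdf m s.
under eq_integral do rewrite normal_pdfE// /normal_fun s2.
have pk : (0 < normal_peak s)%R by exact: normal_peak_gt0.
rewrite ge0_integralZ_EFin; last 3 first.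
- exact: ltW.
- by move=> x; exact: expR_ge0.
- exact: mexp.
have -> : normal_peak s = ((Num.sqrt (pi * a))^-1)%R.
  by rewrite /normal_peak -mulrnAl s2 mulrC.
set I := \int[_]_x _.
move=> /(congr1 (fun z => (Num.sqrt (pi * a))%:E * z)).
rewrite muleA -EFinM divff ?mul1e ?mule1//.
by rewrite gt_eqF// sqrtr_gt0 mulr_gt0// pi_gt0.
Qed.

End lebesgue_integrals.

Section gaussian_integral.
Context {R : realType} (d : nat).
Implicit Types x y m : rspace R d.

Definition sqn x : R := \sum_(i < d) tnth x i ^+ 2.

Lemma measurable_sqn : measurable_fun setT sqn.
Proof.
apply: measurable_sum => i; apply: measurable_funX; exact: measurable_tnth.
Qed.

Lemma measurable_rsub :
  measurable_fun setT (fun z : rspace R d * rspace R d => rsub z.1 z.2).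
Proof.
apply/measurable_fun_tnthP => i.
rewrite (_ : _ \o _ = (fun z => tnth z.1 i - tnth z.2 i)); last first.
  by apply/funext => z /=; rewrite tnth_mktuple.
apply: measurable_funB.
  exact: (measurableT_comp (measurable_tnth i) measurable_fst).
exact: (measurableT_comp (measurable_tnth i) measurable_snd).
Qed.

Lemma measurable_rsubl y : measurable_fun setT (fun x => rsub x y).
Proof.
apply/measurable_fun_tnthP => i.
rewrite (_ : _ \o _ = (fun z => tnth z i - tnth y i)); last first.
  by apply/funext => z /=; rewrite tnth_mktuple.
by apply: measurable_funB => //; exact: measurable_tnth.
Qed.

Definition gauss_vol (a : R) := Num.sqrt (pi * a) ^+ d.

Lemma gauss_vol_gt0 (a : R) : 0 < a -> 0 < gauss_vol a.
Proof. by move=> a0; rewrite exprn_gt0// sqrtr_gt0 mulr_gt0// pi_gt0. Qed.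

(** The exponent is asked for in completed-square form, so that later Gaussian products only have to
    name the centre [m] and the constant [C]. *)
Lemma integral_gauss (a C : R) m (f : rspace R d -> R) : 0 < a ->
  (forall x, f x = expR (C - \sum_(i < d) (tnth x i - tnth m i) ^+ 2 / a)) ->
  (\int[leb d]_x (f x)%:E)%E = (gauss_vol a * expR C)%:E.
Proof.
move=> a0 fE.
have mexp (i : 'I_d) := measurable_gauss a (tnth m i).
transitivity (\int[leb d]_x (expR C *
   \prod_(i < d) expR (- (tnth x i - tnth m i) ^+ 2 / a))%:E)%E.
  apply: eq_integral => x _; rewrite fE expRD -expR_sum; congr (_ * expR _)%:E.
  by rewrite -sumrN; apply: eq_bigr => i _; rewrite mulNr.
rewrite ge0_integralZ_EFin; last 3 first.
- exact: expR_ge0.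
- by move=> x; apply: prodr_ge0 => i _; exact: expR_ge0.
- exact: (measurable_prod_tnth mexp).
rewrite (integral_leb_prod mexp); last by move=> *; rewrite expR_ge0.
under eq_bigr do rewrite integral_gauss1//.
rewrite prodEFin -EFinM mulrC; congr (_ * _)%:E.
by rewrite prodr_const card_ord.
Qed.

End gaussian_integral.

Section bilinear.
Local Open Scope ereal_scope.
Context {R : realType} {dX dT : measure_display} {X : measurableType dX}
  {T : measurableType dT}.
Variables (m : {sigma_finite_measure set X -> \bar R})
  (p q : probability T R) (k k' : X * T -> R) (w : X -> R).
Hypotheses (mk : measurable_fun setT k) (mk' : measurable_fun setT k')
  (mw : measurable_fun setT w).
Hypotheses (k0 : forall z, (0 <= k z)%R) (k'0 : forall z, (0 <= k' z)%R)
  (w0 : forall x, (0 <= w x)%R).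

(** All factors are nonnegative, so Tonelli applies twice with no integrability condition.
    Differences of laws are treated later, term by term. *)
Lemma integral_bilinear :
  \int[m]_x (\int[p]_t (k (x, t))%:E * \int[q]_s (k' (x, s))%:E * (w x)%:E) =
  \int[p]_t \int[q]_s \int[m]_x (k (x, t) * k' (x, s) * w x)%:E.
Proof.
pose F (z : (X * T) * T) := ((k z.1 * k' (z.1.1, z.2) * w z.1.1)%R)%:E.
have mF : measurable_fun setT F.
  apply/measurable_EFinP; apply: measurable_funM; last first.
    by apply: measurableT_comp => //; apply: measurableT_comp => //; exact: measurable_fst.
  apply: measurable_funM; first by apply: measurableT_comp.
  apply: measurableT_comp => //; apply: measurable_fun_pair => //.
  by apply: measurableT_comp => //; exact: measurable_fst.
have F0 z : 0 <= F z by rewrite lee_fin !mulr_ge0.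
have mkx x : measurable_fun setT (fun t => (k (x, t))%:E).
  by apply/measurable_EFinP; apply: measurableT_comp.
have mk'x x : measurable_fun setT (fun t => (k' (x, t))%:E).
  by apply/measurable_EFinP; apply: measurableT_comp.
transitivity (\int[m]_x \int[p]_t (fubini_F q F) (x, t)).
  apply: eq_integral => x _.
  have intk' : 0 <= \int[q]_s (k' (x, s))%:E.
    by apply: integral_ge0 => s _; rewrite lee_fin.
  rewrite -muleA -ge0_integralZr//; last 2 first.
  - by move=> t _; rewrite lee_fin.
  - by rewrite mule_ge0// lee_fin.
  apply: eq_integral => t _; rewrite muleA muleAC -EFinM /fubini_F/=.
  rewrite -ge0_integralZl_EFin//; last 2 first.
  - by move=> s _; rewrite lee_fin.
  - by rewrite mulr_ge0.
  by apply: eq_integral => s _; rewrite -EFinM mulrAC.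
rewrite (fubini_tonelli (fubini_F q F)); last 2 first.
- exact: measurable_fun_fubini_tonelli_F.
- by move=> z; apply: integral_ge0.
apply: eq_integral => t _.
rewrite /fubini_F/= (fubini_tonelli (fun z : X * T => F ((z.1, t), z.2)))//.
apply: measurableT_comp => //; apply: measurable_fun_pair => //.
by apply: measurable_fun_pair => //; exact: measurable_fst.
Qed.

End bilinear.

(** * Bounded integrands and quadratic forms of a difference of two laws *)

Section bounded_measurable.
Context {R : realType} {disp : measure_display} {T : measurableType disp}.
Implicit Types f g : T -> R.

(** A class closed under algebra and partial integration whose members are integrable against every
    probability: integrability side conditions reduce to membership. *)
Definition bdmeas f := measurable_fun setT f /\ exists B, forall x, `|f x| <= B.

Lemma bdmeas_cst (c : R) : bdmeas (fun=> c).
Proof. by split; [exact: measurable_cst|exists `|c|]. Qed.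

Lemma bdmeasD f g : bdmeas f -> bdmeas g -> bdmeas (fun x => f x + g x).
Proof.
move=> [mf [B fB]] [mg [C gC]]; split; first exact: measurable_funD.
exists (B + C) => x; exact: le_trans (ler_normD _ _) (lerD _ _).
Qed.

Lemma bdmeasM f g : bdmeas f -> bdmeas g -> bdmeas (fun x => f x * g x).
Proof.
move=> [mf [B fB]] [mg [C gC]]; split; first exact: measurable_funM.
by exists (B * C) => x; rewrite normrM ler_pM.
Qed.

Lemma bdmeasB f g : bdmeas f -> bdmeas g -> bdmeas (fun x => f x - g x).
Proof.
move=> bf bg; rewrite (_ : (fun _ => _) = (fun x => f x + -1 * g x)).
  exact: bdmeasD (bdmeasM (bdmeas_cst _) bg).
by apply/funext => x; rewrite mulN1r.
Qed.

Lemma bdmeas_sum (I : Type) (r : seq I) (P : pred I) (h : I -> T -> R) :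
  (forall i, bdmeas (h i)) -> bdmeas (fun x => \sum_(i <- r | P i) h i x).
Proof.
move=> bh; elim: r => [|i r IH].
  by under eq_fun do rewrite big_nil; exact: bdmeas_cst.
under eq_fun do rewrite big_cons.
by case: (P i) => //; exact: bdmeasD.
Qed.

Lemma bdmeas_prod (I : Type) (r : seq I) (P : pred I) (h : I -> T -> R) :
  (forall i, bdmeas (h i)) -> bdmeas (fun x => \prod_(i <- r | P i) h i x).
Proof.
move=> bh; elim: r => [|i r IH].
  by under eq_fun do rewrite big_nil; exact: bdmeas_cst.
under eq_fun do rewrite big_cons.
by case: (P i) => //; exact: bdmeasM.
Qed.

Lemma bdmeas_integrable (mu : {finite_measure set T -> \bar R}) f :
  bdmeas f -> mu.-integrable setT (EFin \o f).
Proof.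
move=> [mf [B fB]]; apply: (@le_integrable _ _ _ mu setT _ _ (cst B%:E)) => //.
- exact/measurable_EFinP.
- by move=> x _ /=; rewrite lee_fin (le_trans (fB x))// ler_norm.
- exact: finite_measure_integrable_cst.
Qed.

End bounded_measurable.

Lemma bdmeas_comp {R : realType} {d1 d2} {T1 : measurableType d1}
    {T2 : measurableType d2} (f : T2 -> R) (h : T1 -> T2) :
  measurable_fun setT h -> bdmeas f -> bdmeas (f \o h).
Proof.
move=> mh [mf [B fB]]; split; first exact: measurableT_comp.
by exists B => x /=.
Qed.

Section bounded_integrals.
Context {R : realType} {disp : measure_display} {T : measurableType disp}.
Variable p : probability T R.
Implicit Types f g : T -> R.

Lemma RintegralE f : bdmeas f -> (\int[p]_x f x)%:E = (\int[p]_x (f x)%:E)%E.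
Proof.
move=> bf; rewrite /Rintegral fineK//.
exact: (integrable_fin_num measurableT (bdmeas_integrable p bf)).
Qed.

Lemma Rintegral_addE f g : bdmeas f -> bdmeas g ->
  \int[p]_x (f x + g x) = \int[p]_x f x + \int[p]_x g x.
Proof. by move=> bf bg; rewrite RintegralD//; exact: bdmeas_integrable. Qed.

Lemma Rintegral_scaleE (c : R) f : bdmeas f ->
  \int[p]_x (c * f x) = c * \int[p]_x f x.
Proof. by move=> bf; rewrite RintegralZl//; exact: bdmeas_integrable. Qed.

Lemma Rintegral_cstE (c : R) : \int[p]_x c = c.
Proof.
rewrite Rintegral_cst//; have -> : fine (p setT) = 1 by rewrite probability_setT.
by rewrite mulr1.
Qed.

Lemma Rintegral_sumE (I : Type) (r : seq I) (h : I -> T -> R) :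
  (forall i, bdmeas (h i)) ->
  \int[p]_x (\sum_(i <- r) h i x) = \sum_(i <- r) \int[p]_x h i x.
Proof.
move=> bh; elim: r => [|i r IH].
  under eq_Rintegral do rewrite big_nil.
  by rewrite Rintegral_cstE big_nil.
under eq_Rintegral do rewrite big_cons.
by rewrite big_cons Rintegral_addE ?IH//; exact: bdmeas_sum.
Qed.

Lemma Rintegral_norm_le (e : R) f : bdmeas f -> (forall x, `|f x| <= e) ->
  `|\int[p]_x f x| <= e.
Proof.
move=> bf fe; apply: le_trans (le_normr_Rintegral _ _) _ => //.
  exact: bdmeas_integrable.
rewrite -[leRHS]Rintegral_cstE le_Rintegral//.
- exact: integrable_norm (bdmeas_integrable p bf).
- exact: bdmeas_integrable (bdmeas_cst _).
Qed.

Lemma Rintegral_approx (e : R) f g : bdmeas f -> bdmeas g ->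
  (forall x, `|f x - g x| <= e) -> `|\int[p]_x f x - \int[p]_x g x| <= e.
Proof.
move=> bf bg fge; rewrite -RintegralB//; [|exact: bdmeas_integrable..].
by apply: Rintegral_norm_le => //; exact: bdmeasB.
Qed.

End bounded_integrals.

Section partial_integral.
Context {R : realType} {d1 d2 : measure_display} {X : measurableType d1}
  {T : measurableType d2} (p : probability T R).

Lemma bdmeas_fst (k : X * T -> R) x : bdmeas k -> bdmeas (fun t => k (x, t)).
Proof.
move=> bk; apply: (bdmeas_comp (h := fun t => (x, t))) bk.
exact: measurable_fun_pair.
Qed.

Lemma bdmeas_int (k : X * T -> R) : bdmeas k ->
  bdmeas (fun x => \int[p]_t k (x, t)).
Proof.
move=> bk; have [mk [B kB]] := bk; split; last first.
  exists B => x; apply: Rintegral_norm_le => //; exact: bdmeas_fst.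
apply/measurable_EFinP.
(* Adding the bound [B] makes the integrand nonnegative, as Tonelli's measurability statement
   requires; the constant is subtracted afterwards. *)
rewrite (_ : _ \o _ = fun x => (\int[p]_t (k (x, t) + B)%:E) - B%:E)%E; last first.
  apply/funext => x /=; rewrite -(RintegralE p (f := fun t => k (x, t) + B)).
    rewrite Rintegral_addE ?Rintegral_cstE ?addrK//; first by rewrite -EFinB addrK.
      exact: bdmeas_fst.
    exact: bdmeas_cst.
  by apply: bdmeasD (bdmeas_cst _); exact: bdmeas_fst.
apply: emeasurable_funB => //.
apply: (measurable_fun_fubini_tonelli_F (fun z => (k z + B)%:E)) => //.
  by apply/measurable_EFinP; apply: measurable_funD.
by move=> z; rewrite lee_fin; have := kB z; rewrite ler_norml; lra.
Qed.

End partial_integral.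

Section signed_forms.
Context {R : realType} {disp : measure_display} {T : measurableType disp}.
Variables (p q : probability T R).

(** [nu] and [nunu] are the signed measure p - q and its tensor square, kept as combinations of
    integrals against probabilities so that only results on probabilities are used. *)
Definition nu (g : T -> R) : R := \int[p]_t g t - \int[q]_t g t.

Definition biint (p1 p2 : probability T R) (F : T * T -> R) : R :=
  \int[p1]_t \int[p2]_s F (t, s).

Definition nunu (F : T * T -> R) : R :=
  biint p p F + biint q q F - biint p q F - biint q p F.

Lemma biint_approx (p1 p2 : probability T R) (F : T * T -> R) (I : finType)
    (a : I -> R) (g : I -> T -> R) (e : R) :
  bdmeas F -> (forall i, bdmeas (g i)) ->
  (forall t s, `|F (t, s) - \sum_i a i * (g i t * g i s)| <= e) ->
  `|biint p1 p2 F - \sum_i a i * (\int[p1]_t g i t * \int[p2]_t g i t)| <= e.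
Proof.
move=> bF bg Fe.
pose G t := \sum_i a i * (g i t * \int[p2]_s g i s).
have bagg i : bdmeas (fun t => a i * (g i t * \int[p2]_s g i s)).
  apply: bdmeasM (bdmeas_cst _) _.
  by apply: bdmeasM => //; exact: bdmeas_cst.
have bG : bdmeas G by exact: bdmeas_sum.
have -> : \sum_i a i * (\int[p1]_t g i t * \int[p2]_t g i t) = \int[p1]_t G t.
  rewrite Rintegral_sumE//; apply: eq_bigr => i _.
  rewrite Rintegral_scaleE; last by apply: bdmeasM => //; exact: bdmeas_cst.
  by rewrite RintegralZr//; exact: bdmeas_integrable.
apply: Rintegral_approx => //; first exact: bdmeas_int.
move=> t.
have bags i : bdmeas (fun s => a i * (g i t * g i s)).
  apply: bdmeasM (bdmeas_cst _) _.
  by apply: bdmeasM => //; exact: bdmeas_cst.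
have -> : G t = \int[p2]_s (\sum_i a i * (g i t * g i s)).
  rewrite Rintegral_sumE//; apply: eq_bigr => i _.
  rewrite Rintegral_scaleE; last by apply: bdmeasM => //; exact: bdmeas_cst.
  by rewrite Rintegral_scaleE.
by apply: Rintegral_approx => //; [exact: bdmeas_fst|exact: bdmeas_sum].
Qed.

(** A kernel uniformly close to a diagonal sum of products has a form close to a weighted sum of
    squared moments, which makes two kernels comparable degree by degree. Each of the four terms of
    [nunu] costs [e]. *)
Lemma nunu_approx (F : T * T -> R) (I : finType)
    (a : I -> R) (g : I -> T -> R) (e : R) :
  bdmeas F -> (forall i, bdmeas (g i)) ->
  (forall t s, `|F (t, s) - \sum_i a i * (g i t * g i s)| <= e) ->
  `|nunu F - \sum_i a i * nu (g i) ^+ 2| <= 4 * e.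
Proof.
move=> bF bg Fe.
have := biint_approx p p bF bg Fe; have := biint_approx q q bF bg Fe.
have := biint_approx p q bF bg Fe; have := biint_approx q p bF bg Fe.
have -> : \sum_i a i * nu (g i) ^+ 2 =
    \sum_i a i * (\int[p]_t g i t * \int[p]_t g i t) +
    \sum_i a i * (\int[q]_t g i t * \int[q]_t g i t) -
    \sum_i a i * (\int[p]_t g i t * \int[q]_t g i t) -
    \sum_i a i * (\int[q]_t g i t * \int[p]_t g i t).
  rewrite -!sumrN -!big_split/=; apply: eq_bigr => i _; rewrite /nu; ring.
rewrite /nunu !ler_norml; lra.
Qed.

Lemma nuM (c : R) g : bdmeas g -> nu (fun t => c * g t) = c * nu g.
Proof. by move=> bg; rewrite /nu !Rintegral_scaleE// mulrBr. Qed.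

Lemma nu_sum (I : Type) (r : seq I) (h : I -> T -> R) :
  (forall i, bdmeas (h i)) ->
  nu (fun t => \sum_(i <- r) h i t) = \sum_(i <- r) nu (h i).
Proof. by move=> bh; rewrite /nu !Rintegral_sumE// sumrB. Qed.

Lemma nu_approx (e : R) f g : bdmeas f -> bdmeas g ->
  (forall x, `|f x - g x| <= e) -> `|nu f - nu g| <= 2 * e.
Proof.
move=> bf bg fge.
have := Rintegral_approx p bf bg fge; have := Rintegral_approx q bf bg fge.
rewrite /nu !ler_norml; lra.
Qed.

Lemma nu_le (e : R) f : bdmeas f -> (forall x, `|f x| <= e) -> `|nu f| <= 2 * e.
Proof.
move=> bf fe.
have := Rintegral_norm_le p bf fe; have := Rintegral_norm_le q bf fe.
rewrite /nu !ler_norml; lra.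
Qed.

End signed_forms.

Section bilinear_difference.
Context {R : realType} {dX dT : measure_display} {X : measurableType dX}
  {T : measurableType dT}.
Variables (m : {sigma_finite_measure set X -> \bar R})
  (p q : probability T R) (k k' : X * T -> R) (w : X -> R) (F : T * T -> R).
Hypotheses (bk : bdmeas k) (bk' : bdmeas k') (bF : bdmeas F)
  (mw : measurable_fun setT w).
Hypotheses (k0 : forall z, 0 <= k z) (k'0 : forall z, 0 <= k' z)
  (w0 : forall x, 0 <= w x).
Hypothesis FE : forall t s,
  (\int[m]_x (k (x, t) * k' (x, s) * w x)%:E)%E = (F (t, s))%:E.

Let term (p1 p2 : probability T R) x :=
  \int[p1]_t k (x, t) * \int[p2]_t k' (x, t) * w x.

Let term_ge0 p1 p2 x : 0 <= term p1 p2 x.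
Proof. by rewrite !mulr_ge0//; apply: Rintegral_ge0. Qed.

Let mterm p1 p2 : measurable_fun setT (term p1 p2).
Proof.
apply: measurable_funM => //; apply: measurable_funM.
  by have [] := bdmeas_int p1 bk.
by have [] := bdmeas_int p2 bk'.
Qed.

Let int_term p1 p2 : (\int[m]_x (term p1 p2 x)%:E)%E = (biint p1 p2 F)%:E.
Proof.
transitivity (\int[m]_x (\int[p1]_t (k (x, t))%:E *
    \int[p2]_s (k' (x, s))%:E * (w x)%:E))%E.
  by apply: eq_integral => x _; rewrite -!RintegralE//; exact: bdmeas_fst.
rewrite integral_bilinear//; [|by case: bk|by case: bk'].
rewrite /biint RintegralE; last exact: bdmeas_int.
apply: eq_integral => t _; rewrite RintegralE; last exact: bdmeas_fst.
by apply: eq_integral => s _.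
Qed.

Let iterm p1 p2 : m.-integrable setT (EFin \o term p1 p2).
Proof.
apply/integrableP; split; first exact/measurable_EFinP.
under eq_integral do rewrite /= ger0_norm//.
by rewrite int_term ltry.
Qed.

Let D x := (\int[p]_t k (x, t) - \int[q]_t k (x, t)) *
           (\int[p]_t k' (x, t) - \int[q]_t k' (x, t)) * w x.

Let DE : EFin \o D = (((EFin \o term p p) \+ (EFin \o term q q)) \-
  ((EFin \o term p q) \+ (EFin \o term q p)))%E.
Proof.
apply/funext => x.
transitivity ((term p p x + term q q x - (term p q x + term q p x))%:E).
  by rewrite /=; congr (_%:E); rewrite /D /term; ring.
by rewrite EFinB !EFinD.
Qed.

(** Expanding the product gives four nonnegative terms with the finite integrals [biint], so the
    signed integrand never meets Tonelli directly. *)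
Lemma integrable_bilinear_diff : m.-integrable setT (EFin \o D).
Proof. by rewrite DE; apply: integrableB => //; exact: integrableD. Qed.

Lemma integral_bilinear_diff : \int[m]_x D x = nunu p q F.
Proof.
rewrite /Rintegral.
transitivity (fine (\int[m]_x (EFin \o D) x)%E) => //.
rewrite DE integralB//; [|exact: integrableD..].
rewrite !integralD// !int_term /= /nunu; ring.
Qed.

End bilinear_difference.

(** * Moment comparison *)

Section truncated_exponential.
Context {R : realType}.
Implicit Types (x y rho : R) (K N : nat).

Definition expK K y : R := \sum_(k < K) y ^+ k / k`!%:R.

Lemma expKE K y : expK K y = series (exp_coeff y) K.
Proof. by rewrite /expK /series/= big_mkord. Qed.

Lemma expK_ge0 K y : 0 <= y -> 0 <= expK K y.
Proof. by move=> y0; apply: sumr_ge0 => k _; rewrite divr_ge0// exprn_ge0. Qed.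

Lemma expK_le K y : 0 <= y -> expK K y <= expR y.
Proof.
move=> y0; rewrite expKE; apply: nondecreasing_cvgn_le.
  by apply: nondecreasing_series => n _ _; exact: exp_coeff_ge0.
exact: is_cvg_series_exp_coeff.
Qed.

Lemma norm_expK_le K y : `|expK K y| <= expR `|y|.
Proof.
apply: le_trans (expK_le K (normr_ge0 y)).
apply: le_trans (ler_norm_sum _ _ _) _; apply: ler_sum => k _.
by rewrite normrM normrX normfV (ger0_norm (ler0n _ _)).
Qed.

Lemma exp_term_le k y : 0 <= y -> y ^+ k / k`!%:R <= expR y.
Proof.
move=> y0; apply: le_trans (expK_le k.+1 y0).
rewrite /expK big_ord_recr/= lerDr; exact: expK_ge0.
Qed.

(** Multiplying the term of degree k >= K by rho^(k-K) >= 1 turns the tail into rho^-K times part of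
    the series at [rho * |y|]. The free ratio is used three times: rho = K for the moment
    comparison, rho = 2 for the covering, rho = 1/l for Chernoff's bound. *)
Lemma expK_tail K y rho : 1 <= rho ->
  `|expR y - expK K y| <= rho ^- K * expR (rho * `|y|).
Proof.
move=> r1; have r0 : 0 < rho by exact: lt_le_trans r1.
have tail N : `|expK (K + N) y - expK K y| <= rho ^- K * expR (rho * `|y|).
  rewrite /expK big_split_ord/= addrAC subrr add0r.
  have ry : 0 <= rho * `|y| by rewrite mulr_ge0// ltW.
  apply: (@le_trans _ _ (rho ^- K * expK (K + N) (rho * `|y|))); last first.
    by rewrite ler_pM2l ?invr_gt0 ?exprn_gt0//; exact: expK_le.
  rewrite mulrC ler_pdivlMr ?exprn_gt0// /expK big_split_ord/=.
  rewrite ler_wpDl//; first exact: (expK_ge0 K ry).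
  apply: (le_trans (ler_wpM2r _ (ler_norm_sum _ _ _))).
    by rewrite exprn_ge0// ltW.
  rewrite mulr_suml; apply: ler_sum => k _.
  rewrite normrM normrX normfV (ger0_norm (ler0n _ _)) exprMn mulrAC ler_pM2r; last first.
    by rewrite invr_gt0 ltr0n fact_gt0.
  rewrite mulrC ler_wpM2r ?exprn_ge0//.
  by rewrite exprD ler_peMr ?exprn_ege1// exprn_ge0// ltW.
have cv : `|expK n y - expK K y| @[n --> \oo] --> `|expR y - expK K y|.
  apply: cvg_norm; apply: cvgB; last exact: cvg_cst.
  under eq_fun do rewrite expKE.
  exact: is_cvg_series_exp_coeff.
rewrite -(cvg_lim _ cv)//; apply: limr_le; first by apply/cvg_ex; eexists; exact: cv.
near=> n; have Kn : (K <= n)%N by near: n; exact: nbhs_infty_ge.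
by rewrite -(subnKC Kn); exact: tail.
Unshelve. all: by end_near. Qed.

(** Telescoping: with a common majorant per factor, replacing one factor costs [e] times the full
    product of majorants. *)
Lemma norm_prod_diff_le (I : Type) (r : seq I) (a b A : I -> R) (e : R) :
  0 <= e -> (forall i, `|a i| <= A i) -> (forall i, `|b i| <= A i) ->
  (forall i, `|a i - b i| <= e * A i) ->
  `|\prod_(i <- r) a i - \prod_(i <- r) b i| <=
    (size r)%:R * e * \prod_(i <- r) A i.
Proof.
move=> e0 aA bA abA; elim: r => [|i r IH] /=.
  by rewrite !big_nil subrr normr0 mul0r mul0r.
rewrite !big_cons.
have -> : a i * \prod_(j <- r) a j - b i * \prod_(j <- r) b j =
  (a i - b i) * \prod_(j <- r) a j + b i *
  (\prod_(j <- r) a j - \prod_(j <- r) b j) by ring.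
apply: le_trans (ler_normD _ _) _; rewrite !normrM.
have paA : `|\prod_(j <- r) a j| <= \prod_(j <- r) A j.
  by rewrite normr_prod; apply: ler_prod => j _; rewrite normr_ge0 aA.
apply: le_trans (lerD (ler_pM (normr_ge0 _) (normr_ge0 _) (abA i) paA)
  (ler_pM (normr_ge0 _) (normr_ge0 _) (bA i) IH)) _.
by rewrite -natr1 le_eqVlt; apply/orP; left; apply/eqP; ring.
Qed.

(** Truncating every coordinate instead of the total degree keeps a product, which [prod_expKE]
    distributes into a sum over a finite type of multi-indices. *)
Lemma prod_expK_tail d K (y : 'I_d -> R) rho : 1 <= rho ->
  `|expR (\sum_i y i) - \prod_i expK K (y i)| <=
  d%:R * rho ^- K * expR (rho * \sum_i `|y i|).
Proof.
move=> r1; have r0 : 0 < rho by exact: lt_le_trans r1.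
have le_rho (z : R) : expR `|z| <= expR (rho * `|z|) :> R.
  by rewrite ler_expR ler_peMl.
rewrite expR_sum mulr_sumr expR_sum.
have := @norm_prod_diff_le _ (index_enum 'I_d) (fun i => expR (y i))
  (fun i => expK K (y i)) (fun i => expR (rho * `|y i|)) (rho ^- K).
have -> : size (index_enum 'I_d) = d by rewrite /index_enum -enumT size_enum_ord.
apply.
- by rewrite invr_ge0 exprn_ge0// ltW.
- move=> i; rewrite ger0_norm ?expR_ge0//; apply: (le_trans _ (le_rho _)).
  by rewrite ler_expR ler_norm.
- by move=> i; exact: (le_trans (norm_expK_le _ _) (le_rho _)).
- by move=> i; exact: expK_tail.
Qed.

Lemma prod_expKE d K (y : 'I_d -> R) : \prod_i expK K (y i) =
  \sum_(f : {ffun 'I_d -> 'I_K}) \prod_i (y i ^+ f i / (f i)`!%:R).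
Proof. by rewrite bigA_distr_bigA. Qed.

End truncated_exponential.

Lemma bdmeas_expR {R : realType} {disp} {T : measurableType disp} (f : T -> R) :
  bdmeas f -> bdmeas (fun x => expR (f x)).
Proof.
move=> [mf [B fB]]; split; first exact: measurableT_comp.
exists (expR B) => x; rewrite ger0_norm ?expR_ge0// ler_expR.
by rewrite (le_trans (ler_norm _))// fB.
Qed.

Lemma bdmeasX {R : realType} {disp} {T : measurableType disp} (f : T -> R) n :
  bdmeas f -> bdmeas (fun x => f x ^+ n).
Proof.
move=> bf; elim: n => [|n IH]; first exact: bdmeas_cst.
by under eq_fun do rewrite exprS; exact: bdmeasM.
Qed.

Lemma binomial_term_le n k a b : (k <= n)%N ->
  ('C(n, k) * (a ^ (n - k) * b ^ k) <= (a + b) ^ n)%N.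
Proof.
rewrite -ltnS => kn; rewrite expnDn (bigD1 (Ordinal kn))//=; exact: leq_addr.
Qed.

(** With n = k + 2j, the left side holds the inverse weight of a squared moment of degree n in the
    expansion of [kerA]; the right side holds k! from [kerQ] and (6^j j!)^2 from undoing the
    damping. The loss between the two is 4^n. *)
Lemma trinomial_bound k j :
  (3 ^ (k + j.*2) * (k + j.*2)`! <= 4 ^ (k + j.*2) * (36 ^ j * (j`! * j`!) * k`!))%N.
Proof.
have h1 : ((k + j.*2)`! = 'C(k + j.*2, k) * (k`! * (j.*2)`!))%N.
  by rewrite -(bin_fact (leq_addr j.*2 k)) addKn.
have h2 : ((j.*2)`! <= 4 ^ j * (j`! * j`!))%N.
  have jj : (j <= j.*2)%N by rewrite -addnn leq_addr.
  have jE : (j.*2 - j = j)%N by rewrite -addnn addnK.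
  have := bin_fact jj; rewrite jE => <-.
  have := binomial_term_le 1 1 jj; rewrite !exp1n !muln1 -mul2n expnM => h.
  by rewrite leq_mul2r h orbT.
(* One term of the binomial expansion of (1 + 3)^n. *)
have h3 : ('C(k + j.*2, k) * 3 ^ k <= 4 ^ (k + j.*2))%N.
  have := binomial_term_le 1 3 (leq_addr j.*2 k).
  by rewrite exp1n mul1n.
have h4 : (3 ^ (k + j.*2) = 3 ^ k * 9 ^ j)%N by rewrite expnD -mul2n expnM.
have h5 : (36 ^ j = 9 ^ j * 4 ^ j)%N by rewrite -expnMn.
rewrite h1 h4 h5.
have := leq_mul h3 (leq_mul (leqnn (9 ^ j * k`!)) h2).
have e1 (x y z u w : nat) : (x * y * (z * u * w) = y * z * (x * (u * w)))%N by lia.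
have e2 (x y z u w : nat) : (x * (y * u * (z * w)) = x * (y * z * w * u))%N by lia.
by rewrite e1 e2.
Qed.

Lemma sqr_sum_le {R : realDomainType} (I : finType) (x : I -> R) :
  (\sum_i x i) ^+ 2 <= #|I|%:R * \sum_i x i ^+ 2.
Proof.
have E1 : \sum_(i : I) \sum_(j : I) x i ^+ 2 = #|I|%:R * \sum_i x i ^+ 2.
  rewrite mulr_sumr; apply: eq_bigr => i _.
  by rewrite mulr_natl sumr_const.
have E2 : \sum_(i : I) \sum_(j : I) x j ^+ 2 = #|I|%:R * \sum_i x i ^+ 2.
  by rewrite mulr_natl sumr_const.
have E3 : (\sum_i x i) ^+ 2 = \sum_i \sum_j x i * x j.
  by rewrite expr2 big_distrlr.
have : 0 <= \sum_i \sum_j (x i - x j) ^+ 2.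
  by apply: sumr_ge0 => i _; apply: sumr_ge0 => j _; exact: sqr_ge0.
have -> : \sum_i \sum_j (x i - x j) ^+ 2 =
  \sum_(i : I) \sum_(j : I) x i ^+ 2 + \sum_(i : I) \sum_(j : I) x j ^+ 2 -
  2 * \sum_i \sum_j x i * x j.
  rewrite mulr_sumr -sumrN -!big_split/=; apply: eq_bigr => i _.
  rewrite mulr_sumr -sumrN -!big_split/=; apply: eq_bigr => j _; ring.
rewrite E1 E2 -E3; lra.
Qed.

Section moments.
Context {R : realType} {disp : measure_display} {T : measurableType disp}.
Variables (p q : probability T R) (d K : nat) (v : 'I_d -> T -> R) (c : T -> R)
  (L : R).
Hypotheses (mv : forall i, measurable_fun setT (v i)) (L0 : 0 <= L)
  (vL : forall i t, `|v i t| <= L).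
Hypotheses (mc : measurable_fun setT c) (c01 : forall t, 0 <= c t <= 1).
Hypothesis K0 : (0 < K)%N.

Notation I := {ffun 'I_d -> 'I_K}.
Notation D := (d%:R : R).

(** [c] will be the indicator of the cube and [v] the coordinates measured from a corner. Putting
    the cutoff into the kernels makes them bounded on the whole space, in particular the exponential
    of the inner product in [kerQ]. *)
Definition kerA (z : T * T) : R :=
  c z.1 * c z.2 * expR (- (\sum_i (v i z.1 - v i z.2) ^+ 2 / 6)).
Definition kerQ (z : T * T) : R :=
  c z.1 * c z.2 * expR (\sum_i v i z.1 * v i z.2).

(** Since exp (-|v - v'|^2 / 6) = ev ev' exp (<v, v'> / 3), expanding [kerA] produces the damped
    moments [b], whereas [kerQ] produces the plain moments [m]. [E a] is the size of the truncation
    errors. *)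
Let mono (n : 'I_d -> nat) t : R := \prod_i v i t ^+ n i.
Let ev t := expR (- (\sum_i v i t ^+ 2 / 6)).
Let b (n : 'I_d -> nat) := nu p q (fun t => c t * ev t * mono n t).
Let m (n : 'I_d -> nat) := nu p q (fun t => c t * mono n t).
Let E (a : R) : R := K%:R ^- K * expR (a * D * L ^+ 2 * K%:R).

Let K1 : 1 <= K%:R :> R. Proof. by rewrite ler1n. Qed.
Let D0 : 0 <= D. Proof. by []. Qed.
Let E0 a : 0 <= E a.
Proof. by rewrite mulr_ge0 ?expR_ge0// invr_ge0 exprn_ge0. Qed.

Let E_le a a' : a <= a' -> E a <= E a'.
Proof.
move=> aa; rewrite /E ler_wpM2l ?invr_ge0 ?exprn_ge0// ler_expR.
by rewrite !ler_wpM2r ?ler0n// sqr_ge0.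
Qed.

Let bc : bdmeas c.
Proof.
split=> //; exists 1 => t; have /andP[c0 c1] := c01 t.
by rewrite ger0_norm.
Qed.
Let bv i : bdmeas (v i). Proof. by split=> //; exists L. Qed.

Let bmono n : bdmeas (mono n).
Proof. by apply: bdmeas_prod => i; exact: bdmeasX. Qed.

Let bev : bdmeas ev.
Proof.
apply: bdmeas_expR; under eq_fun do rewrite -sumrN.
apply: bdmeas_sum => i; under eq_fun do rewrite -mulrN.
by apply: bdmeasM (bdmeas_cst _); exact: bdmeasX.
Qed.

Let bfst (f : T -> R) : bdmeas f -> bdmeas (fun z : T * T => f z.1).
Proof. by move=> bf; exact: (bdmeas_comp measurable_fst bf). Qed.
Let bsnd (f : T -> R) : bdmeas f -> bdmeas (fun z : T * T => f z.2).
Proof. by move=> bf; exact: (bdmeas_comp measurable_snd bf). Qed.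

Lemma bdmeas_kerA : bdmeas kerA.
Proof.
apply: bdmeasM; first by apply: bdmeasM; [exact: bfst|exact: bsnd].
apply: bdmeas_expR; under eq_fun do rewrite -sumrN.
apply: bdmeas_sum => i; under eq_fun do rewrite -mulrN.
apply: bdmeasM (bdmeas_cst _); apply: bdmeasX.
by apply: bdmeasB; [exact: bfst|exact: bsnd].
Qed.

Lemma bdmeas_kerQ : bdmeas kerQ.
Proof.
apply: bdmeasM; first by apply: bdmeasM; [exact: bfst|exact: bsnd].
apply: bdmeas_expR; apply: bdmeas_sum => i.
by apply: bdmeasM; [exact: bfst|exact: bsnd].
Qed.

Let mono_le n t : `|mono n t| <= \prod_i L ^+ n i.
Proof.
rewrite normr_prod; apply: ler_prod => i _.
by rewrite normr_ge0 normrX lerXn2r ?nnegrE.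
Qed.

Let ev_le t : 0 <= ev t <= 1.
Proof.
rewrite expR_ge0/= expR_le1 oppr_le0; apply: sumr_ge0 => i _.
by rewrite divr_ge0// sqr_ge0.
Qed.

Let c_norm t : `|c t| <= 1.
Proof. by have /andP[c0 c1] := c01 t; rewrite ger0_norm. Qed.

Let norm_mul_le1 (x y B : R) : `|x| <= 1 -> `|y| <= B -> `|x * y| <= B.
Proof.
move=> x1 yB; rewrite normrM -[B]mul1r ler_pM//.
Qed.

(** [prod_expK_tail] with rho = K: a ratio growing with K yields K^-K, which beats every fixed
    exponential of K. *)
Let tail_le (a : R) (y : 'I_d -> R) : 0 <= a ->
  (forall i, `|y i| <= a * L ^+ 2) ->
  `|expR (\sum_i y i) - \prod_i expK K (y i)| <= D * E a.
Proof.
move=> a0 yL; apply: le_trans (prod_expK_tail K _ K1) _.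
rewrite -mulrA ler_wpM2l// ler_wpM2l ?invr_ge0 ?exprn_ge0// ler_expR.
rewrite mulrC ler_wpM2r// (le_trans (ler_sum _ (fun i _ => yL i)))//.
by rewrite sumr_const card_ord -[leLHS]mulr_natl [leRHS](_ : _ = D * (a * L ^+ 2))//; ring.
Qed.

Let kerA_moments : \sum_(f : I) (\prod_i (3 ^+ f i * (f i)`!%:R))^-1 * b (fun i => f i) ^+ 2 <=
  nunu p q kerA + 4 * (D * E (3^-1)).
Proof.
rewrite -lerBlDl; apply: le_trans (ler_norm _) _; rewrite distrC.
apply: (@nunu_approx _ _ _ p q _ _ _ (fun (f : I) t => c t * ev t * mono (fun i => f i) t));
  first exact: bdmeas_kerA.
  by move=> f; do 2 apply: bdmeasM => //.
move=> t s.
have -> : kerA (t, s) = c t * c s * (ev t * ev s * expR (\sum_i v i t * v i s / 3)).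
  rewrite /kerA/= -!expRD; congr (_ * expR _).
  rewrite -!sumrN -!big_split/=; by apply: eq_bigr => i _; field.
rewrite (_ : \sum_(f : I) _ = c t * c s * (ev t * ev s * \prod_i expK K (v i t * v i s / 3))).
  rewrite -mulrBr -mulrBr; apply: norm_mul_le1; first exact: norm_mul_le1.
  apply: norm_mul_le1.
    have /andP[? ?] := ev_le t; have /andP[? ?] := ev_le s.
    by apply: norm_mul_le1; rewrite ger0_norm.
  apply: tail_le; first by rewrite invr_ge0.
  move=> i; rewrite normrM mulrC [`|3^-1|]ger0_norm ?invr_ge0// ler_wpM2l ?invr_ge0//.
  by rewrite normrM expr2 ler_pM.
rewrite prod_expKE !mulr_sumr; apply: eq_bigr => f _.
have -> : \prod_i ((v i t * v i s / 3) ^+ f i / (f i)`!%:R) =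
    (\prod_i (3 ^+ f i * (f i)`!%:R))^-1 *
    (mono (fun i => f i) t * mono (fun i => f i) s); last ring.
rewrite -prodfV -!big_split/=; apply: eq_bigr => i _.
rewrite !exprMn exprVn invfM; ring.
Qed.

(* c = (c * ev) * ev^-1: the moments m follow from those of the damped form b
   by expanding ev^-1 in power series. *)
Let moments_of_damped (k : 'I_d -> nat) :
  `|m k - \sum_(f : I) (\prod_i (6 ^+ f i * (f i)`!%:R))^-1 *
     b (fun i => k i + (f i).*2)%N| <= 2 * ((\prod_i L ^+ k i) * (D * E (6^-1))).
Proof.
have bcem n : bdmeas (fun t => c t * ev t * mono n t).
  by do 2 apply: bdmeasM => //.
have -> : \sum_(f : I) (\prod_i (6 ^+ f i * (f i)`!%:R))^-1 *
     b (fun i => k i + (f i).*2)%N = nu p q (fun t => \sum_(f : I)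
     (\prod_i (6 ^+ f i * (f i)`!%:R))^-1 *
     (c t * ev t * mono (fun i => k i + (f i).*2)%N t)).
  rewrite nu_sum; last by move=> f; apply: bdmeasM (bdmeas_cst _) _.
  by apply: eq_bigr => f _; rewrite nuM.
apply: nu_approx; first exact: bdmeasM.
  by apply: bdmeas_sum => f; apply: bdmeasM (bdmeas_cst _) _.
move=> t.
have -> : c t * mono k t = c t * (mono k t * (ev t * expR (\sum_i v i t ^+ 2 / 6))).
  by rewrite /ev -expRD addNr expR0 mulr1.
rewrite (_ : \sum_(f : I) _ = c t * (mono k t * (ev t * \prod_i expK K (v i t ^+ 2 / 6)))).
  rewrite -!mulrBr; apply: norm_mul_le1 => //.
  rewrite normrM ler_pM//; apply: norm_mul_le1.
    by have /andP[? ?] := ev_le t; rewrite ger0_norm.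
  apply: tail_le; first by rewrite invr_ge0.
  move=> i; rewrite normrM mulrC [`|6^-1|]ger0_norm ?invr_ge0// ler_wpM2l ?invr_ge0//.
  by rewrite normrX lerXn2r ?nnegrE.
rewrite prod_expKE !mulr_sumr; apply: eq_bigr => f _.
have -> : \prod_i ((v i t ^+ 2 / 6) ^+ f i / (f i)`!%:R) =
    (\prod_i (6 ^+ f i * (f i)`!%:R))^-1 * mono (fun i => (f i).*2) t; last first.
  have -> : mono (fun i => k i + (f i).*2)%N t = mono k t * mono (fun i => (f i).*2) t.
    by rewrite /mono -big_split/=; apply: eq_bigr => i _; rewrite exprD.
  ring.
rewrite -prodfV -!big_split/=; apply: eq_bigr => i _.
by rewrite expr_div_n invfM -mul2n exprM -mulrA mulrC.
Qed.

Let kerQ_moments : nunu p q kerQ <= \sum_(f : I) (\prod_i (f i)`!%:R)^-1 * m (fun i => f i) ^+ 2 +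
  4 * (D * E 1).
Proof.
rewrite -lerBlDl; apply: le_trans (ler_norm _) _.
apply: (@nunu_approx _ _ _ p q _ _ _ (fun (f : I) t => c t * mono (fun i => f i) t));
  first exact: bdmeas_kerQ.
  by move=> f; apply: bdmeasM.
move=> t s.
have -> : kerQ (t, s) = c t * c s * expR (\sum_i v i t * v i s) by [].
rewrite (_ : \sum_(f : I) _ = c t * c s * \prod_i expK K (v i t * v i s)).
  rewrite -mulrBr; apply: norm_mul_le1; first exact: norm_mul_le1.
  apply: tail_le => //.
  by move=> i; rewrite mul1r normrM expr2 ler_pM.
rewrite prod_expKE !mulr_sumr; apply: eq_bigr => f _.
have -> : \prod_i ((v i t * v i s) ^+ f i / (f i)`!%:R) =
    (\prod_i (f i)`!%:R)^-1 *
    (mono (fun i => f i) t * mono (fun i => f i) s); last ring.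
rewrite -prodfV -!big_split/=; apply: eq_bigr => i _.
rewrite !exprMn; ring.
Qed.

Let b_le n : b n ^+ 2 <= 4 * \prod_i (L ^+ 2) ^+ n i.
Proof.
have h : `|b n| <= 2 * \prod_i L ^+ n i.
  apply: nu_le => [|t]; first by do 2 apply: bdmeasM => //.
  rewrite -mulrA; apply: norm_mul_le1 => //; apply: norm_mul_le1 => //.
  by have /andP[? ?] := ev_le t; rewrite ger0_norm.
rewrite -real_normK ?num_real//.
have P0 : 0 <= \prod_i L ^+ n i by apply: prodr_ge0 => i _; exact: exprn_ge0.
apply: (le_trans (lerXn2r 2 _ _ h)); rewrite ?nnegrE ?mulr_ge0//.
have -> : \prod_i (L ^+ 2) ^+ n i = (\prod_i L ^+ n i) ^+ 2.
  by rewrite -prodrXl; apply: eq_bigr => i _; rewrite -!exprM mulnC.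
by rewrite exprMn (_ : 2 ^+ 2 = 4 :> R)//; ring.
Qed.

Variable A : R.
Hypothesis kerA_le : nunu p q kerA <= A.

Let A' := A + 4 * (D * E (3^-1)).

Let A'_ge0 : 0 <= A'.
Proof.
apply: le_trans (le_trans kerA_moments _); last by rewrite lerD2r.
apply: sumr_ge0 => f _; rewrite mulr_ge0 ?sqr_ge0// invr_ge0.
by apply: prodr_ge0 => i _; rewrite mulr_ge0// exprn_ge0.
Qed.

(** The reciprocal of the coefficient with which b_(k+2f)^2 enters: 1/k! from [kerQ], and the square
    of 1 / (6^f f!) from the series of ev^-1. *)
Let weight (k f : 'I_d -> nat) : R :=
  \prod_i ((k i)`!%:R * (6 ^+ f i * (f i)`!%:R) ^+ 2).

Let weight_gt0 k f : 0 < weight k f.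
Proof.
apply: prodr_gt0 => i _; apply: mulr_gt0; first by rewrite ltr0n fact_gt0.
by rewrite exprn_gt0// mulr_gt0 ?exprn_gt0// ltr0n fact_gt0.
Qed.

(** Total degree below K puts the multi-index among those of [kerA_moments], where a single term is
    at most the whole sum. Splitting by total degree, not by coordinate, is what gives 4^K instead
    of 4^(dK). *)
Let low_degree (k f : 'I_d -> nat) : (\sum_i (k i + (f i).*2) < K)%N ->
  b (fun i => k i + (f i).*2)%N ^+ 2 <= 4 ^+ K * A' * weight k f.
Proof.
set n := fun i => (k i + (f i).*2)%N => nK.
have niK i : (n i < K)%N.
  by apply: leq_ltn_trans nK; rewrite (bigD1 i)//= leq_addr.
pose F : I := [ffun i => Ordinal (niK i)].
have nF : (fun i => nat_of_ord (F i)) = n by apply/funext => i; rewrite ffunE.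
have pos (g : 'I_d -> nat) : 0 < \prod_i (3 ^+ g i * (g i)`!%:R) :> R.
  by apply: prodr_gt0 => i _; rewrite mulr_gt0 ?exprn_gt0// ltr0n fact_gt0.
have h1 : b n ^+ 2 <= A' * \prod_i (3 ^+ n i * (n i)`!%:R).
  rewrite -ler_pdivrMr// mulrC.
  have /(le_trans kerA_moments) : nunu p q kerA + 4 * (D * E (3^-1)) <= A' by rewrite lerD2r.
  rewrite (bigD1 F)//= nF => h; apply: le_trans h.
  rewrite [X in X^-1](_ : _ = \prod_i (3 ^+ F i * (F i)`!%:R)) ?lerDl; last first.
    by apply: eq_bigr => i _; rewrite ffunE.
  apply: sumr_ge0 => g _; rewrite mulr_ge0 ?sqr_ge0// invr_ge0.
  by apply: prodr_ge0 => i _; rewrite mulr_ge0// exprn_ge0.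
apply: (le_trans h1); rewrite [4 ^+ K * A']mulrC -mulrA ler_wpM2l//.
apply: (@le_trans _ _ (4 ^+ (\sum_i n i) * weight k f)); last first.
  by rewrite ler_wpM2r ?(ltW (weight_gt0 _ _))// ler_weXn2l ?ler1n// ltnW.
rewrite -prodrXr -big_split/=; apply: ler_prod => i _.
rewrite mulr_ge0 ?exprn_ge0//=.
have := trinomial_bound (k i) (f i).
rewrite -(ler_nat R) !natrM !natrX => /le_trans -> //.
have e6 : 36%:R ^+ f i = (6 ^+ f i) ^+ 2 :> R.
  by rewrite -exprM mulnC exprM; congr (_ ^+ _); ring.
rewrite e6 ler_wpM2l ?exprn_ge0//.
by rewrite exprMn -expr2 mulrC.
Qed.

(** Here K^K <= K^n, so the trivial bound on [b] times K^K is a product of powers of z = L^2 K. Each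
    power over its factorial is a term of an exponential series, and the exponents z + 2 z/6 fit in
    2z. *)
Let high_degree (k f : 'I_d -> nat) : (K <= \sum_i (k i + (f i).*2))%N ->
  b (fun i => k i + (f i).*2)%N ^+ 2 <= 4 * E 2 * weight k f.
Proof.
set n := fun i => (k i + (f i).*2)%N => nK.
have KR0 : 0 < K%:R :> R by rewrite ltr0n.
apply: (le_trans (b_le n)); rewrite -[leRHS]mulrA ler_wpM2l// /E.
rewrite -[leRHS]mulrA ler_pdivlMl ?exprn_gt0// mulrC.
apply: (@le_trans _ _ ((\prod_i (L ^+ 2) ^+ n i) * K%:R ^+ (\sum_i n i))).
  rewrite ler_wpM2l ?ler_weXn2l// ?prodr_ge0// => i _.
  by rewrite exprn_ge0// sqr_ge0.
have -> : 2 * D * L ^+ 2 * K%:R = \sum_(i < d) 2 * (L ^+ 2 * K%:R).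
  by rewrite sumr_const card_ord -[RHS]mulr_natl; ring.
rewrite expR_sum -prodrXr -!big_split/=; apply: ler_prod => i _.
set z := L ^+ 2 * K%:R; have z0 : 0 <= z by rewrite mulr_ge0// sqr_ge0.
rewrite -exprMn -/z exprn_ge0//= /n exprD.
have h1 := exp_term_le (k i) z0.
have z60 : 0 <= z / 6 by rewrite divr_ge0.
have h2 := exp_term_le (f i) z60.
have -> : z ^+ k i * z ^+ (f i).*2 = (z ^+ k i / (k i)`!%:R) *
    ((z / 6) ^+ f i / (f i)`!%:R) ^+ 2 *
    ((k i)`!%:R * (6 ^+ f i * (f i)`!%:R) ^+ 2).
  rewrite (expr_div_n z 6 (f i)) -mul2n mulnC exprM.
  have : (k i)`!%:R != 0 :> R by rewrite pnatr_eq0 -lt0n fact_gt0.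
  have : (f i)`!%:R != 0 :> R by rewrite pnatr_eq0 -lt0n fact_gt0.
  have : 6 ^+ f i != 0 :> R by rewrite expf_neq0// pnatr_eq0.
  move: (z ^+ k i) (z ^+ f i) (6 ^+ f i) ((f i)`!%:R) ((k i)`!%:R) => a1 a2 a3 a4 a5.
  by move=> n1 n2 n3; field; rewrite n1 n2 n3.
apply: ler_wpM2r; first by rewrite mulr_ge0// sqr_ge0.
apply: (@le_trans _ _ (expR z * expR (z / 6) ^+ 2)).
  apply: ler_pM => //; first by rewrite divr_ge0// exprn_ge0.
    by rewrite sqr_ge0.
  by rewrite lerXn2r ?nnegrE ?expR_ge0// divr_ge0// exprn_ge0.
rewrite -expRM_natl -expRD ler_expR; lra.
Qed.

Let term_bound (k f : 'I_d -> nat) :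
  (\prod_i (k i)`!%:R)^-1 * ((\prod_i (6 ^+ f i * (f i)`!%:R))^-1 *
     b (fun i => k i + (f i).*2)%N) ^+ 2 <= 4 ^+ K * A' + 4 * E 2.
Proof.
have -> : (\prod_i (k i)`!%:R)^-1 * ((\prod_i (6 ^+ f i * (f i)`!%:R))^-1 *
     b (fun i => k i + (f i).*2)%N) ^+ 2 =
   b (fun i => k i + (f i).*2)%N ^+ 2 / weight k f.
  have -> : weight k f =
      (\prod_i (k i)`!%:R) * (\prod_i (6 ^+ f i * (f i)`!%:R)) ^+ 2.
    by rewrite /weight big_split/= prodrXl.
  rewrite invfM exprMn exprVn; ring.
rewrite ler_pdivrMr//.
have [h|h] := ltnP (\sum_i (k i + (f i).*2))%N K.
  apply: (le_trans (low_degree h)); rewrite ler_wpM2r ?(ltW (weight_gt0 _ _))//.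
  by rewrite lerDl mulr_ge0.
apply: (le_trans (high_degree h)); rewrite ler_wpM2r ?(ltW (weight_gt0 _ _))//.
by rewrite lerDr mulr_ge0// exprn_ge0.
Qed.

Let cardI : #|I|%:R = K%:R ^+ d :> R.
Proof. by rewrite card_ffun !card_ord natrX. Qed.

(** The square of [m] is split into the damped expansion [S] and its truncation error [r].
    Cauchy-Schwarz on [S] costs one factor K^d, and adding the term bounds costs another. *)
Let m_bound (k : I) : (\prod_i (k i)`!%:R)^-1 * m (fun i => k i) ^+ 2 <=
  2 * K%:R ^+ d * (K%:R ^+ d * (4 ^+ K * A' + 4 * E 2)) + 8 * D ^+ 2 * E 5.
Proof.
set S := \sum_(f : I) (\prod_i (6 ^+ f i * (f i)`!%:R))^-1 *
     b (fun i => k i + (f i).*2)%N.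
set w := (\prod_i (k i)`!%:R)^-1.
have w0 : 0 <= w by rewrite invr_ge0 prodr_ge0.
have h2 := moments_of_damped (fun i => k i).
set r := 2 * _ in h2.
have mS : m (fun i => k i) ^+ 2 <= 2 * S ^+ 2 + 2 * r ^+ 2.
  have : (m (fun i => k i) - S) ^+ 2 <= r ^+ 2.
    by rewrite -real_normK ?num_real// lerXn2r ?nnegrE// (le_trans _ h2).
  (* The identity 2 S^2 + 2 (m - S)^2 - m^2 = (m - 2S)^2. *)
  have := sqr_ge0 (m (fun i => k i) - 2 * S); nra.
apply: (le_trans (ler_wpM2l w0 mS)); rewrite mulrDr; apply: lerD.
  rewrite mulrCA -!mulrA ler_wpM2l//.
  apply: (le_trans (ler_wpM2l w0 (sqr_sum_le _))).
  rewrite cardI mulrCA ler_wpM2l ?exprn_ge0// mulr_sumr.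
  apply: (@le_trans _ _ (\sum_(f : I) (4 ^+ K * A' + 4 * E 2))).
    apply: ler_sum => f _.
    exact: (term_bound (fun i => k i) (fun i => f i)).
  by rewrite sumr_const -[leLHS]mulr_natl cardI.
have -> : w * (2 * r ^+ 2) =
  8 * D ^+ 2 * (E 6^-1 ^+ 2 * (w * (\prod_i L ^+ k i) ^+ 2)) by rewrite /r; ring.
rewrite ler_wpM2l ?mulr_ge0// ?sqr_ge0//.
have h3 : w * (\prod_i L ^+ k i) ^+ 2 <= expR (D * L ^+ 2).
  have -> : D * L ^+ 2 = \sum_(i < d) L ^+ 2.
    by rewrite sumr_const card_ord -[RHS]mulr_natl.
  rewrite expR_sum /w -prodfV -prodrXl -big_split/=; apply: ler_prod => i _.
  rewrite mulr_ge0 ?sqr_ge0 ?invr_ge0//= mulrC -exprM mulnC exprM.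
  exact: exp_term_le (sqr_ge0 _).
apply: (le_trans (ler_wpM2l (sqr_ge0 _) h3)).
have KK : K%:R ^- K <= 1 :> R by rewrite invf_le1 ?exprn_gt0 ?ltr0n// exprn_ege1.
have KK0 : 0 <= K%:R ^- K :> R by rewrite invr_ge0 exprn_ge0.
have -> : E 6^-1 ^+ 2 * expR (D * L ^+ 2) = K%:R ^- K * (K%:R ^- K *
    (expR (6^-1 * D * L ^+ 2 * K%:R) ^+ 2 * expR (D * L ^+ 2))) by rewrite /E; ring.
rewrite /E ler_wpM2l//.
rewrite -[leRHS]mul1r ler_pM ?mulr_ge0 ?expR_ge0 ?sqr_ge0//.
rewrite -expRM_natl -expRD ler_expR.
have : D * L ^+ 2 <= D * L ^+ 2 * K%:R.
  by rewrite ler_peMr// mulr_ge0// sqr_ge0.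
have : 0 <= D * L ^+ 2 by rewrite mulr_ge0// sqr_ge0.
have -> : 6^-1 * D * L ^+ 2 * K%:R = 6^-1 * (D * L ^+ 2 * K%:R) by ring.
have -> : 5 * D * L ^+ 2 * K%:R = 5 * (D * L ^+ 2 * K%:R) by ring.
lra.
Qed.

(** The power 3d collects the two factors K^d of [m_bound] and a third one from summing over [k].
    All truncation errors are put under the largest one, [E 5]. *)
Lemma moment_inequality : 0 <= A -> nunu p q kerQ <=
  (20 * D ^+ 2 + 20 * D + 20) * K%:R ^+ (3 * d) * 4 ^+ K *
    (A + K%:R ^- K * expR (5 * D * L ^+ 2 * K%:R)).
Proof.
move=> A0; apply: (le_trans kerQ_moments).
apply: (le_trans (lerD (ler_sum _ (fun f _ => m_bound f)) (lexx _))).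
rewrite sumr_const -[_ *+ _]mulr_natl cardI -/(E 5) mulnC exprM.
have E1 : E 1 <= E 5 by apply: E_le; lra.
have E2 : E 2 <= E 5 by apply: E_le; lra.
have E3 : E 3^-1 <= E 5 by apply: E_le; lra.
set e := E 5 in E1 E2 E3 *; have e0 : 0 <= e by exact: E0.
set k := K%:R ^+ d; set F := 4 ^+ K.
have k1 : 1 <= k by rewrite exprn_ege1.
have F1 : 1 <= F by rewrite exprn_ege1// ler1n.
have A'le : A' <= A + 4 * D * e by rewrite /A' lerD2l mulrA ler_wpM2l// mulr_ge0.
have k0 : 0 <= k by exact: le_trans k1.
have De0 : 0 <= D * e by rewrite mulr_ge0.
have DDe0 : 0 <= D ^+ 2 * e by rewrite mulr_ge0 ?sqr_ge0.
set G := k ^+ 3 * F.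
have G0 : 0 <= G by rewrite mulr_ge0 ?exprn_ge0// (le_trans _ F1).
have k3 : k <= k ^+ 3 by rewrite -[leLHS]expr1 ler_weXn2l.
have kG : k <= G by rewrite (le_trans k3)// ler_peMr// exprn_ge0.
have k3G : k ^+ 3 <= G by rewrite ler_peMr// exprn_ge0.
have G1 : 1 <= G by exact: le_trans kG.
have h1 : k * (2 * k * (k * (F * A' + 4 * E 2))) <= G * (2 * (A + 4 * D * e + 4 * e)).
  have -> : k * (2 * k * (k * (F * A' + 4 * E 2))) =
    2 * (G * A') + 8 * (k ^+ 3 * E 2) by rewrite /G; ring.
  have := ler_wpM2l G0 A'le; have := ler_pM (exprn_ge0 3 k0) (E0 2) k3G E2; lra.
have h2 : k * (8 * D ^+ 2 * e) <= G * (8 * (D ^+ 2 * e)).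
  by rewrite -mulrA ler_wpM2r// mulr_ge0.
have h3 : 4 * (D * E 1) <= G * (4 * (D * e)).
  apply: (@le_trans _ _ (4 * (D * e))); first by rewrite ler_wpM2l// ler_wpM2l.
  by rewrite ler_peMl// mulr_ge0.
rewrite [leLHS](_ : _ = k * (2 * k * (k * (F * A' + 4 * E 2))) +
  k * (8 * D ^+ 2 * e) + 4 * (D * E 1)); last ring.
apply: (le_trans (lerD (lerD h1 h2) h3)).
have -> : (20 * D ^+ 2 + 20 * D + 20) * k ^+ 3 * F * (A + e) =
  G * ((20 * D ^+ 2 + 20 * D + 20) * (A + e)) by rewrite /G; ring.
rewrite -[X in X + _]mulrDr -[leLHS]mulrDr.
rewrite ler_wpM2l//.
have DA0 : 0 <= D * A by rewrite mulr_ge0.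
have DDA0 : 0 <= D ^+ 2 * A by rewrite mulr_ge0 ?sqr_ge0.
by rewrite !(mulrDl, mulrDr) -!(mulrA _ D) -!(mulrA _ (D ^+ 2)); lra.
Qed.

End moments.

(** * Gaussian mixtures *)

Section support.
Context {R : realType} (d : nat).
Implicit Types (p : probability (rspace R d) R) (x y : rspace R d).

Lemma measurable_box (A : 'I_d -> set (measurableTypeR R)) : (forall i, measurable (A i)) ->
  measurable [set y : rspace R d | forall i, A i (tnth y i)].
Proof.
move=> mA; rewrite (_ : [set _ | _] = \bigcap_(i in [set: 'I_d])
    ((fun x : rspace R d => tnth x i) @^-1` A i)).
  apply: fin_bigcap_measurable => // i _.
  by rewrite -[X in measurable X]setTI; exact: measurable_tnth.
by apply/seteqP; split => x /=; [move=> h i _; exact: h|move=> h i; exact: h].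
Qed.

Lemma measurable_cube (M : R) : measurable (cube M : set (rspace R d)).
Proof.
apply: (@measurable_box (fun=> [set z | `|z| <= M])) => i.
rewrite (_ : [set _ | _] = `[- M, M]%classic) //.
by apply/seteqP; split => z /=; rewrite in_itv/= ler_norml.
Qed.

Definition ratbox (z : d.-tuple rat * rat) : set (rspace R d) :=
  [set y | forall i, `|tnth y i - ratr (tnth z.1 i)| < ratr z.2].

Lemma measurable_ratbox z : measurable (ratbox z).
Proof.
apply: (@measurable_box (fun i => [set w | `|w - ratr (tnth z.1 i)| < ratr z.2])) => i.
rewrite (_ : [set _ | _] =
  `](ratr (tnth z.1 i) - ratr z.2), (ratr (tnth z.1 i) + ratr z.2)[%classic) //.
by apply/seteqP; split => w /=; rewrite in_itv/= ltr_distl.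
Qed.

(** Every point off the support lies in a rational box of mass zero, and there are countably many
    such boxes; [F] enumerates them through [unpickle]. *)
Lemma supp_null p : (p.-negligible (~` supp p))%classic.
Proof.
pose F n : set (rspace R d) :=
  if unpickle n is Some z then (if p (ratbox z) == 0%E then ratbox z else set0)
  else set0.
have mF n : measurable (F n).
  rewrite /F; case: unpickle => // z; case: ifP => _ //; exact: measurable_ratbox.
apply: (@negligibleS _ _ _ _ (\bigcup_n F n)); last first.
  apply: negligible_bigcup => n; apply/negligibleP => //.
  rewrite /F; case: unpickle => [z|]; last exact: measure0.
  by case: ifP => [/eqP//|_]; exact: measure0.
move=> x /=; rewrite /supp /= => /existsNP[r] /not_implyP[r0] /negP.
rewrite -leNgt => Pr.
(* Half-side below r/2: a rational box that contains [x] then stays within distance [r] of [x] in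
   each coordinate. *)
have [s /andP[]] : exists s : rat, (0 : R) < ratr s < r / 2.
  have : 0 < r / 2 by rewrite divr_gt0.
  by move=> /rat_in_itvoo[s]; rewrite inE/= => h; exists s.
move=> s0 sr.
have near (i : 'I_d) : exists q : rat, `|tnth x i - ratr q| < ratr s.
  have : tnth x i - ratr s < tnth x i + ratr s by lra.
  move=> /rat_in_itvoo[q]; rewrite inE/= => h; exists q.
  by rewrite ltr_distlC.
have [q hq] := choice near.
pose z : d.-tuple rat * rat := ([tuple q i | i < d], s).
exists (pickle z) => //; rewrite /F pickleK.
have sub : ratbox z `<=` [set y | forall i, `|tnth y i - tnth x i| < r].
  move=> y /= h i; have := h i; rewrite /= tnth_mktuple => hy.
  have := hq i; rewrite distrC => hx.
  rewrite (_ : tnth y i - tnth x i =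
    (tnth y i - ratr (q i)) + (ratr (q i) - tnth x i)); last ring.
  apply: le_lt_trans (ler_normD _ _) _; lra.
have -> : p (ratbox z) == 0%E.
  rewrite -measure_le0; apply: le_trans Pr; apply: le_measure => //.
  - by rewrite inE; exact: measurable_ratbox.
  - rewrite inE.
    apply: (@measurable_box (fun i => [set w | `|w - tnth x i| < r])) => i.
    rewrite (_ : [set _ | _] = `](tnth x i - r), (tnth x i + r)[%classic) //.
    by apply/seteqP; split => w /=; rewrite in_itv/= ltr_distl.
by move=> i /=; rewrite tnth_mktuple; exact: hq.
Qed.

Definition icube (M : R) (x : rspace R d) : R := \1_(cube M) x.

Lemma icube01 M x : 0 <= icube M x <= 1.
Proof. by rewrite /icube indicE; case: (_ \in _); rewrite ?lexx ?ler01. Qed.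

Lemma bdmeas_icube M : bdmeas (icube M).
Proof.
split; first by apply: measurable_indic; exact: measurable_cube.
by exists 1 => x; have /andP[? ?] := icube01 M x; rewrite ger0_norm.
Qed.

Lemma Rintegral_icube M p (f : rspace R d -> R) : supp p `<=` cube M ->
  bdmeas f -> \int[p]_x f x = \int[p]_x (f x * icube M x).
Proof.
move=> pM bf; congr fine; apply: ae_eq_integral => //.
- by case: bf => mf _; exact/measurable_EFinP.
- have [mf _] := bdmeasM bf (bdmeas_icube M); exact/measurable_EFinP.
apply: negligibleS (supp_null p) => x /=; apply: contra_not => px _.
by rewrite /icube indicE mem_set ?mulr1//; exact: pM.
Qed.

End support.

Section gaussian_mixture_kernels.
Context {R : realType} (d : nat).
Implicit Types (p q : probability (rspace R d) R) (x y t s : rspace R d).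
Variable M : R.

Definition gauss_cst : R := (2 * pi) `^ (- (d%:R / 2)).

Lemma gauss_cst_gt0 : 0 < gauss_cst.
Proof. by rewrite powR_gt0// mulr_gt0// pi_gt0. Qed.

Definition sqd x y : R := \sum_(i < d) (tnth x i - tnth y i) ^+ 2.

Lemma sqd_ge0 x y : 0 <= sqd x y.
Proof. by apply: sumr_ge0 => i _; exact: sqr_ge0. Qed.

Lemma std_gaussE x y :
  std_gauss (rsub x y) = gauss_cst * expR (- (sqd x y / 2)).
Proof.
have -> : sqd x y = \sum_(i < d) tnth (rsub x y) i ^+ 2.
  by apply: eq_bigr => i _; rewrite tnth_mktuple.
by rewrite /std_gauss mulNr.
Qed.

Lemma std_gauss_gt0 x : 0 < std_gauss x.
Proof. by rewrite mulr_gt0 ?expR_gt0// gauss_cst_gt0. Qed.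

Lemma std_gauss_le x : std_gauss x <= gauss_cst.
Proof.
rewrite /std_gauss -/gauss_cst ler_piMr ?(ltW gauss_cst_gt0)//.
rewrite expR_le1 mulNr oppr_le0 divr_ge0// sumr_ge0// => i _; exact: sqr_ge0.
Qed.

Lemma measurable_std_gauss : measurable_fun setT (@std_gauss R d).
Proof.
apply: measurable_funM => //; apply: measurableT_comp => //.
by apply: measurable_funM => //; apply: measurableT_comp => //; exact: measurable_sqn.
Qed.

Lemma measurable_sqd :
  measurable_fun setT (fun z : rspace R d * rspace R d => sqd z.1 z.2).
Proof.
rewrite (_ : (fun _ => _) = @sqn R d \o (fun z => rsub z.1 z.2)).
  by apply: measurableT_comp; [exact: measurable_sqn|exact: measurable_rsub].
by apply/funext => z; apply: eq_bigr => i _; rewrite tnth_mktuple.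
Qed.

Lemma bdmeas_sqd_exp (a : R) : 0 <= a ->
  bdmeas (fun z : rspace R d * rspace R d => expR (- (sqd z.1 z.2 / a))).
Proof.
move=> a0; split.
  apply: measurableT_comp => //; apply: measurableT_comp => //.
  by apply: measurable_funM => //; exact: measurable_sqd.
exists 1 => z; rewrite ger0_norm ?expR_ge0// expR_le1 oppr_le0 divr_ge0//.
exact: sqd_ge0.
Qed.

(** The indicator leaves the mixture unchanged by [mixtureE], and it passes to the kernels in theta
    obtained by integrating out x, which must be bounded. *)
Definition gkern (z : rspace R d * rspace R d) : R :=
  std_gauss (rsub z.1 z.2) * icube M z.2.

Lemma gkern_ge0 z : 0 <= gkern z.
Proof.
apply: mulr_ge0; first exact: (ltW (std_gauss_gt0 _)).
by have /andP[] := icube01 M z.2.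
Qed.

Lemma bdmeas_gkern : bdmeas gkern.
Proof.
apply: (@bdmeasM _ _ _ (fun z => std_gauss (rsub z.1 z.2)) (fun z => icube M z.2)).
  2: exact: (bdmeas_comp measurable_snd (bdmeas_icube d M)).
under eq_fun do rewrite std_gaussE.
by apply: bdmeasM (bdmeas_cst _) (bdmeas_sqd_exp _).
Qed.

Lemma bdmeas_std_gauss x : bdmeas (fun t => std_gauss (rsub x t)).
Proof.
apply: (bdmeas_fst (k := fun z => std_gauss (rsub z.1 z.2))).
under eq_fun do rewrite std_gaussE.
by apply: bdmeasM (bdmeas_cst _) (bdmeas_sqd_exp _).
Qed.

Lemma mixtureE p x : supp p `<=` cube M ->
  mixture p x = \int[p]_t gkern (x, t).
Proof. by move=> pM; exact: (Rintegral_icube pM (bdmeas_std_gauss x)). Qed.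

Lemma measurable_mixture p : supp p `<=` cube M -> measurable_fun setT (mixture p).
Proof.
move=> pM; have -> : mixture p = fun x => \int[p]_t gkern (x, t).
  by apply/funext => x; exact: mixtureE.
by have [] := bdmeas_int p bdmeas_gkern.
Qed.

Lemma integral_gaussB (a B C : R) (m : rspace R d) (f : rspace R d -> R) :
  0 < a -> 0 <= B -> (forall x, f x = B * expR (C - sqd x m / a)) ->
  (\int[leb d]_x (f x)%:E)%E = (B * (gauss_vol d a * expR C))%:E.
Proof.
move=> a0 B0 fE.
rewrite EFinM -(@integral_gauss R d a C m (fun x => expR (C - sqd x m / a)))//.
  rewrite -ge0_integralZ_EFin//.
    by apply: eq_integral => x _; rewrite fE.
  apply: measurableT_comp => //; apply: measurable_funB => //.
  apply: measurable_funM => //.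
  have h : measurable_fun setT (fun x : rspace R d => (x, m)).
    exact: measurable_fun_pair.
  exact: (measurableT_comp measurable_sqd h).
by move=> x; rewrite /sqd mulr_suml.
Qed.

Definition tmid (f : R -> R -> R) x y : rspace R d :=
  [tuple f (tnth x i) (tnth y i) | i < d].

Lemma gauss_conv x t :
  (\int[leb d]_y (std_gauss (rsub y t) * std_gauss (rsub x y))%:E)%E =
  (gauss_cst ^+ 2 * gauss_vol d 1 * expR (- (sqd x t / 4)))%:E.
Proof.
rewrite (@integral_gaussB 1 (gauss_cst ^+ 2) (- (sqd x t / 4))
  (tmid (fun a b => (a + b) / 2) x t))//.
- by rewrite mulrA.
- exact: sqr_ge0.
move=> y; rewrite !std_gaussE mulrACA -expr2 -expRD; congr (_ * expR _).
rewrite /sqd !mulr_suml -!sumrN -!big_split/=; apply: eq_bigr => i _.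
by rewrite tnth_mktuple; field.
Qed.

(** Variances 1 and 2 add up to 3, the origin of the 6 in [kerA]. *)
Lemma gauss_prod2 t s :
  (\int[leb d]_x (std_gauss (rsub x t) * expR (- (sqd x s / 4)))%:E)%E =
  (gauss_cst * (gauss_vol d (4 / 3) * expR (- (sqd t s / 6))))%:E.
Proof.
rewrite (@integral_gaussB (4 / 3) gauss_cst (- (sqd t s / 6))
  (tmid (fun a b => (2 * a + b) / 3) t s))//.
  exact: (ltW gauss_cst_gt0).
move=> y; rewrite !std_gaussE -mulrA -expRD; congr (_ * expR _).
rewrite /sqd !mulr_suml -!sumrN -!big_split/=; apply: eq_bigr => i _.
by rewrite tnth_mktuple; field.
Qed.

(** Two Gaussian exponents minus a third leave a Gaussian centred at t + s - t0, and completing the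
    square leaves exactly the inner product of t - t0 and s - t0. *)
Lemma gauss_chi (t0 t s : rspace R d) :
  (\int[leb d]_x (std_gauss (rsub x t) * std_gauss (rsub x s) *
     (std_gauss (rsub x t0))^-1)%:E)%E =
  (gauss_cst * (gauss_vol d 2 *
    expR (\sum_(i < d) (tnth t i - tnth t0 i) * (tnth s i - tnth t0 i))))%:E.
Proof.
rewrite (@integral_gaussB 2 gauss_cst
  (\sum_(i < d) (tnth t i - tnth t0 i) * (tnth s i - tnth t0 i))
  (tmid (fun a b => a + b) (rsub t t0) s))//.
  exact: (ltW gauss_cst_gt0).
move=> y; rewrite !std_gaussE.
rewrite (_ : expR (_ - _) = expR (- (sqd y t / 2)) * expR (- (sqd y s / 2)) /
    expR (- (sqd y t0 / 2))).
  have g0 : gauss_cst != 0 by rewrite gt_eqF// gauss_cst_gt0.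
  have e0 : expR (- (sqd y t0 / 2)) != 0 by rewrite gt_eqF// expR_gt0.
  move: gauss_cst (expR (- (sqd y t0 / 2))) g0 e0 => g e g0 e0.
  by field; rewrite g0 e0.
rewrite -expRN -!expRD; congr expR.
rewrite /sqd !mulr_suml -!sumrN -!big_split/=; apply: eq_bigr => i _.
by rewrite !tnth_mktuple; field.
Qed.

End gaussian_mixture_kernels.

Lemma integral_prob_cst {R : realType} {disp} {T : measurableType disp}
  (p : probability T R) (c : \bar R) : (\int[p]_x c = c)%E.
Proof.
rewrite -[LHS]/(\int[p]_x cst c x)%E integral_cst//.
by rewrite [X in (_ * X)%E](_ : _ = 1%E) ?mule1//; exact: probability_setT.
Qed.

Lemma integrable_scaleE {R : realType} {disp} {T : measurableType disp}
    (mu : {measure set T -> \bar R}) (k : R) (h : T -> R) :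
  mu.-integrable setT (EFin \o h) ->
  mu.-integrable setT (EFin \o (fun x => k * h x)).
Proof. by move=> ih; exact: (integrableZl measurableT k ih). Qed.

Lemma integrable_addE {R : realType} {disp} {T : measurableType disp}
    (mu : {measure set T -> \bar R}) (h k : T -> R) :
  mu.-integrable setT (EFin \o h) -> mu.-integrable setT (EFin \o k) ->
  mu.-integrable setT (EFin \o (fun x => h x + k x)).
Proof. by move=> ih ik; exact: (integrableD measurableT ih ik). Qed.

Section hellinger_l1.
Context {R : realType} (d : nat).
Implicit Types (x y t s : rspace R d).
Variables (M : R) (p q : probability (rspace R d) R).
Hypotheses (M0 : 0 < M) (pM : supp p `<=` cube M) (qM : supp q `<=` cube M).

Let f := mixture p.
Let g := mixture q.

Hypotheses (intf : (leb d).-integrable setT (EFin \o f))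
  (intg : (leb d).-integrable setT (EFin \o g)).

Let t1 := \int[leb d]_x `|f x - g x|.

Let cg := @gauss_cst R d.
Let cg0 : 0 < cg. Proof. exact: gauss_cst_gt0. Qed.

Lemma icube_cases x : icube M x = 0 \/ icube M x = 1 /\ cube M x.
Proof.
rewrite /icube indicE; have [h|h] := boolP (x \in cube M); last by left.
by right; split=> //; move: h; rewrite inE.
Qed.

Let intfg : (leb d).-integrable setT (EFin \o (fun x => f x - g x)).
Proof.
rewrite (_ : _ \o _ = (EFin \o f) \- (EFin \o g))%E; first exact: integrableB.
by apply/funext => x /=; rewrite EFinB.
Qed.

Let t1_ge0 : 0 <= t1. Proof. exact: Rintegral_ge0. Qed.

Let ek (z : rspace R d * rspace R d) := expR (- (sqd z.1 z.2 / 4)) * icube M z.2.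

Let bek : bdmeas ek.
Proof.
apply: bdmeasM; first exact: bdmeas_sqd_exp.
exact: (bdmeas_comp measurable_snd (bdmeas_icube d M)).
Qed.

Let ek0 z : 0 <= ek z.
Proof.
by apply: mulr_ge0; [exact: expR_ge0|have /andP[] := icube01 M z.2].
Qed.

Let c1 := cg ^+ 2 * gauss_vol d 1.
Let c1_gt0 : 0 < c1.
Proof. by apply: mulr_gt0; [exact: exprn_gt0|exact: gauss_vol_gt0]. Qed.

Let mixture_conv (r : probability (rspace R d) R) x : supp r `<=` cube M ->
  \int[leb d]_y (mixture r y * std_gauss (rsub x y)) = c1 * \int[r]_t ek (x, t).
Proof.
move=> rM.
have mw : measurable_fun setT (fun y => std_gauss (rsub x y)).
  by have [] := bdmeas_std_gauss x.
(* Plain Tonelli is obtained from the bilinear form with second kernel 1 and the smoothing Gaussian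
   as weight. *)
have := @integral_bilinear R _ _ _ _ (leb d) r r (gkern M) (fun=> 1)
  (fun y => std_gauss (rsub x y)) (bdmeas_gkern d M).1 (measurable_cst _) mw
  (@gkern_ge0 _ _ M) (fun=> ler01) (fun y => ltW (std_gauss_gt0 _)).
under eq_integral => y _.
  rewrite integral_prob_cst mule1.
  rewrite -RintegralE; last exact: (bdmeas_fst y (bdmeas_gkern d M)).
  rewrite -(mixtureE y rM) -EFinM.
  over.
move=> /= h; rewrite [LHS]/Rintegral h.
under eq_integral => t _.
  rewrite integral_prob_cst.
  under eq_integral => y _.
    rewrite mulr1 /gkern/= mulrAC mulrC.
    over.
  rewrite ge0_integralZ_EFin; last 3 first.
  - by have /andP[] := icube01 M t.
  - by move=> y; rewrite mulr_ge0// ltW// std_gauss_gt0.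
  - apply: measurable_funM => //.
    apply: measurableT_comp; first exact: measurable_std_gauss.
    exact: measurable_rsubl.
  rewrite gauss_conv -/cg -/c1 -EFinM mulrCA [_ * expR _]mulrC.
  over.
rewrite -RintegralE; last first.
  by apply: bdmeasM (bdmeas_cst _) _; exact: (bdmeas_fst x bek).
by rewrite Rintegral_scaleE//; exact: (bdmeas_fst x bek).
Qed.

Let integrable_mul_std (h : rspace R d -> R) x :
  (leb d).-integrable setT (EFin \o h) ->
  (leb d).-integrable setT (EFin \o (fun y => h y * std_gauss (rsub x y))).
Proof.
move=> ih; have [mg [B gB]] := bdmeas_std_gauss x.
have mh : measurable_fun setT h by apply/measurable_EFinP; exact: measurable_int ih.
apply: (@le_integrable _ _ _ (leb d) setT measurableT _ (fun y => B%:E * (EFin \o h) y)%E).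
- by apply/measurable_EFinP; exact: measurable_funM.
- move=> y _ /=; rewrite lee_fin normrM [leRHS]normrM mulrC ler_wpM2r//.
  by rewrite (le_trans (gB y))// ler_norm.
- exact: integrableZl.
Qed.

Let conv_diff_le x : `|\int[p]_t ek (x, t) - \int[q]_t ek (x, t)| <= c1^-1 * (cg * t1).
Proof.
rewrite ler_pdivlMl// -[X in X * _](gtr0_norm c1_gt0) -normrM mulrBr.
rewrite -!mixture_conv// -RintegralB//; [|exact: integrable_mul_std..].
rewrite (@eq_Rintegral _ _ _ _ _ (fun y => (f y - g y) * std_gauss (rsub x y))); last first.
  by move=> y _; rewrite mulrBl.
have ih := integrable_mul_std x intfg.
apply: (le_trans (le_normr_Rintegral _ ih)) => //.
rewrite /t1 -RintegralZl//; last exact: (integrable_norm intfg).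
apply: le_Rintegral => //; first exact: (integrable_norm ih).
  exact: integrable_scaleE (integrable_norm intfg).
move=> y _; rewrite normrM mulrC ler_wpM2r//.
by rewrite ger0_norm ?std_gauss_le// ltW// std_gauss_gt0.
Qed.

Section center.
Variable t0 : rspace R d.
Hypothesis t0M : forall i, `|tnth t0 i| <= M.

Let v (i : 'I_d) t := icube M t * (tnth t i - tnth t0 i).

Let mv i : measurable_fun setT (v i).
Proof.
apply: measurable_funM; first by have [] := bdmeas_icube d M.
by apply: measurable_funB => //; exact: measurable_tnth.
Qed.

Let v_le i t : `|v i t| <= 2 * M.
Proof.
rewrite /v; have [->|[-> tM]] := icube_cases t.
  by rewrite mul0r normr0 mulr_ge0// ltW.
rewrite mul1r (le_trans (ler_normB _ _))//.
have := tM i; have := t0M i; lra.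
Qed.

Let c2 := cg * gauss_vol d (4 / 3).
Let c2_gt0 : 0 < c2.
Proof. by apply: mulr_gt0 => //; apply: gauss_vol_gt0; rewrite divr_gt0. Qed.

Let kerA_int t s :
  (\int[leb d]_x (gkern M (x, t) * ek (x, s) * c2^-1)%:E)%E =
  (kerA v (icube M) (t, s))%:E.
Proof.
transitivity (\int[leb d]_x ((icube M t * icube M s / c2) *
  (std_gauss (rsub x t) * expR (- (sqd x s / 4))))%:E)%E.
  by apply: eq_integral => x _; congr (_%:E); rewrite /gkern /ek/=; ring.
have /andP[ct _] := icube01 M t; have /andP[cs _] := icube01 M s.
rewrite ge0_integralZ_EFin.
- rewrite gauss_prod2 -EFinM; congr (_%:E).
  rewrite (mulrA (gauss_cst d)) -/cg -/c2 -[LHS]mulrA (mulrA c2^-1) mulVf ?gt_eqF// mul1r /kerA/=.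
  have [->|[-> tM]] := icube_cases t; first by rewrite !mul0r.
  have [->|[-> sM]] := icube_cases s; first by rewrite !mulr0 !mul0r.
  congr (_ * expR (- _)); rewrite /sqd mulr_suml; apply: eq_bigr => i _.
  rewrite /v /icube !indicE !mem_set// !mul1r; congr (_ ^+ 2 / _); ring.
- by apply: divr_ge0; [exact: mulr_ge0|exact: (ltW c2_gt0)].
- by move=> x; rewrite mulr_ge0 ?expR_ge0// ltW// std_gauss_gt0.
- apply: measurable_funM.
    apply: measurableT_comp; first exact: measurable_std_gauss.
    exact: measurable_rsubl.
  apply: measurableT_comp => //; apply: measurableT_comp => //.
  apply: measurable_funM => //.
  have h : measurable_fun setT (fun x : rspace R d => (x, s)).
    exact: measurable_fun_pair.
  exact: (measurableT_comp (@measurable_sqd R d) h).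
Qed.

Let icube_le1 t : 0 <= icube M t <= 1. Proof. exact: icube01. Qed.
Let micube : measurable_fun setT (@icube R d M). Proof. by have [] := bdmeas_icube d M. Qed.
Let L0 : 0 <= 2 * M. Proof. by rewrite mulr_ge0// ltW. Qed.

(** The form is the integral of f - g against its own smoothing. The smoothing is uniformly at most
    a multiple of [t1] by [conv_diff_le], and integrating |f - g| gives the second factor. *)
Lemma nunu_kerA_le :
  nunu p q (kerA v (icube M)) <= (cg / (c1 * c2)) * t1 ^+ 2.
Proof.
have bA := bdmeas_kerA mv v_le micube icube_le1.
have ID := integral_bilinear_diff p q (bdmeas_gkern d M) bek bA
  (measurable_cst c2^-1) (@gkern_ge0 _ _ M) ek0
  (fun=> (ltW (etrans (invr_gt0 c2) c2_gt0))) kerA_int.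
have II := integrable_bilinear_diff p q (bdmeas_gkern d M) bek bA
  (measurable_cst c2^-1) (@gkern_ge0 _ _ M) ek0
  (fun=> (ltW (etrans (invr_gt0 c2) c2_gt0))) kerA_int.
rewrite -ID; apply: (le_trans (ler_norm _)).
apply: (le_trans (le_normr_Rintegral _ II)) => //.
rewrite (_ : _ * t1 ^+ 2 = (c1^-1 * (cg * t1) / c2) * t1); last first.
  by rewrite invfM; ring.
rewrite {2}/t1 -RintegralZl//; last exact: (integrable_norm intfg).
apply: le_Rintegral => //; first exact: (integrable_norm II).
  exact: integrable_scaleE (integrable_norm intfg).
move=> x _; rewrite -!mixtureE// -/f -/g !normrM -[leLHS]mulrA [leRHS]mulrC.
apply: ler_wpM2l => //; have c20 : 0 <= c2^-1 by rewrite invr_ge0 (ltW c2_gt0).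
rewrite [`|c2^-1|]ger0_norm//; exact: ler_wpM2r.
Qed.

Let c3 := cg * gauss_vol d 2.
Let c3_gt0 : 0 < c3.
Proof. by apply: mulr_gt0 => //; exact: gauss_vol_gt0. Qed.

Let wchi x := c3^-1 * (std_gauss (rsub x t0))^-1.

Let wchi_ge0 x : 0 <= wchi x.
Proof. by rewrite mulr_ge0// invr_ge0 ltW// std_gauss_gt0. Qed.

Let mstd (t : rspace R d) : measurable_fun setT (fun x => std_gauss (rsub x t)).
Proof.
apply: measurableT_comp; first exact: measurable_std_gauss.
exact: measurable_rsubl.
Qed.

Let mstdV : measurable_fun setT (fun x => (std_gauss (rsub x t0))^-1).
Proof.
have -> : (fun x => (std_gauss (rsub x t0))^-1) =
    (fun x => cg^-1 * expR (sqd x t0 / 2)).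
  by apply/funext => x; rewrite std_gaussE invfM -expRN opprK.
apply: measurable_funM => //; apply: measurableT_comp => //.
apply: measurable_funM => //.
have h : measurable_fun setT (fun x : rspace R d => (x, t0)).
  exact: measurable_fun_pair.
exact: (measurableT_comp (@measurable_sqd R d) h).
Qed.

Let mwchi : measurable_fun setT wchi.
Proof. exact: measurable_funM. Qed.

Let kerQ_int t s :
  (\int[leb d]_x (gkern M (x, t) * gkern M (x, s) * wchi x)%:E)%E =
  (kerQ v (icube M) (t, s))%:E.
Proof.
transitivity (\int[leb d]_x ((icube M t * icube M s / c3) *
  (std_gauss (rsub x t) * std_gauss (rsub x s) * (std_gauss (rsub x t0))^-1))%:E)%E.
  by apply: eq_integral => x _; congr (_%:E); rewrite /gkern /wchi/=; ring.
have /andP[ct _] := icube01 M t; have /andP[cs _] := icube01 M s.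
rewrite ge0_integralZ_EFin.
- rewrite gauss_chi -EFinM; congr (_%:E).
  rewrite (mulrA (gauss_cst d)) -/cg -/c3 -[LHS]mulrA (mulrA c3^-1) mulVf ?gt_eqF// mul1r /kerQ/=.
  have [->|[-> tM]] := icube_cases t; first by rewrite !mul0r.
  have [->|[-> sM]] := icube_cases s; first by rewrite !mulr0 !mul0r.
  congr (_ * expR _); apply: eq_bigr => i _.
  by rewrite /v /icube !indicE !mem_set// !mul1r.
- by apply: divr_ge0; [exact: mulr_ge0|exact: (ltW c3_gt0)].
- by move=> x; rewrite !mulr_ge0// ?invr_ge0// ltW// std_gauss_gt0.
- by apply: measurable_funM => //; exact: measurable_funM.
Qed.

Let bQ := bdmeas_kerQ mv v_le micube icube_le1.

Let chi x := (f x - g x) ^+ 2 / std_gauss (rsub x t0).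

Let chiE x : c3^-1 * chi x =
  (\int[p]_t gkern M (x, t) - \int[q]_t gkern M (x, t)) *
  (\int[p]_t gkern M (x, t) - \int[q]_t gkern M (x, t)) * wchi x.
Proof. by rewrite -!mixtureE// /chi /wchi -/f -/g; ring. Qed.

Lemma chi_integrable : (leb d).-integrable setT (EFin \o chi).
Proof.
have := integrable_bilinear_diff p q (bdmeas_gkern d M) (bdmeas_gkern d M) bQ
  mwchi (@gkern_ge0 _ _ M) (@gkern_ge0 _ _ M) wchi_ge0 kerQ_int.
move=> /(integrable_scaleE c3); congr (integrable _ _ _).
by apply/funext => x /=; rewrite -chiE mulVKf ?gt_eqF.
Qed.

Let chi_int : \int[leb d]_x chi x = c3 * nunu p q (kerQ v (icube M)).
Proof.
rewrite -(integral_bilinear_diff p q (bdmeas_gkern d M) (bdmeas_gkern d M) bQ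
  mwchi (@gkern_ge0 _ _ M) (@gkern_ge0 _ _ M) wchi_ge0 kerQ_int).
transitivity (c3 * \int[leb d]_x (c3^-1 * chi x)).
  by rewrite RintegralZl ?mulVKf ?gt_eqF//; exact: chi_integrable.
by congr (_ * _); apply: eq_Rintegral => x _; exact: chiE.
Qed.

Definition l1_cst : R :=
  @gauss_cst R d / ((@gauss_cst R d ^+ 2 * gauss_vol d 1) *
                    (@gauss_cst R d * gauss_vol d (4 / 3))).

Lemma chi_le K : (0 < K)%N ->
  \int[leb d]_x ((f x - g x) ^+ 2 / std_gauss (rsub x t0)) <=
  (@gauss_cst R d * gauss_vol d 2) *
  ((20 * d%:R ^+ 2 + 20 * d%:R + 20) * K%:R ^+ (3 * d) * 4 ^+ K *
    (l1_cst * t1 ^+ 2 + K%:R ^- K * expR (5 * d%:R * (2 * M) ^+ 2 * K%:R))).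
Proof.
move=> K0; rewrite -/cg -/c3 -/(chi _) chi_int ler_wpM2l// ?(ltW c3_gt0)//.
apply: (moment_inequality mv L0 v_le micube icube_le1 K0 nunu_kerA_le).
rewrite mulr_ge0 ?sqr_ge0// divr_ge0 ?(ltW cg0)// mulr_ge0//.
  exact: (ltW c1_gt0).
exact: (ltW c2_gt0).
Qed.

End center.

Definition corner (e : {ffun 'I_d -> bool}) : rspace R d :=
  [tuple (if e i then M else - M) | i < d].

Lemma corner_le e i : `|tnth (corner e) i| <= M.
Proof.
by rewrite tnth_mktuple; case: (e i); rewrite ?normrN ger0_norm// ltW.
Qed.

(* A concave function of theta on the cube, such as the log-density at x, is
   minimized at a corner; that corner depends on x only. *)
Lemma mixture_ge_corner x : exists e, std_gauss (rsub x (corner e)) <= f x.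
Proof.
pose e : {ffun 'I_d -> bool} := [ffun i => tnth x i <= 0].
exists e; rewrite /f (mixtureE _ pM).
have cI : \int[p]_t icube M t = 1.
  rewrite -[RHS](Rintegral_cstE p 1) (Rintegral_icube pM (bdmeas_cst 1)).
  by apply: eq_Rintegral => t _; rewrite mul1r.
rewrite -[leLHS]mulr1 -cI -Rintegral_scaleE; last exact: bdmeas_icube.
apply: le_Rintegral => //.
- apply: bdmeas_integrable; apply: bdmeasM (bdmeas_cst _) _; exact: bdmeas_icube.
- by apply: bdmeas_integrable; exact: (bdmeas_fst x (bdmeas_gkern d M)).
move=> t _; rewrite /gkern/=.
have [->|[-> tM]] := icube_cases t; first by rewrite !mulr0.
rewrite !mulr1 !std_gaussE ler_wpM2l ?(ltW cg0)// ler_expR lerN2 ler_wpM2r//.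
apply: ler_sum => i _; rewrite tnth_mktuple ffunE.
have := tM i; rewrite ler_norml => /andP[h1 h2].
case: ifPn => [x0|]; last rewrite -ltNge => x0; nra.
Qed.

Let mf : measurable_fun setT f. Proof. exact: (measurable_mixture pM). Qed.
Let mg : measurable_fun setT g. Proof. exact: (measurable_mixture qM). Qed.

Let f_ge0 x : 0 <= f x.
Proof. by rewrite /f (mixtureE _ pM); apply: Rintegral_ge0 => t _; exact: gkern_ge0. Qed.
Let g_ge0 x : 0 <= g x.
Proof. by rewrite /g (mixtureE _ qM); apply: Rintegral_ge0 => t _; exact: gkern_ge0. Qed.

(** f - g is the product of the difference and the sum of the square roots, and the square of that
    sum is at least f, hence at least a Gaussian at some corner. Summing over all corners removes
    the dependence of this corner on [x]. *)
Let sqrt_diff_le x : (Num.sqrt (f x) - Num.sqrt (g x)) ^+ 2 <=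
  \sum_e (f x - g x) ^+ 2 / std_gauss (rsub x (corner e)).
Proof.
have [e he] := mixture_ge_corner x.
rewrite (bigD1 e)//= ler_wpDr//.
  by apply: sumr_ge0 => e' _; rewrite divr_ge0 ?sqr_ge0// ltW// std_gauss_gt0.
have s0 : 0 < std_gauss (rsub x (corner e)) by exact: std_gauss_gt0.
rewrite ler_pdivlMr//.
have fE := sqr_sqrtr (f_ge0 x); have gE := sqr_sqrtr (g_ge0 x).
have a0 := sqrtr_ge0 (f x); have b0 := sqrtr_ge0 (g x).
rewrite -{2}fE -{2}gE subr_sqr exprMn ler_wpM2l ?sqr_ge0//.
by rewrite (le_trans he)// -{1}fE lerXn2r ?nnegrE ?addr_ge0// lerDl.
Qed.

Let msqrt_diff : measurable_fun setT (fun x => (Num.sqrt (f x) - Num.sqrt (g x)) ^+ 2).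
Proof.
have ms : measurable_fun setT (@Num.sqrt R).
  exact: continuous_measurable_fun (@sqrt_continuous R).
apply: measurable_funX; apply: measurable_funB.
  exact: (measurableT_comp ms mf).
exact: (measurableT_comp ms mg).
Qed.

Let sqrt_integrable :
  (leb d).-integrable setT (EFin \o (fun x => (Num.sqrt (f x) - Num.sqrt (g x)) ^+ 2)).
Proof.
apply: (@le_integrable _ _ _ (leb d) setT measurableT _ (EFin \o (fun x => f x + g x))).
- exact/measurable_EFinP.
- move=> x _ /=; rewrite lee_fin !ger0_norm ?sqr_ge0 ?addr_ge0//.
  have fE := sqr_sqrtr (f_ge0 x); have gE := sqr_sqrtr (g_ge0 x).
  have a0 := sqrtr_ge0 (f x); have b0 := sqrtr_ge0 (g x); nra.
- exact: integrable_addE.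
Qed.

Let Iterm e := chi_integrable (corner_le e).

Lemma hellinger_sqrE : hellinger f g ^+ 2 =
  2^-1 * \int[leb d]_x (Num.sqrt (f x) - Num.sqrt (g x)) ^+ 2.
Proof.
rewrite /hellinger sqr_sqrtr// mulr_ge0//; apply: Rintegral_ge0 => x _.
exact: sqr_ge0.
Qed.

Lemma hellinger_le1 : \int[leb d]_x f x = 1 -> \int[leb d]_x g x = 1 ->
  hellinger f g ^+ 2 <= 1.
Proof.
move=> f1 g1; rewrite hellinger_sqrE -ler_pdivlMl ?invr_gt0// invrK mulr1.
have -> : 2 = \int[leb d]_x (f x + g x) :> R by rewrite RintegralD// f1 g1.
apply: le_Rintegral => //.
  exact: integrable_addE.
move=> x _.
have fE := sqr_sqrtr (f_ge0 x); have gE := sqr_sqrtr (g_ge0 x).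
have a0 := sqrtr_ge0 (f x); have b0 := sqrtr_ge0 (g x); nra.
Qed.

Lemma hellinger_le K : (0 < K)%N -> hellinger f g ^+ 2 <=
  2 ^+ d * ((@gauss_cst R d * gauss_vol d 2) *
  ((20 * d%:R ^+ 2 + 20 * d%:R + 20) * K%:R ^+ (3 * d) * 4 ^+ K *
    (l1_cst * t1 ^+ 2 + K%:R ^- K * expR (5 * d%:R * (2 * M) ^+ 2 * K%:R)))).
Proof.
move=> K0; rewrite hellinger_sqrE.
set B := gauss_cst d * _ * _.
have I0 : 0 <= \int[leb d]_x (Num.sqrt (f x) - Num.sqrt (g x)) ^+ 2.
  by apply: Rintegral_ge0 => x _; exact: sqr_ge0.
apply: (@le_trans _ _ (\int[leb d]_x (Num.sqrt (f x) - Num.sqrt (g x)) ^+ 2)).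
  by rewrite ler_piMl// invf_le1// ler1n.
(* Integrability and the bound are carried together because additivity of the integral needs the
   former at each step. *)
have isum (r : seq {ffun 'I_d -> bool}) : (leb d).-integrable setT
    (EFin \o (fun x => \sum_(e <- r) (f x - g x) ^+ 2 / std_gauss (rsub x (corner e)))) /\
    \int[leb d]_x (\sum_(e <- r) (f x - g x) ^+ 2 / std_gauss (rsub x (corner e))) <=
    (size r)%:R * B.
  elim: r => [|e r [IH1 IH2]].
    rewrite mul0r; split.
      rewrite (_ : _ \o _ = cst 0%E); first exact: integrable0.
      by apply/funext => x /=; rewrite big_nil.
    rewrite (@eq_Rintegral _ _ _ _ _ (fun=> 0)); last first.
      by move=> x _; rewrite big_nil.
    by rewrite /Rintegral integral0.
  have E1 : (fun x => \sum_(e' <- e :: r) (f x - g x) ^+ 2 / std_gauss (rsub x (corner e'))) =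
    (fun x => (f x - g x) ^+ 2 / std_gauss (rsub x (corner e)) +
      \sum_(e <- r) (f x - g x) ^+ 2 / std_gauss (rsub x (corner e))).
    by apply/funext => x; rewrite big_cons.
  rewrite E1; split.
    exact: (integrable_addE (Iterm e) IH1).
  rewrite (RintegralD measurableT (Iterm e) IH1) /= -natr1 mulrDl mul1r addrC.
  exact: (lerD IH2 (chi_le (corner_le e) K0)).
have [i1 i2] := isum (index_enum _).
apply: (@le_trans _ _ (\int[leb d]_x (\sum_e (f x - g x) ^+ 2 / std_gauss (rsub x (corner e))))).
  by apply: le_Rintegral => // x _; exact: sqrt_diff_le.
apply: (le_trans i2).
rewrite [X in X%:R](_ : _ = 2 ^ d)%N ?natrX//.
by rewrite /index_enum -enumT -cardT card_ffun card_bool card_ord.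
Qed.

End hellinger_l1.

Section densities.
Context {R : realType} (d : nat).
Variables (P Q : probability (rspace R d) R) (f g : rspace R d -> R).
Hypotheses (Pf : is_density P f) (Qg : is_density Q g).

Lemma density_integrable (P' : probability (rspace R d) R) h : is_density P' h ->
  (leb d).-integrable setT (EFin \o h).
Proof.
move=> [mh h0 hE]; apply/integrableP; split; first exact/measurable_EFinP.
under eq_integral do rewrite /= ger0_norm//.
by rewrite -hE// (le_lt_trans (probability_le1 _ _))// ltry.
Qed.

Lemma density_Rintegral (P' : probability (rspace R d) R) h A : is_density P' h ->
  measurable A -> \int[leb d]_(x in A) h x = fine (P' A).
Proof. by move=> [mh h0 hE] mA; rewrite /Rintegral -hE. Qed.

Lemma density_Rintegral1 (P' : probability (rspace R d) R) h : is_density P' h ->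
  \int[leb d]_x h x = 1.
Proof.
by move=> dh; rewrite (density_Rintegral dh)//; have -> : P' setT = 1%E by exact: probability_setT.
Qed.

Let intfg : (leb d).-integrable setT (EFin \o (fun x => f x - g x)).
Proof.
have := integrableB measurableT (density_integrable Pf) (density_integrable Qg).
by congr (integrable _ _ _); apply/funext => x /=; rewrite EFinB.
Qed.

Let int_diff A : measurable A ->
  \int[leb d]_(x in A) (f x - g x) = fine (P A) - fine (Q A).
Proof.
move=> mA; rewrite RintegralB//.
- by rewrite (density_Rintegral Pf)// (density_Rintegral Qg).
- exact: integrableS (density_integrable Pf).
- exact: integrableS (density_integrable Qg).
Qed.

Let int_diff0 : \int[leb d]_x (f x - g x) = 0.
Proof.
rewrite int_diff//; have -> : P setT = 1%E by exact: probability_setT.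
by have -> : Q setT = 1%E by [exact: probability_setT]; rewrite subrr.
Qed.

Lemma l1_le_of_measurable (D : R) :
  (forall B, measurable B -> fine (P B) - fine (Q B) <= D) ->
  \int[leb d]_x `|f x - g x| <= 2 * D.
Proof.
move=> PQ; have mfg : measurable_fun setT (fun x => f x - g x).
  by case: Pf => mf _ _; case: Qg => mg _ _; exact: measurable_funB.
rewrite (Rintegral_norm_split intfg int_diff0 (measurable_ge0_set mfg))//.
  by rewrite ler_wpM2l// int_diff ?PQ//; exact: measurable_ge0_set.
by move=> x /= /negP; rewrite -ltNge => /ltW.
Qed.

(** Links [tv], defined through densities against P + Q, to the Lebesgue densities by evaluating
    both on the Yatracos set. The factor 1/2 is given away. *)
Lemma tv_le_l1 : fine (tv P Q) <= \int[leb d]_x `|f x - g x|.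
Proof.
rewrite tv_yatracosE -int_diff; last exact: measurable_yatracos_set.
apply: le_trans (ler_norm _) _.
apply: le_trans (norm_Rintegral_le intfg int_diff0 (measurable_yatracos_set P Q)) _.
rewrite ler_piMl ?invf_le1 ?ler1n//; exact: Rintegral_ge0.
Qed.

End densities.

(** * Risk of the minimum distance law *)

Section yatracos_deterministic.
Context {disp : measure_display} {T : measurableType disp} {R : realType}.
Implicit Types (P Q : probability T R) (A B : set T).

Lemma fine_prob01 P A : measurable A -> 0 <= fine (P A) <= 1.
Proof.
move=> mA; rewrite fine_ge0//= -lee_fin fineK ?fin_num_measure//.
exact: probability_le1.
Qed.

Variables (model : set (probability T R)) (eta : R) (N : nat)
  (c : 'I_N -> probability T R) (emp : set T -> \bar R) (est P0 : probability T R)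
  (D : R).
Hypotheses (cov : tv_covering model eta c) (mP0 : model P0) (mest : model est).
Hypothesis estP : class_dist (yatracos_class c) est emp <=
  class_dist (yatracos_class c) P0 emp.
Hypotheses (D0 : 0 <= D) (PD : forall A, yatracos_class c A ->
  `|fine (P0 A) - fine (emp A)| <= D).

Lemma measurable_yatracos_class A : yatracos_class c A -> measurable A.
Proof. by move=> [i [j [_ ->]]]; exact: measurable_yatracos_set. Qed.

Let dist_P0 : class_dist (yatracos_class c) P0 emp <= D.
Proof.
rewrite /class_dist; set S := [set _ | _ in _].
have [->|/set0P S0] := eqVneq S set0; first by rewrite sup0.
by apply: sup_le_ub => // _ [A cA <-]; exact: PD.
Qed.

Let est_emp A : yatracos_class c A -> `|fine (est A) - fine (emp A)| <= D.
Proof.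
move=> cA; apply: le_trans (le_trans estP dist_P0).
apply: ub_le_sup; last by exists A.
(* [sup] is an upper bound only of a bounded set: probabilities differ by at most 1, and the
   empirical value is within [D] of that of [P0]. *)
exists (1 + D) => _ [B cB <-].
have mB := measurable_yatracos_class cB.
have := PD cB; have := fine_prob01 est mB; have := fine_prob01 P0 mB.
rewrite !ler_norml; lra.
Qed.

(** Both laws are replaced by centers within [eta], once on [B] and once on the Yatracos set that
    realizes the distance of the centers: 4 eta. On that set both are within [D] of the empirical
    law: 2 D. *)
Lemma yatracos_le B : measurable B ->
  fine (P0 B) - fine (est B) <= 4 * eta + 2 * D.
Proof.
move=> mB; have [i Pi] := cov mP0; have [j Pj] := cov mest.
have {}Pi : fine (tv P0 (c i)) <= eta by rewrite -lee_fin fineK// tv_fin_num.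
have {}Pj : fine (tv est (c j)) <= eta by rewrite -lee_fin fineK// tv_fin_num.
have hi := le_trans (le_tv P0 (c i) mB) Pi.
have hj := le_trans (le_tv est (c j) mB) Pj.
(* Equal centers have no Yatracos set in the class, but the triangle inequality through the common
   center already gives 2 eta. *)
have [ij|ij] := eqVneq i j.
  move: hi hj; rewrite ij !ler_norml => /andP[a1 a2] /andP[b1 b2].
  have eta0 : 0 <= eta by lra.
  have D20 : 0 <= 2 * D by rewrite mulr_ge0.
  by lra.
pose Y := yatracos_set (c i) (c j).
have cY : yatracos_class c Y by exists i, j.
have mY := measurable_yatracos_class cY.
have hij := le_tv (c i) (c j) mB; rewrite tv_yatracosE -/Y in hij.
have hiY := le_trans (le_tv P0 (c i) mY) Pi.
have hjY := le_trans (le_tv est (c j) mY) Pj.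
have := est_emp cY; have := PD cY.
move: hi hj hij hiY hjY; rewrite !ler_norml; lra.
Qed.

End yatracos_deterministic.

(** * Deviations of the empirical law *)

Lemma expR1_le3 {R : realType} : expR 1 <= 3 :> R.
Proof.
(* exp (-1/6) >= 5/6, and (6/5)^6 is just below 3. *)
have h6 : expR (6^-1) <= 6 / 5 :> R.
  rewrite -[6^-1]opprK expRN -[6 / 5]invrK lef_pV2 ?posrE ?expR_gt0 ?invr_gt0 ?divr_gt0//.
  by apply: le_trans (expR_ge1Dx _); lra.
have -> : 1 = 6%:R * 6^-1 :> R by rewrite mulfV.
rewrite expRM_natl; apply: (le_trans (lerXn2r 6 _ _ h6)); rewrite ?nnegrE ?expR_ge0 ?divr_ge0//.
by rewrite !exprS !expr0; lra.
Qed.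

Section lower_integral.
Context {R : realType} {disp} {T : measurableType disp}.
Variable mu : {measure set T -> \bar R}.

(* The integral of a nonnegative function is a supremum over the simple
   functions below it, hence monotone without measurability. *)
Lemma ge0_integral_le (f g : T -> \bar R) : (forall x, 0 <= f x)%E ->
  (forall x, f x <= g x)%E -> (\int[mu]_x f x <= \int[mu]_x g x)%E.
Proof.
move=> f0 fg; have g0 x : (0 <= g x)%E by exact: le_trans (fg x).
rewrite !ge0_integralTE//; apply: le_ereal_sup => _ [h hf <-].
by exists h => // x; exact: le_trans (hf x) (fg x).
Qed.

End lower_integral.

Section chernoff.
Context {R : realType} {disp disp' : measure_display} {Omega : measurableType disp}
  {T : measurableType disp'} (Pr : probability Omega R) (n : nat)
  (X : 'I_n -> {RV Pr >-> T}) (A : set T) (r : R).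
Hypotheses (indX : mutually_independent X) (mA : measurable A)
  (PA : forall i, fine (Pr (X i @^-1` A)) = r).

Let ind (i : 'I_n) (w : Omega) : R := \1_A (X i w).

Let mXA i : measurable (X i @^-1` A).
Proof. by rewrite -[_ @^-1` _]setTI; exact: measurable_funPT. Qed.

Let bind i : bdmeas (ind i).
Proof.
split; first by apply: measurableT_comp => //; exact: measurable_indic.
by exists 1 => w; rewrite /ind indicE; case: (_ \in _); rewrite ?normr1 ?normr0.
Qed.

(** Independence is given for events only, so the product is expanded over subsets [J]; each term is
    a multiple of the indicator of an intersection of preimages. *)
Lemma integral_prod_indep (a : R) :
  \int[Pr]_w (\prod_(i < n) (a * ind i w + 1)) = (a * r + 1) ^+ n.
Proof.
have distr (F : 'I_n -> R) : \prod_(i < n) (F i + 1) =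
    \sum_(J : {set 'I_n}) \prod_i (if i \in J then F i else 1).
  by rewrite bigA_distr; apply: eq_bigl.
under eq_Rintegral do rewrite distr.
have bif i (J : {set 'I_n}) : bdmeas (fun w => if i \in J then a * ind i w else 1).
  by case: (i \in J); [exact: bdmeasM (bdmeas_cst _) _|exact: bdmeas_cst].
rewrite Rintegral_sumE; last by move=> J; apply: bdmeas_prod => i; exact: bif.
transitivity (\sum_(J : {set 'I_n}) \prod_(i < n) (if i \in J then a * r else 1)); last first.
  by rewrite -distr prodr_const card_ord.
apply: eq_bigr => J _.
pose S : set Omega := \bigcap_(i in [set` J]) (X i @^-1` A).
have mS : measurable S.
  by apply: fin_bigcap_measurable => // i _; exact: mXA.
have -> : \prod_(i < n) (if i \in J then a * r else 1) = a ^+ #|J| * \prod_(i in J) r.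
  by rewrite -big_mkcond/= big_split/= prodr_const.
rewrite (@eq_Rintegral _ _ _ _ _ (fun w => a ^+ #|J| * \1_S w)); last first.
  move=> w _; rewrite -big_mkcond/= big_split/= prodr_const; congr (_ * _).
  have [wS|wS] := boolP (w \in S).
    rewrite indicE wS big1// => i iJ; rewrite /ind indicE mem_set//.
    by move: wS; rewrite inE; apply.
  rewrite indicE (negbTE wS).
  have [i iJ iA] : exists2 i, i \in J & ~ A (X i w).
    apply: contrapT => h; move/negP: wS; apply; rewrite inE => i /= iJ.
    by apply: contrapT => iA; apply: h; exists i.
  by rewrite (bigD1 i)//= /ind indicE memNset// mul0r.
have bS : bdmeas (\1_S : Omega -> R).
  split; first exact: measurable_indic.
  by exists 1 => w; rewrite indicE; case: (_ \in _); rewrite ?normr1 ?normr0.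
rewrite Rintegral_scaleE//; congr (_ * _).
rewrite /Rintegral integral_indic// setIT.
transitivity (fine (\prod_(i in J) Pr (X i @^-1` A))%E).
  by congr fine; exact: (indX J (fun=> mA)).
rewrite (eq_bigr (fun=> r%:E)) => [|i _]; last first.
  by rewrite -(PA i) fineK// fin_num_measure.
by rewrite prodEFin.
Qed.

(** [expK_tail] at order 2 with ratio 1/l: the remainder is at most l^2 exp 1. *)
Lemma expR_quadratic (l : R) : 0 < l <= 1 -> expR l <= 1 + l + 3 * l ^+ 2.
Proof.
move=> /andP[l0 l1]; have r1 : 1 <= l^-1 by rewrite invf_ge1.
have := @expK_tail R 2 l l^-1 r1; rewrite (_ : l^-1 ^- 2 = l ^+ 2); last first.
  by rewrite exprVn invrK.
rewrite (ger0_norm (ltW l0)) mulVf ?gt_eqF// /expK !big_ord_recl big_ord0 /= expr0 expr1.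
rewrite !divr1 addr0 => h.
have e3 := @expR1_le3 R.
have l2 : 0 <= l ^+ 2 by exact: sqr_ge0.
have := ler_wpM2l l2 e3; move: h; rewrite ler_norml; lra.
Qed.

Hypothesis n0 : (0 < n)%N.

Lemma chernoff (u : R) : 0 < u <= 6 -> 0 <= r <= 1 ->
  fine (Pr [set w | n%:R * (r + u) <= \sum_(i < n) ind i w]) <=
  expR (- (n%:R * u ^+ 2 / 12)).
Proof.
move=> /andP[u0 u6] /andP[r0 r1].
(* This minimizes 3 l^2 - l u, with value - u^2 / 12; the bound u <= 6 gives l <= 1. *)
pose l := u / 6.
have l01 : 0 < l <= 1 by rewrite divr_gt0//= ler_pdivrMr// mul1r.
set B := [set w | _].
have bsum : bdmeas (fun w => \sum_(i < n) ind i w) by exact: bdmeas_sum.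
have mB : measurable B.
  rewrite (_ : B = [set w | 0 <= \sum_(i < n) ind i w - n%:R * (r + u)]).
    by apply: measurable_ge0_set; have [] := bdmeasB bsum (bdmeas_cst (n%:R * (r + u))).
  by apply/seteqP; split=> w /=; rewrite subr_ge0.
have bB : bdmeas (\1_B : Omega -> R).
  split; first exact: measurable_indic.
  by exists 1 => w; rewrite indicE; case: (_ \in _); rewrite ?normr1 ?normr0.
have -> : fine (Pr B) = \int[Pr]_w (\1_B w).
  by rewrite /Rintegral integral_indic// setIT.
have indE i w : expR (l * ind i w) = (expR l - 1) * ind i w + 1.
  rewrite /ind indicE; case: (_ \in _); first by rewrite !mulr1 subrK.
  by rewrite !mulr0 expR0 add0r.
have bprod : bdmeas (fun w => \prod_(i < n) ((expR l - 1) * ind i w + 1)).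
  apply: bdmeas_prod => i; apply: bdmeasD (bdmeas_cst _).
  by apply: bdmeasM (bdmeas_cst _) _.
apply: (@le_trans _ _ (\int[Pr]_w (expR (- (l * (n%:R * (r + u)))) *
    \prod_(i < n) ((expR l - 1) * ind i w + 1)))).
  apply: le_Rintegral => //; first exact: bdmeas_integrable.
    by apply: bdmeas_integrable; apply: bdmeasM (bdmeas_cst _) _.
  move=> w _; under eq_bigr do rewrite -indE.
  rewrite -expR_sum -expRD -mulr_sumr addrC -mulrBr.
  rewrite indicE; have [wB|_] := boolP (w \in B); last exact: expR_ge0.
  rewrite -[leLHS]expR0 ler_expR mulr_ge0 ?(ltW (andP l01).1)// subr_ge0.
  by move: wB; rewrite inE.
rewrite Rintegral_scaleE// integral_prod_indep.
have h1 : (expR l - 1) * r + 1 <= expR ((expR l - 1) * r).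
  by rewrite addrC; exact: expR_ge1Dx.
have e1 : 0 <= expR l - 1.
  by rewrite subr_ge0 -[leLHS]expR0 ler_expR (ltW (andP l01).1).
have h2 : ((expR l - 1) * r + 1) ^+ n <= expR (n%:R * ((expR l - 1) * r)).
  by rewrite expRM_natl lerXn2r ?nnegrE ?expR_ge0// addr_ge0// mulr_ge0.
apply: (le_trans (ler_wpM2l (expR_ge0 _) h2)); rewrite -expRD ler_expR.
have hq := expR_quadratic l01.
have h3 : (expR l - 1) * r <= l * r + 3 * l ^+ 2.
  have : (expR l - 1) * r <= (l + 3 * l ^+ 2) * r by rewrite ler_wpM2r//; lra.
  have : 3 * l ^+ 2 * r <= 3 * l ^+ 2 by rewrite ler_piMr// mulr_ge0// sqr_ge0.
  lra.
have nR : 0 <= n%:R :> R by [].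
rewrite (_ : - (l * (n%:R * (r + u))) + n%:R * ((expR l - 1) * r) =
  n%:R * ((expR l - 1) * r - l * r - l * u)); last ring.
rewrite (_ : - (n%:R * u ^+ 2 / 12) = n%:R * (3 * l ^+ 2 - l * u)); last first.
  by rewrite /l; field.
by rewrite ler_wpM2l//; lra.
Qed.

End chernoff.

Section deviation.
Context {R : realType} {disp disp' : measure_display} {Omega : measurableType disp}
  {T : measurableType disp'} (Pr : probability Omega R) (n : nat)
  (X : 'I_n -> {RV Pr >-> T}) (mu : set T -> R).
Hypotheses (indX : mutually_independent X) (n0 : (0 < n)%N).
Hypothesis Xmu : forall i A, measurable A -> fine (Pr (X i @^-1` A)) = mu A.

Lemma fine_empirical (s : n.-tuple T) (A : set T) :
  fine (@empirical _ _ R n s A) = n%:R^-1 * \sum_(i < n) \1_A (tnth s i).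
Proof.
rewrite /empirical (eq_bigr (fun i => (\1_A (tnth s i))%:E)); last first.
  by move=> i _; rewrite diracE indicE.
by rewrite sumEFin -EFinM.
Qed.

Let sum_ind A w := \sum_(i < n) (\1_A (X i w) : R).

Let bsum A : measurable A -> bdmeas (sum_ind A).
Proof.
move=> mA; apply: bdmeas_sum => i.
split; first by apply: measurableT_comp => //; exact: measurable_indic.
by exists 1 => w; rewrite indicE; case: (_ \in _); rewrite ?normr1 ?normr0.
Qed.

Let empE w A : fine (@empirical _ _ R n (sample X w) A) = n%:R^-1 * sum_ind A w.
Proof.
rewrite fine_empirical; congr (_ * _).
by apply: eq_bigr => i _; rewrite tnth_mktuple.
Qed.

Let sum_indC A w : sum_ind (~` A) w = n%:R - sum_ind A w.
Proof.
have -> : n%:R = \sum_(i < n) (1 : R) by rewrite sumr_const card_ord.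
rewrite /sum_ind -sumrB; apply: eq_bigr => i _.
by rewrite !indicE in_setC; case: (_ \in A); rewrite /= ?subr0 ?subrr.
Qed.

Let sum_ind01 A w : 0 <= sum_ind A w <= n%:R.
Proof.
have ge0 B : 0 <= sum_ind B w.
  by apply: sumr_ge0 => i _; rewrite indicE.
by rewrite ge0/= -subr_ge0 -sum_indC ge0.
Qed.

Let nR0 : 0 < n%:R :> R. Proof. by rewrite ltr0n. Qed.

Let mXA A i : measurable A -> measurable (X i @^-1` A).
Proof. by move=> mA; rewrite -[_ @^-1` _]setTI; exact: measurable_funPT. Qed.

Let i0 : 'I_n := Ordinal n0.

Let mu01 A : measurable A -> 0 <= mu A <= 1.
Proof. by move=> mA; rewrite -(Xmu i0 mA); apply: fine_prob01; exact: mXA. Qed.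

Let muC A : measurable A -> mu (~` A) = 1 - mu A.
Proof.
move=> mA; rewrite -(Xmu i0 mA) -(Xmu i0 (measurableC mA)) preimage_setC.
by rewrite probability_setC ?fineB//; [exact: fin_num_measure (mXA _ mA)|exact: mXA].
Qed.

Definition deviates (A : set T) (u : R) : set Omega :=
  [set w | u < `|mu A - fine (@empirical _ _ R n (sample X w) A)|].

Lemma measurable_deviates A (u : R) : measurable A -> measurable (deviates A u).
Proof.
move=> mA; rewrite (_ : deviates A u =
  ~` [set w | 0 <= u - `|mu A - n%:R^-1 * sum_ind A w| ]).
  apply: measurableC; apply: measurable_ge0_set.
  apply: measurable_funB => //; apply: measurableT_comp => //.
  apply: measurable_funB => //; apply: measurable_funM => //.
  by have [] := bsum mA.
apply/seteqP; split=> w; rewrite /deviates /= empE subr_ge0 ltNge.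
  by move/negP.
by move=> /negP.
Qed.

Lemma deviation_le A (u : R) : measurable A -> 0 < u ->
  fine (Pr (deviates A u)) <= 2 * expR (- (n%:R * u ^+ 2 / 12)).
Proof.
move=> mA u0; have mD := measurable_deviates u mA.
(* Beyond 6 the event is empty, since both quantities lie in [0, 1]. *)
have [u6|u6] := leP u 6; last first.
  rewrite (_ : deviates A u = set0) ?measure0; first by rewrite mulr_ge0 ?expR_ge0.
  apply/seteqP; split => w //; rewrite /deviates /= empE => h.
  have /andP[m0 m1] := mu01 mA; have /andP[s0 s1] := sum_ind01 A w.
  have : n%:R^-1 * sum_ind A w <= 1 by rewrite ler_pdivrMl// mulr1.
  have : 0 <= n%:R^-1 * sum_ind A w by rewrite mulr_ge0// invr_ge0 ltW.
  move: h; rewrite lter_normr; lra.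
pose B C := [set w | n%:R * (mu C + u) <= sum_ind C w].
have mB C : measurable C -> measurable (B C).
  move=> mC; rewrite (_ : B C = [set w | 0 <= sum_ind C w - n%:R * (mu C + u)]).
    apply: measurable_ge0_set.
    by have [] := bdmeasB (bsum mC) (bdmeas_cst (n%:R * (mu C + u))).
  by apply/seteqP; split=> w /=; rewrite subr_ge0.
have PB C : measurable C -> fine (Pr (B C)) <= expR (- (n%:R * u ^+ 2 / 12)).
  move=> mC; apply: (chernoff indX mC (fun i => Xmu i mC)) => //; first by rewrite u0 u6.
  exact: mu01.
have mA' := measurableC mA.
(* A downward deviation of [A] is an upward deviation of its complement, so the one-sided bound
   suffices. *)
have sub : deviates A u `<=` B A `|` B (~` A).
  move=> w; rewrite /deviates /B /= empE sum_indC muC// => h.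
  pose m := n%:R^-1 * sum_ind A w.
  have sE : sum_ind A w = n%:R * m by rewrite /m mulVKf// gt_eqF.
  move: h; rewrite -/m lter_normr sE => /orP[h|h]; [right|left].
    rewrite (_ : n%:R - n%:R * m = n%:R * (1 - m)); last ring.
    by rewrite ler_wpM2l ?(ltW nR0)//; lra.
  by rewrite ler_wpM2l ?(ltW nR0)//; lra.
have mU : measurable (B A `|` B (~` A)) by apply: measurableU; exact: mB.
have : (Pr (deviates A u) <= Pr (B A) + Pr (B (~` A)))%E.
  apply: (le_trans (le_measure _ _ _ sub)); rewrite ?inE//.
  by apply: measureU2; exact: mB.
have finB C : measurable C -> Pr (B C) \is a fin_num.
  by move=> mC; apply: fin_num_measure; exact: mB.
rewrite -(fineK (fin_num_measure Pr _ mD)) -(fineK (finB _ mA)) -(fineK (finB _ mA')).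
rewrite lee_fin; have := PB _ mA; have := PB _ mA'; lra.
Qed.

(* The selected law is an arbitrary minimizer, so H may fail to be measurable. *)
Lemma expectation_deviation N (cls : 'I_N * 'I_N -> set T) (H : Omega -> R) (a u : R) :
  (forall k, measurable (cls k)) -> 0 < u -> 0 <= a ->
  (forall w, 0 <= H w <= 1) ->
  (forall w, (forall k, `|mu (cls k) - fine (@empirical _ _ R n (sample X w) (cls k))| <= u) ->
     H w <= a) ->
  ('E_Pr[H] <= (a + 2 * N%:R ^+ 2 * expR (- (n%:R * u ^+ 2 / 12)))%:E)%E.
Proof.
move=> mcls u0 a0 H01 Ha.
pose G w := a + \sum_k \1_(deviates (cls k) u) w.
have bi k : bdmeas (\1_(deviates (cls k) u) : Omega -> R).
  split; first by apply: measurable_indic; exact: measurable_deviates.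
  by exists 1 => w; rewrite indicE; case: (_ \in _); rewrite ?normr1 ?normr0.
have bG : bdmeas G by apply: bdmeasD (bdmeas_cst _) _; exact: bdmeas_sum.
have HG w : H w <= G w.
  have [h|h] := pselect (forall k, ~ deviates (cls k) u w).
    apply: le_trans (Ha w _) _.
      by move=> k; rewrite leNgt; apply/negP; exact: h.
    by rewrite /G lerDl; apply: sumr_ge0 => k _; rewrite indicE.
  have [k kw] : exists k, deviates (cls k) u w.
    by apply: contrapT => h'; apply: h => k kw; apply: h'; exists k.
  have /andP[_ H1] := H01 w; apply: (le_trans H1); rewrite /G (bigD1 k)//=.
  rewrite indicE mem_set// addrCA lerDl addr_ge0//.
  by apply: sumr_ge0 => j _; rewrite indicE.
rewrite unlock; apply: (@le_trans _ _ (\int[Pr]_w (G w)%:E)%E).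
  apply: ge0_integral_le => w; rewrite lee_fin ?HG//.
  by have /andP[] := H01 w.
rewrite -RintegralE// lee_fin Rintegral_addE ?Rintegral_cstE; last 2 first.
- exact: bdmeas_cst.
- exact: bdmeas_sum.
rewrite lerD2l Rintegral_sumE//.
apply: (@le_trans _ _ (\sum_(k : 'I_N * 'I_N) 2 * expR (- (n%:R * u ^+ 2 / 12)))).
  apply: ler_sum => k _.
  rewrite /Rintegral integral_indic//; last exact: measurable_deviates.
  by rewrite setIT; exact: deviation_le.
rewrite sumr_const card_prod card_ord -[leLHS]mulr_natl natrM.
by rewrite le_eqVlt; apply/orP; left; apply/eqP; ring.
Qed.

End deviation.

(** * Metric entropy of the mixtures *)

Section covering.
Context {R : realType} (d : nat).
Implicit Types (x y t s : rspace R d) (p q : probability (rspace R d) R).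
Variable M : R.
Hypothesis M0 : 0 < M.

Definition covering_cst : R :=
  @gauss_cst R d * expR (4 * d%:R * M ^+ 2) * gauss_vol d 4.

Lemma covering_cst_gt0 : 0 < covering_cst.
Proof.
apply: mulr_gt0; last exact: gauss_vol_gt0.
by apply: mulr_gt0; [exact: gauss_cst_gt0|exact: expR_gt0].
Qed.

Section moments_determine.
Variables (B : nat).
Notation I := {ffun 'I_d -> 'I_B}.

Let v (i : 'I_d) t := icube M t * (tnth t i / M).

Let ev t := expR (- (\sum_i (M * v i t) ^+ 2 / 2)).

(* The factor ev is the theta-part of the Gaussian kernel, so that only
   expR (<x, theta>) remains to be expanded. *)
Definition nmom (a : I) t : R := icube M t * ev t * \prod_i v i t ^+ a i.

Let bic := bdmeas_icube d M.

Let v_le i t : `|v i t| <= 1.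
Proof.
rewrite /v; have [->|[-> tM]] := icube_cases M t; first by rewrite mul0r normr0.
by rewrite mul1r normrM normfV (gtr0_norm M0) ler_pdivrMr// mul1r; exact: tM.
Qed.

Let bv i : bdmeas (v i).
Proof.
split; last by exists 1.
apply: measurable_funM; first by case: bic.
by apply: measurable_funM => //; exact: measurable_tnth.
Qed.

Let ev01 t : 0 <= ev t <= 1.
Proof.
rewrite expR_ge0/= expR_le1 oppr_le0; apply: sumr_ge0 => i _.
by rewrite divr_ge0// sqr_ge0.
Qed.

Let bev : bdmeas ev.
Proof.
apply: bdmeas_expR; under eq_fun do rewrite -sumrN.
apply: bdmeas_sum => i; under eq_fun do rewrite -mulrN.
by apply: bdmeasM (bdmeas_cst _); apply: bdmeasX; apply: bdmeasM (bdmeas_cst _) _.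
Qed.

Let ic_norm t : `|icube M t| <= 1.
Proof. by have /andP[? ?] := icube01 M t; rewrite ger0_norm. Qed.

Let ev_norm t : `|ev t| <= 1.
Proof. by have /andP[? ?] := ev01 t; rewrite ger0_norm. Qed.

Lemma bdmeas_nmom a : bdmeas (nmom a).
Proof.
apply: bdmeasM; first exact: bdmeasM.
by apply: bdmeas_prod => i; exact: bdmeasX.
Qed.

Lemma nmom_le a t : `|nmom a t| <= 1.
Proof.
rewrite !normrM -[leRHS]mulr1 ler_pM// -?normrM// ?normr_ge0//.
  by rewrite normrM -[leRHS]mulr1 ler_pM.
by rewrite normr_prod prodr_ile1// => i _; rewrite normr_ge0 normrX exprn_ile1.
Qed.

Let n1 x := \sum_i `|tnth x i|.

Let gkern_expand x t : gkern M (x, t) =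
  @gauss_cst R d * expR (- (\sum_i tnth x i ^+ 2 / 2)) *
  (icube M t * ev t * expR (\sum_i (M * tnth x i) * v i t)).
Proof.
rewrite /gkern std_gaussE /ev /=.
have [->|[-> tM]] := icube_cases M t; first by rewrite !mulr0 !mul0r mulr0.
rewrite mulr1 mul1r -mulrA -!expRD; congr (_ * expR _).
rewrite /sqd mulr_suml -!sumrN -!big_split/=; apply: eq_bigr => i _.
rewrite /v /icube indicE mem_set// mul1r.
by have m0 : M != 0 by [rewrite gt_eqF]; field.
Qed.

(** The expansion costs exp (2 M |x|_1), which half of the Gaussian decay in x absorbs. The other
    half remains, so that the bound can be integrated in x. *)
Lemma mixture_diff_le p q (tau : R) x : 0 <= tau ->
  supp p `<=` cube M -> supp q `<=` cube M ->
  (forall a : I, `|nu p q (nmom a)| <= tau) ->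
  `|mixture p x - mixture q x| <=
  @gauss_cst R d * expR (4 * d%:R * M ^+ 2) * (tau + 2 * d%:R * 2 ^- B) *
  expR (- (\sum_i tnth x i ^+ 2 / 4)).
Proof.
move=> tau0 pM qM mpq.
pose w := @gauss_cst R d * expR (- (\sum_i tnth x i ^+ 2 / 2)).
have w0 : 0 <= w by rewrite mulr_ge0 ?expR_ge0// ltW// gauss_cst_gt0.
pose h t := icube M t * ev t * expR (\sum_i (M * tnth x i) * v i t).
have bh : bdmeas h.
  apply: bdmeasM; first exact: bdmeasM.
  apply: bdmeas_expR; apply: bdmeas_sum => i.
  by apply: bdmeasM (bdmeas_cst _) _.
have -> : mixture p x - mixture q x = w * nu p q h.
  rewrite -nuM// /nu (mixtureE x pM) (mixtureE x qM).
  by congr (_ - _); apply: eq_Rintegral => t _; exact: gkern_expand.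
pose k t := \sum_(a : I) (\prod_i ((M * tnth x i) ^+ a i / (a i)`!%:R)) * nmom a t.
have bk : bdmeas k.
  by apply: bdmeas_sum => a; apply: bdmeasM (bdmeas_cst _) _; exact: bdmeas_nmom.
have hk t : `|h t - k t| <= d%:R * 2 ^- B * expR (2 * (M * n1 x)).
  rewrite (_ : k t = icube M t * ev t * \prod_i expK B ((M * tnth x i) * v i t)).
    rewrite -mulrBr normrM -[leRHS]mul1r ler_pM//.
      by rewrite normrM -[leRHS]mulr1 ler_pM.
    apply: (le_trans (prod_expK_tail B _ (ler1n _ 2))).
    rewrite ler_wpM2l ?mulr_ge0 ?invr_ge0 ?exprn_ge0// ler_expR ler_wpM2l//.
    rewrite mulr_sumr; apply: ler_sum => i _.
    rewrite (normrM (M * tnth x i) (v i t)) (normrM M) (gtr0_norm M0).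
    by apply: ler_piMr => //; exact: mulr_ge0 (ltW M0) (normr_ge0 _).
  rewrite prod_expKE mulr_sumr; apply: eq_bigr => a _.
  rewrite /nmom mulrCA; congr (_ * _).
  rewrite -big_split/=; apply: eq_bigr => i _. by rewrite [in RHS]exprMn mulrAC.
have nk : `|nu p q k| <= tau * expR (M * n1 x).
  rewrite /k nu_sum; last first.
    by move=> a; apply: bdmeasM (bdmeas_cst _) _; exact: bdmeas_nmom.
  apply: (le_trans (ler_norm_sum _ _ _)).
  apply: (@le_trans _ _ (\sum_(a : I) tau * \prod_i (`|M * tnth x i| ^+ a i / (a i)`!%:R))).
    apply: ler_sum => a _; rewrite nuM; last exact: bdmeas_nmom.
    rewrite normrM mulrC; apply: ler_pM => //.
    rewrite normr_prod; apply: ler_prod => i _; rewrite normr_ge0/=.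
    by rewrite normrM normfV normrX (ger0_norm (ler0n _ _)).
  rewrite -mulr_sumr ler_wpM2l// -prod_expKE mulr_sumr expR_sum.
  apply: ler_prod => i _; rewrite expK_ge0//=.
  by rewrite normrM (gtr0_norm M0) expK_le// mulr_ge0// ltW.
rewrite normrM (ger0_norm w0).
have n0 : 0 <= M * n1 x by rewrite mulr_ge0 ?(ltW M0)//; exact: sumr_ge0.
have nh : `|nu p q h| <= (tau + 2 * d%:R * 2 ^- B) * expR (2 * (M * n1 x)).
  rewrite -[nu p q h](subrK (nu p q k)); apply: (le_trans (ler_normD _ _)).
  rewrite mulrDl [leRHS]addrC; apply: lerD.
    by apply: (le_trans (nu_approx p q bh bk hk)); rewrite !mulrA.
  by apply: (le_trans nk); rewrite ler_wpM2l// ler_expR; lra.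
apply: (le_trans (ler_wpM2l w0 nh)).
rewrite /w -!mulrA ler_wpM2l ?(ltW (gauss_cst_gt0 _))//.
rewrite mulrCA [leRHS]mulrCA ler_wpM2l ?addr_ge0 ?mulr_ge0 ?invr_ge0 ?exprn_ge0//.
rewrite -!expRD ler_expR.
have -> : 4 * (d%:R * M ^+ 2) = \sum_(i < d) 4 * M ^+ 2.
  by rewrite sumr_const card_ord -[RHS]mulr_natl; ring.
rewrite /n1 !mulr_sumr -!sumrN -!big_split/=; apply: ler_sum => i _.
(* Expanding this square gives 2 M |x| - x^2 / 2 <= 4 M^2 - x^2 / 4. *)
have : 0 <= (`|tnth x i| / 2 - 2 * M) ^+ 2 by exact: sqr_ge0.
have : `|tnth x i| ^+ 2 = tnth x i ^+ 2 by rewrite real_normK// num_real.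
move: `|tnth x i| => y; lra.
Qed.

Lemma l1_of_moments (P Q : probability (rspace R d) R) p q (tau : R) : 0 <= tau ->
  supp p `<=` cube M -> supp q `<=` cube M ->
  is_density P (mixture p) -> is_density Q (mixture q) ->
  (forall a : I, `|nu p q (nmom a)| <= tau) ->
  \int[leb d]_x `|mixture p x - mixture q x| <=
  covering_cst * (tau + 2 * d%:R * 2 ^- B).
Proof.
move=> tau0 pM qM dP dQ mpq.
pose C := @gauss_cst R d * expR (4 * d%:R * M ^+ 2) * (tau + 2 * d%:R * 2 ^- B).
pose ee x := expR (- (\sum_i tnth x i ^+ 2 / 4)).
have eeE : (\int[leb d]_x (ee x)%:E)%E = (gauss_vol d 4)%:E.
  rewrite (@integral_gauss R d 4 0 [tuple 0 | i < d] ee) ?expR0 ?mulr1//.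
  move=> x; rewrite /ee sub0r; congr (expR (- _)).
  by apply: eq_bigr => i _; rewrite tnth_mktuple subr0.
have mee : measurable_fun setT ee.
  have h : measurable_fun setT (fun x : rspace R d => (x, [tuple 0 | i < d] : rspace R d)).
    exact: measurable_fun_pair.
  have [me _] := @bdmeas_sqd_exp R d 4 (ler0n R 4).
  rewrite (_ : ee = fun x => expR (- (sqd x [tuple 0 | i < d] / 4))).
    exact: (measurableT_comp me h).
  apply/funext => x; rewrite /ee /sqd mulr_suml; congr (expR (- _)).
  by apply: eq_bigr => i _; rewrite tnth_mktuple subr0.
have iee : (leb d).-integrable setT (EFin \o ee).
  apply/integrableP; split; first exact/measurable_EFinP.
  under eq_integral do rewrite /= ger0_norm ?expR_ge0//.
  by rewrite eeE ltry.
have -> : covering_cst * (tau + 2 * d%:R * 2 ^- B) = C * \int[leb d]_x ee x.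
  by rewrite /Rintegral eeE /covering_cst /C /=; ring.
rewrite -RintegralZl//; apply: le_Rintegral => //.
- apply: (@integrable_norm _ _ _ (leb d) setT (fun x => mixture p x - mixture q x)).
  have := integrableB measurableT (density_integrable dP) (density_integrable dQ).
  by congr (integrable _ _ _); apply/funext => x /=; rewrite EFinB.
- exact: integrable_scaleE.
- by move=> x _; exact: mixture_diff_le.
Qed.

End moments_determine.

(** Each of the B^d moments lies in [-1, 1] and is rounded to a multiple of [tau]. Priors with the
    same digits have moments within [tau], so by [l1_of_moments] one law per nonempty cell is
    enough. *)
Lemma covering_exists (P0 : probability (rspace R d) R) (tau : R) (B : nat) :
  0 < tau ->
  exists c' : 'I_((truncn (2 / tau)).+1 ^ (B ^ d)) -> probability (rspace R d) R,
    tv_covering (mixtures M) (covering_cst * (tau + 2 * d%:R * 2 ^- B)) c'.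
Proof.
move=> tau0; pose L := (truncn (2 / tau)).+1.
pose I : finType := {ffun 'I_d -> 'I_B}.
pose digit (p : probability (rspace R d) R) (a : I) : 'I_L :=
  inord (truncn ((\int[p]_t nmom a t + 1) / tau)).
have digitE p a : (digit p a)%:R <= (\int[p]_t nmom a t + 1) / tau < (digit p a).+1%:R.
  have := Rintegral_norm_le p (bdmeas_nmom a) (nmom_le a).
  rewrite ler_norml => /andP[h1 h2].
  have y0 : 0 <= (\int[p]_t nmom a t + 1) / tau by rewrite divr_ge0 ?(ltW tau0)//; lra.
  rewrite /digit inordK; first exact: truncn_itv.
  rewrite ltnS truncn_ge_nat ?divr_ge0 ?(ltW tau0)//.
  have /andP[t1 _] := truncn_itv y0; apply: (le_trans t1).
  by rewrite ler_wpM2r ?invr_ge0 ?(ltW tau0)//; lra.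
have digit_eq p q a : digit p a = digit q a -> `|nu p q (nmom a)| <= tau.
  move=> pq; have := digitE p a; have := digitE q a; rewrite -pq -natr1.
  rewrite !ler_pdivlMr// !ltr_pdivrMr// => /andP[h1 h2] /andP[h3 h4].
  move: h1 h2 h3 h4; rewrite !mulrDl mul1r /nu ler_norml; lra.
pose cell (k : {ffun I -> 'I_L}) (P : probability (rspace R d) R) :=
  exists2 p : probability (rspace R d) R, supp p `<=` cube M /\ (forall a, digit p a = k a) &
    is_density P (mixture p).
have cardE : #|{ffun I -> 'I_L}| = (L ^ (B ^ d))%N.
  by rewrite card_ffun !card_ord card_ffun !card_ord.
(* [P0] fills the empty cells. *)
pose center (k : {ffun I -> 'I_L}) : probability (rspace R d) R :=
  if pselect (exists P, cell k P) is left h then sval (cid h) else P0.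
have centerP k P : cell k P -> cell k (center k).
  by move=> kP; rewrite /center; case: pselect => [h|[]]; [case: cid|exists P].
exists (fun j => center (enum_val (cast_ord (esym cardE) j))) => P [p pM dP].
pose k : {ffun I -> 'I_L} := [ffun a => digit p a].
exists (cast_ord cardE (enum_rank k)); rewrite cast_ordK enum_rankK.
have [q [qM qk] dQ] : cell k (center k).
  by apply: (centerP _ P); exists p => //; split=> // a; rewrite ffunE.
rewrite -(fineK (tv_fin_num P (center k))) lee_fin.
apply: (le_trans (tv_le_l1 dP dQ)).
apply: (l1_of_moments (ltW tau0) pM qM dP dQ) => a.
by apply: digit_eq; rewrite qk ffunE.
Qed.

End covering.

(** * Nonasymptotic risk bound *)

Section same_density.
Context {R : realType} (d : nat).

(** The reported density of the selected law is any version, while the analytic bounds concern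
    mixtures; the two agree almost everywhere. *)
Lemma hellinger_density (P : probability (rspace R d) R) (f g g' : rspace R d -> R) :
  measurable_fun setT f -> is_density P g -> is_density P g' ->
  hellinger f g = hellinger f g'.
Proof.
move=> mf dg dg'; have [mg _ gE] := dg; have [mg' _ g'E] := dg'.
have ms : measurable_fun setT (@Num.sqrt R).
  exact: continuous_measurable_fun (@sqrt_continuous R).
have mh (h : rspace R d -> R) : measurable_fun setT h ->
    measurable_fun setT (EFin \o (fun x : rspace R d => (Num.sqrt (f x) - Num.sqrt (h x)) ^+ 2)).
  move=> m; apply/measurable_EFinP; apply: measurable_funX.
  by apply: measurable_funB; [exact: (measurableT_comp ms mf)|exact: (measurableT_comp ms m)].
have ae : ae_eq (leb d) setT (EFin \o g) (EFin \o g').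
  apply: integral_ae_eq => //.
  - exact: density_integrable dg.
  - exact/measurable_EFinP.
  - by move=> E _ mE; rewrite /= -gE// -g'E.
rewrite /hellinger; congr (Num.sqrt (_ * fine _)).
apply: ae_eq_integral => //; [exact: mh|exact: mh|].
move: ae; apply: filterS => x /= h _; have [gg] := h I.
by rewrite gg.
Qed.

End same_density.

Section nonasymptotic.
Context {R : realType} (d : nat).

Definition hell_cst : R := 2 ^+ d * ((@gauss_cst R d * gauss_vol d 2) *
  (20 * d%:R ^+ 2 + 20 * d%:R + 20)).

Lemma hell_cst_ge0 : 0 <= hell_cst.
Proof.
apply: mulr_ge0; first exact: exprn_ge0.
apply: mulr_ge0; last by rewrite !addr_ge0 ?mulr_ge0 ?exprn_ge0.
by apply: mulr_ge0; apply: ltW; [exact: gauss_cst_gt0|exact: gauss_vol_gt0].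
Qed.

Lemma l1_cst_ge0 : 0 <= @l1_cst R d.
Proof.
have g0 := @gauss_cst_gt0 R d.
apply: divr_ge0; first exact: ltW.
apply: mulr_ge0; apply: mulr_ge0; rewrite ?exprn_ge0 ?(ltW g0)//;
  by apply: ltW; apply: gauss_vol_gt0; rewrite ?divr_gt0.
Qed.

Lemma yatracos_risk (M eta tau u eps : R) (n N B K : nat)
  (c : 'I_N -> probability (rspace R d) R)
  (est : n.-tuple (rspace R d) -> probability (rspace R d) R)
  (fhat : n.-tuple (rspace R d) -> rspace R d -> R)
  (prior P0 Q : probability (rspace R d) R)
  (disp : measure_display) (Omega : measurableType disp)
  (Pr : probability Omega R) (X : 'I_n -> {RV Pr >-> rspace R d}) :
  0 < M -> (0 < n)%N -> (0 < K)%N -> 0 < tau -> 0 < u -> 0 <= eps < 1 ->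
  covering_cst d M * (tau + 2 * d%:R * 2 ^- B) <= eta ->
  minimal_tv_covering (mixtures M) eta c ->
  yatracos_estimator (mixtures M) c est ->
  (forall s, is_density (est s) (fhat s)) ->
  supp prior `<=` cube M -> is_density P0 (mixture prior) ->
  iid_from X (contaminated eps P0 Q) ->
  ('E_Pr[fun w => (hellinger (mixture prior) (fhat (sample X w)) ^+ 2)%R]
    <= (hell_cst * K%:R ^+ (3 * d) * 4 ^+ K *
        (l1_cst d * (2 * (4 * eta + 2 * (eps + u))) ^+ 2 +
         K%:R ^- K * expR (5 * d%:R * (2 * M) ^+ 2 * K%:R)) +
        2 * ((truncn (2 / tau)).+1%:R ^+ (B ^ d)) ^+ 2 *
          expR (- (n%:R * u ^+ 2 / 12)))%:E)%E.
Proof.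
move=> M0 n0 K0 tau0 u0 /andP[e0 e1] etaB [cov mincov] estP densP priorM dP0 [indX distX].
have [c' cov'] := covering_exists M0 P0 B tau0.
(* Minimality turns the explicit covering into a bound on the number of centers, hence of events in
   the union bound. *)
have NN : (N <= (truncn (2 / tau)).+1 ^ (B ^ d))%N.
  apply: mincov (c') _ => P mP; have [i Pi] := cov' P mP; exists i.
  by apply: (le_trans Pi); rewrite lee_fin.
have mP0 : mixtures M P0 by exists prior.
pose mu A := (1 - eps) * fine (P0 A) + eps * fine (Q A).
have Xmu i A : measurable A -> fine (Pr (X i @^-1` A)) = mu A.
  move=> mA; have := distX i A mA; rewrite /distribution /pushforward => ->.
  by rewrite /contaminated fineD ?fineM// ?fin_numM// fin_num_measure.
pose cls (k : 'I_N * 'I_N) := yatracos_set (c k.1) (c k.2).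
have mcls k : measurable (cls k) by exact: measurable_yatracos_set.
have eta0 : 0 <= eta.
  apply: le_trans etaB; rewrite mulr_ge0 ?(ltW (covering_cst_gt0 _ M))//.
  by rewrite addr_ge0 ?(ltW tau0)// !mulr_ge0// invr_ge0 exprn_ge0.
set a := _ * 4 ^+ K * _.
have a0 : 0 <= a.
  apply: mulr_ge0.
    by apply: mulr_ge0; rewrite ?exprn_ge0// mulr_ge0 ?exprn_ge0 ?hell_cst_ge0.
  apply: addr_ge0; apply: mulr_ge0; rewrite ?l1_cst_ge0 ?sqr_ge0 ?expR_ge0//.
have fhatE w : exists2 q : probability (rspace R d) R,
    supp q `<=` cube M /\ is_density (est (sample X w)) (mixture q) &
    hellinger (mixture prior) (fhat (sample X w)) = hellinger (mixture prior) (mixture q).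
  have [[q qM dq] _] := estP (sample X w); exists q => //.
  by apply: hellinger_density (densP _) dq; exact: measurable_mixture priorM.
have H01 w : 0 <= hellinger (mixture prior) (fhat (sample X w)) ^+ 2 <= 1.
  rewrite sqr_ge0/=; have [q [qM dq] ->] := fhatE w.
  apply: (hellinger_le1 priorM qM (density_integrable dP0) (density_integrable dq)).
    exact: density_Rintegral1 dP0.
  exact: density_Rintegral1 dq.
have Ha w : (forall k, `|mu (cls k) -
      fine (@empirical _ _ R n (sample X w) (cls k))| <= u) ->
    hellinger (mixture prior) (fhat (sample X w)) ^+ 2 <= a.
  move=> dev; have [q [qM dq] ->] := fhatE w.
  have l1 : \int[leb d]_x `|mixture prior x - mixture q x| <=
      2 * (4 * eta + 2 * (eps + u)).
    apply: (l1_le_of_measurable dP0 dq) => C mC.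
    have [mest est_le] := estP (sample X w).
    apply: (yatracos_le cov mP0 mest (est_le _ mP0)) => //.
      by rewrite addr_ge0// ltW.
    move=> A [i [j [ij AE]]]; have mA : measurable A by rewrite AE; exact: measurable_yatracos_set.
    have := dev (i, j); rewrite /cls/= -AE /mu.
    have /andP[p0 p1] := fine_prob01 P0 mA; have /andP[q0 q1] := fine_prob01 Q mA.
    move: (fine (P0 A)) (fine (Q A)) (fine _) p0 p1 q0 q1 => x y z p0 p1 q0 q1.
    (* The sampling law differs from [P0] on each set by eps (Q - P0), at most [eps] in absolute
       value. *)
    rewrite !ler_norml => /andP[h1 h2]; by apply/andP; split; nra.
  apply: (le_trans (hellinger_le M0 priorM qM (density_integrable dP0)
    (density_integrable dq) K0)).
  set I := \int[_]_x _ in l1 *.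
  have I0 : 0 <= I by exact: Rintegral_ge0.
  set g := gauss_cst d * _; set p20 := 20 * _ + _ + _; set rest := K%:R ^- K * _.
  rewrite (_ : 2 ^+ d * _ = hell_cst * K%:R ^+ (3 * d) * 4 ^+ K * (l1_cst d * I ^+ 2 + rest)); last first.
    by rewrite /hell_cst -/g -/p20; ring.
  rewrite /a ler_wpM2l//.
    by apply: mulr_ge0; rewrite ?exprn_ge0// mulr_ge0 ?exprn_ge0 ?hell_cst_ge0.
  by rewrite lerD2r ler_wpM2l ?l1_cst_ge0// lerXn2r ?nnegrE// (le_trans I0).
apply: (le_trans (expectation_deviation indX n0 Xmu mcls u0 a0 H01 Ha)).
rewrite lee_fin lerD2l ler_wpM2r ?expR_ge0// ler_wpM2l// lerXn2r ?nnegrE//.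
by rewrite -natrX ler_nat.
Qed.

End nonasymptotic.

(** * Rates *)

Section growth.
Context {R : realType}.

Lemma expR_half_le2 : expR 2^-1 <= 2 :> R.
Proof.
rewrite -[2^-1]opprK expRN -[leRHS]invrK lef_pV2 ?posrE ?expR_gt0 ?invr_gt0//.
by apply: le_trans (expR_ge1Dx _); lra.
Qed.

Lemma ln2_ge_half : 2^-1 <= ln 2 :> R.
Proof. by rewrite -[leLHS]expRK ler_ln ?posrE ?expR_gt0// expR_half_le2. Qed.

Lemma expR_ge4 : 4 <= expR (3 / 2) :> R.
Proof.
rewrite (_ : 3 / 2 = 12%:R * 8^-1 :> R); last by field.
(* exp (1/8) >= 9/8, and (9/8)^12 exceeds 4. *)
rewrite expRM_natl; apply: (@le_trans _ _ ((9 / 8) ^+ 12)).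
  by rewrite !exprS expr0; lra.
have h := expR_ge1Dx (8^-1 : R).
by rewrite lerXn2r ?nnegrE ?expR_ge0 ?divr_ge0// (le_trans _ h)//; lra.
Qed.

(** 8/5 = 3/2 + 1/10: the first part pays for 4^K, the second for the polynomial. Any exponent
    between ln 4 and 16/9 would keep (9/4) times it below the budget 4. *)
Lemma poly_exp_growth d K : K%:R ^+ (3 * d) * 4 ^+ K <=
  10 ^+ (3 * d) * (3 * d)`!%:R * expR (8 / 5 * K%:R) :> R.
Proof.
rewrite (_ : 8 / 5 * K%:R = 10^-1 * K%:R + 3 / 2 * K%:R :> R); last by field.
rewrite expRD [leRHS]mulrA; apply: ler_pM; rewrite ?exprn_ge0//; last first.
  by rewrite expRM_natr lerXn2r ?nnegrE ?expR_ge0// expR_ge4.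
have x0 : 0 <= 10^-1 * K%:R :> R by rewrite mulr_ge0.
have := exp_term_le (3 * d) x0.
rewrite ler_pdivrMr ?ltr0n ?fact_gt0// exprMn exprVn ler_pdivrMl ?exprn_gt0//.
by rewrite [expR _ * _]mulrC mulrA.
Qed.

End growth.

Section parameter_choice.
Context {R : realType} (d : nat).

Lemma parameter_choice (Cp c1 c2 : R) : 0 < Cp -> 0 < c1 -> 0 < c2 ->
  exists2 C3 : R, 0 <= C3 & forall (n : nat) (eta : R), (2 <= n)%N ->
    c1 * (ln n%:R `^ (d%:R / 2) / Num.sqrt n%:R) <= eta
      <= c2 * (ln n%:R `^ (d%:R / 2) / Num.sqrt n%:R) ->
  exists tau : R, exists B : nat, exists u : R,
    [/\ 0 < tau, 0 < u, Cp * (tau + 2 * d%:R * 2 ^- B) <= eta,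
      forall eps, 0 <= eps -> (2 * (4 * eta + 2 * (eps + u))) ^+ 2 <=
        C3 * (eps ^+ 2 + ln n%:R ^+ d.+1 / n%:R) &
      2 * ((truncn (2 / tau)).+1%:R ^+ (B ^ d)) ^+ 2 *
        expR (- (n%:R * u ^+ 2 / 12)) <= 2 ^+ d.+2 * (ln n%:R ^+ d.+1 / n%:R)].
Proof.
move=> Cp0 c10 c20.
(* As ln n >= 1/2 for n >= 2, [eta] is at least a / sqrt n. The constants [l0] and [b0] absorb the
   factors this leaves in the number of levels and in 2^B. *)
pose a := c1 * 2^-1 `^ (d%:R / 2).
have aE : a = c1 * 2^-1 `^ (d%:R / 2) by [].
have a0 : 0 < a by rewrite mulr_gt0// powR_gt0.
clearbody a.
pose l0 := ln (4 * Cp / a + 1); have l0E : l0 = ln (4 * Cp / a + 1) by [].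
clearbody l0.
have Ca0 : 0 < 4 * Cp / a by rewrite divr_gt0// mulr_gt0.
have l00 : 0 <= l0 by rewrite l0E ln_ge0//; lra.
pose b0 := 2 * ln (4 * d%:R * Cp / a + 1).
have b0E : b0 = 2 * ln (4 * d%:R * Cp / a + 1) by []; clearbody b0.
have Cd0 : 0 <= 4 * d%:R * Cp / a by rewrite divr_ge0 ?(ltW a0)// mulr_ge0 ?(ltW Cp0).
have b00 : 0 <= b0 by rewrite b0E mulr_ge0// ln_ge0//; lra.
pose CB := 2 * b0 + 3; have CBE : CB = 2 * b0 + 3 by []; clearbody CB.
have CB0 : 0 <= CB by lra.
pose G := 2 * CB ^+ d * (2 * l0 + 1).
have GE : G = 2 * CB ^+ d * (2 * l0 + 1) by [].
have G0 : 0 <= G by rewrite !mulr_ge0 ?exprn_ge0//; lra.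
clearbody G.
pose D2 : R := 2 ^+ d; have D2E : D2 = 2 ^+ d by [].
have D20 : 0 <= D2 by rewrite exprn_ge0.
clearbody D2.
exists (48 + 384 * c2 ^+ 2 + 576 * (G + D2)).
  have := sqr_ge0 c2; lra.
move=> n eta n2 /andP[eta1 eta2].
pose L := ln (n%:R : R); have LE : ln n%:R = L by [].
rewrite !LE in eta1 eta2 *; clearbody L.
have n0 : (0 < n)%N by exact: leq_trans n2.
have nR : 0 < n%:R :> R by rewrite ltr0n.
have L2 : 2^-1 <= L.
  by rewrite -LE (le_trans ln2_ge_half)// ler_ln ?posrE ?ltr0n// ler_nat.
have L0 : 0 < L by apply: lt_le_trans L2; rewrite invr_gt0.
have nE : n%:R = expR L by rewrite -LE lnK// posrE.
pose r := Num.sqrt (n%:R : R); have rE : Num.sqrt n%:R = r by [].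
rewrite !rE in eta1 eta2; clearbody r.
have sn : r = expR (L / 2).
  apply/eqP; rewrite -rE -(@eqrXn2 _ 2) ?sqrtr_ge0 ?expR_ge0// sqr_sqrtr ?(ltW nR)//.
  by rewrite -expRM_natl nE; apply/eqP; congr expR; field.
have sn0 : 0 < r by rewrite sn expR_gt0.
have rn : r ^+ 2 = n%:R by rewrite -rE sqr_sqrtr// ltW.
have eta_ge : a / r <= eta.
  apply: le_trans eta1; rewrite aE -mulrA ler_wpM2l ?(ltW c10)//.
  apply: ler_wpM2r; first by rewrite invr_ge0 ltW.
  by apply: ge0_ler_powR => //; rewrite ?nnegrE ?invr_ge0// ltW.
have eta0 : 0 < eta by apply: lt_le_trans eta_ge; rewrite divr_gt0.
have eta_inv : eta^-1 <= r / a.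
  rewrite -[leRHS]invrK lef_pV2 ?posrE ?invr_gt0 ?divr_gt0//.
  by rewrite invf_div.
pose s := L ^+ d.+1 / n%:R; rewrite -/s.
have s0 : 0 <= s by rewrite divr_ge0 ?exprn_ge0 ?(ltW L0)// ltW.
(* ln n is below 1 at n = 2, so 2 L rather than L is used as the quantity at least 1; hence the
   powers of 2 in the constants. *)
have L2d k : 1 <= 2 ^+ k * L ^+ k by rewrite -exprMn exprn_ege1//; lra.
have Ls : L / n%:R <= D2 * s.
  rewrite /s mulrA ler_wpM2r ?invr_ge0 ?(ltW nR)// exprS mulrCA D2E.
  by rewrite ler_peMr ?(ltW L0).
have etas : eta ^+ 2 <= 2 * c2 ^+ 2 * s.
  have e2 : eta ^+ 2 <= (c2 * (L `^ (d%:R / 2) / r)) ^+ 2.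
    by rewrite lerXn2r ?nnegrE ?(ltW eta0)// (le_trans _ eta2)// ltW.
  apply: (le_trans e2); rewrite exprMn expr_div_n rn.
  have -> : (L `^ (d%:R / 2)) ^+ 2 = L ^+ d.
    rewrite -powR_mulrn ?powR_ge0// -powRrM -[RHS]powR_mulrn ?(ltW L0)//.
    by congr (_ `^ _); field.
  rewrite [2 * _]mulrC -[leRHS]mulrA ler_wpM2l ?sqr_ge0//.
  rewrite /s exprS !mulrA ler_wpM2r ?invr_ge0 ?(ltW nR)// ler_peMl ?exprn_ge0 ?(ltW L0)//; lra.
have sE : s = L ^+ d.+1 / n%:R by [].
clearbody s.
pose tau := eta / (2 * Cp); have tauE : tau = eta / (2 * Cp) by [].
have tau0 : 0 < tau by rewrite divr_gt0// mulr_gt0.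
clearbody tau.
have cp : Cp != 0 by rewrite gt_eqF.
have en0 : eta != 0 by rewrite gt_eqF.
have Lb0 : 0 <= L + b0 by rewrite addr_ge0// ltW.
(* 2^B >= exp (B/2) then exceeds sqrt n times any required constant, which brings the truncation
   error under eta / 2. *)
pose B := (truncn (L + b0)).+1.
have [B1 B2] : L + b0 <= B%:R /\ B%:R <= L + b0 + 1.
  have /andP[h1 h2] := truncn_itv Lb0; rewrite /B; split; first exact: ltW.
  by rewrite -natr1 lerD2r.
clearbody B.
have B2exp : 4 * d%:R * Cp / eta <= 2 ^+ B.
  apply: (@le_trans _ _ (expR ((L + b0) / 2))); last first.
    apply: (@le_trans _ _ (expR (2^-1 * B%:R))).
      by rewrite ler_expR mulrC ler_wpM2l ?invr_ge0.
    by rewrite expRM_natr lerXn2r ?nnegrE ?expR_ge0// expR_half_le2.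
  have -> : expR ((L + b0) / 2) = r * (4 * d%:R * Cp / a + 1).
    rewrite mulrDl expRD -sn b0E mulrAC divff// mul1r lnK// posrE.
    by rewrite ltr_wpDl.
  apply: (@le_trans _ _ (4 * d%:R * Cp * (r / a))).
    by rewrite ler_wpM2l// mulr_ge0 ?(ltW Cp0)// mulr_ge0.
  rewrite (_ : _ * (_ / a) = r * (4 * d%:R * Cp / a)); last ring.
  by rewrite ler_wpM2l ?(ltW sn0)// lerDl.
have cov : Cp * (tau + 2 * d%:R * 2 ^- B) <= eta.
  have -> : Cp * (tau + 2 * d%:R * 2 ^- B) = eta / 2 + 2 * d%:R * Cp / 2 ^+ B.
    move: (2 ^- B) => w; rewrite tauE.
    by field; rewrite cp.
  have h : 2 * d%:R * Cp / 2 ^+ B <= eta / 2.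
    rewrite ler_pdivrMr ?exprn_gt0// -ler_pdivrMl ?divr_gt0//.
    apply: le_trans B2exp; rewrite le_eqVlt; apply/orP; left; apply/eqP.
    by field; rewrite en0.
  by rewrite [leRHS](splitr eta) lerD2l.
(* expR (G * L ^+ d.+1) will bound the number of pairs of centers, so that this
   deviation level makes the union bound of order 1 / n. *)
pose U := 12 * (G * L ^+ d.+1 + L) / n%:R.
have Ld0 : 0 <= L ^+ d.+1 by rewrite exprn_ge0// ltW.
have U0 : 0 < U.
  by rewrite divr_gt0// mulr_gt0// ltr_wpDl// mulr_ge0.
pose u := Num.sqrt U.
have u0 : 0 < u by rewrite sqrtr_gt0.
have u2 : u ^+ 2 = 12 * (G * L ^+ d.+1 + L) / n%:R by rewrite sqr_sqrtr// ltW.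
clearbody u; clear U U0.
exists tau, B, u; split=> //.
- have us : u ^+ 2 <= 12 * (G + D2) * s.
    rewrite u2 (_ : 12 * (G * L ^+ d.+1 + L) / n%:R = 12 * (G * s + L / n%:R)).
      by rewrite -[leRHS]mulrA ler_wpM2l// mulrDl lerD2l.
    by rewrite sE; ring.
  move=> eps eps0.
  have h1 : (2 * (4 * eta + 2 * (eps + u))) ^+ 2 <=
      192 * eta ^+ 2 + 48 * eps ^+ 2 + 48 * u ^+ 2.
    have q1 := sqr_ge0 (8 * eta - 4 * eps); have q2 := sqr_ge0 (8 * eta - 4 * u).
    have q3 := sqr_ge0 (4 * eps - 4 * u).
    rewrite -subr_ge0 (_ : _ - _ = (8 * eta - 4 * eps) ^+ 2 + (8 * eta - 4 * u) ^+ 2 +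
      (4 * eps - 4 * u) ^+ 2); last ring.
    by rewrite !addr_ge0.
  apply: (le_trans h1).
  have q1 : 0 <= c2 ^+ 2 * eps ^+ 2 by rewrite mulr_ge0 ?sqr_ge0.
  have q2 : 0 <= (G + D2) * eps ^+ 2 by rewrite mulr_ge0 ?sqr_ge0// addr_ge0.
  have -> : (48 + 384 * c2 ^+ 2 + 576 * (G + D2)) * (eps ^+ 2 + s) =
     192 * (2 * c2 ^+ 2 * s) + 48 * eps ^+ 2 + 48 * (12 * (G + D2) * s) +
     (48 * s + 384 * (c2 ^+ 2 * eps ^+ 2) + 576 * ((G + D2) * eps ^+ 2)) by ring.
  apply: ler_wpDr.
    exact: (addr_ge0 (addr_ge0 (mulr_ge0 (ler0n R 48) s0) (mulr_ge0 (ler0n R 384) q1))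
      (mulr_ge0 (ler0n R 576) q2)).
  by apply: lerD; [apply: lerD => //|]; exact: ler_wpM2l.
(* The logarithm of the number of levels is O(L), and B^d is O(L^d), so the covering number is exp
   (O(L^(d+1))); the factor 2 in [G] accounts for pairs. *)
have Lev : (truncn (2 / tau)).+1%:R <= expR (l0 + L).
  have t0 : 0 <= 2 / tau by rewrite divr_ge0// ltW.
  have /andP[tr _] := truncn_itv t0.
  rewrite -natr1; apply: (@le_trans _ _ (2 / tau + 1)); first by rewrite lerD2r.
  apply: (@le_trans _ _ (r * (4 * Cp / a + 1))).
    rewrite mulrDr mulr1; apply: lerD.
      have -> : 2 / tau = 4 * Cp * eta^-1.
        by rewrite tauE; field; rewrite en0 cp.
      apply: (@le_trans _ _ (4 * Cp * (r / a))).
        by rewrite ler_wpM2l// mulr_ge0// ltW.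
      by rewrite mulrCA mulrA.
    by rewrite sn -[leLHS]expR0 ler_expR divr_ge0// ltW.
  rewrite expRD {1}l0E lnK; last by rewrite posrE ltr_wpDl// ltW.
  rewrite mulrC; apply: ler_wpM2l; first by rewrite addr_ge0// ltW.
  by rewrite sn ler_expR ler_pdivrMr// ler_peMr ?(ltW L0)// ler1n.
have Bd : (B ^ d)%:R <= CB ^+ d * L ^+ d.
  rewrite natrX -exprMn lerXn2r ?nnegrE// ?mulr_ge0 ?(ltW L0)//.
  have : b0 <= b0 * (2 * L) by rewrite ler_peMr//; lra.
  rewrite CBE; lra.
have E1 : ((truncn (2 / tau)).+1%:R ^+ (B ^ d)) ^+ 2 <= expR (G * L ^+ d.+1).
  apply: (@le_trans _ _ ((expR (l0 + L) ^+ (B ^ d)) ^+ 2)).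
    by rewrite lerXn2r ?nnegrE ?exprn_ge0 ?expR_ge0// lerXn2r ?nnegrE ?expR_ge0.
  rewrite -!expRM_natl ler_expR GE exprS.
  have lL : l0 + L <= (2 * l0 + 1) * L.
    have : l0 <= l0 * (2 * L) by rewrite ler_peMr//; lra.
    lra.
  have h := ler_pM (ler0n R _) (addr_ge0 l00 (ltW L0)) Bd lL.
  rewrite [leRHS](_ : _ = 2 * (CB ^+ d * L ^+ d * ((2 * l0 + 1) * L))); last ring.
  by rewrite ler_wpM2l.
have nn : n%:R != 0 :> R by rewrite gt_eqF.
have -> : n%:R * u ^+ 2 / 12 = G * L ^+ d.+1 + L by rewrite u2; field; rewrite nn.
apply: (@le_trans _ _ (2 * expR (G * L ^+ d.+1) * expR (- (G * L ^+ d.+1 + L)))).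
  by rewrite ler_wpM2r ?expR_ge0// ler_wpM2l.
rewrite -[leLHS]mulrA -expRD opprD addrA subrr sub0r expRN -nE.
apply: (@le_trans _ _ (2 * (2 * (D2 * s)))); last by rewrite !exprS -D2E !mulrA.
rewrite ler_wpM2l//; apply: (@le_trans _ _ (2 * (L / n%:R))); last by rewrite ler_wpM2l.
by rewrite mulrA ler_peMl ?invr_ge0 ?(ltW nR)//; lra.
Qed.

End parameter_choice.

Lemma risk_bookkeeping {R : realType} (h A l C F e eps2 s k t2 tail D : R) :
  0 <= h -> 0 <= A -> 0 <= l -> 0 <= C -> 0 <= F -> 0 <= eps2 -> 0 <= s ->
  0 <= k -> 0 <= t2 -> 0 <= D -> 1 <= e ->
  F <= A * e -> t2 <= C * (eps2 + s) -> tail <= D * s ->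
  h * F * (l * t2 + k) + tail <= (h * A * (l * C + 1) + D) * e * (eps2 + s + k).
Proof.
move=> h0 A0 l0 C0 F0 p0 s0 k0 t0 D0 e1 FA tC tD.
have e0 : 0 <= e by exact: le_trans e1.
rewrite mulrDl mulrDl; apply: lerD.
  rewrite (_ : h * A * _ * _ * _ = h * (A * e) * ((l * C + 1) * (eps2 + s + k))); last ring.
  apply: ler_pM.
  - exact: mulr_ge0.
  - by apply: addr_ge0 => //; exact: mulr_ge0.
  - exact: ler_wpM2l.
  apply: (@le_trans _ _ (l * (C * (eps2 + s)) + k)).
    by apply: lerD => //; exact: ler_wpM2l.
  rewrite [leRHS](_ : _ = l * (C * (eps2 + s)) + k + (l * C * k + (eps2 + s))); last ring.
  by rewrite lerDl !addr_ge0// mulr_ge0// mulr_ge0.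
apply: (le_trans tD); rewrite -mulrA; apply: ler_wpM2l => //.
rewrite -[leLHS]mul1r; apply: ler_pM => //; lra.
Qed.

Section polylog_risk.
Context {R : realType} (d : nat).

(** [K] is quantified last: it will depend on [eps] and [n], while [C] and [c0] may not. *)
Lemma yatracos_polylog_risk (M c1 c2 : R) : 0 < M -> 0 < c1 -> 0 < c2 ->
  exists C : R, exists c0 : R, 0 < C /\ 0 <= c0 /\
    forall (n : nat) (eta : R) (N : nat)
      (c : 'I_N -> probability (rspace R d) R)
      (est : n.-tuple (rspace R d) -> probability (rspace R d) R)
      (fhat : n.-tuple (rspace R d) -> rspace R d -> R),
      (2 <= n)%N ->
      c1 * (ln n%:R `^ (d%:R / 2) / Num.sqrt n%:R) <= eta
        <= c2 * (ln n%:R `^ (d%:R / 2) / Num.sqrt n%:R) ->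
      minimal_tv_covering (mixtures M) eta c ->
      yatracos_estimator (mixtures M) c est ->
      (forall s, is_density (est s) (fhat s)) ->
    forall (eps : R) (prior P0 Q : probability (rspace R d) R),
      0 <= eps < 1 ->
      supp prior `<=` cube M ->
      is_density P0 (mixture prior) ->
    forall (disp : measure_display) (Omega : measurableType disp)
      (Pr : probability Omega R) (X : 'I_n -> {RV Pr >-> rspace R d}),
      iid_from X (contaminated eps P0 Q) ->
    forall K : nat, (0 < K)%N ->
      ('E_Pr[fun w => (hellinger (mixture prior) (fhat (sample X w)) ^+ 2)%R]
        <= (C * expR (8 / 5 * K%:R) *
             (eps ^+ 2 + ln n%:R ^+ d.+1 / n%:R + K%:R ^- K * expR (c0 * K%:R)))%:E)%E.
Proof.
move=> M0 c10 c20.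
have Cp0 : 0 < covering_cst d M by exact: covering_cst_gt0.
have [C3 C30 params] := parameter_choice d Cp0 c10 c20.
pose Ad : R := 10 ^+ (3 * d) * (3 * d)`!%:R.
have AdE K : K%:R ^+ (3 * d) * 4 ^+ K <= Ad * expR (8 / 5 * K%:R).
  exact: poly_exp_growth.
have Ad0 : 0 <= Ad by rewrite mulr_ge0// exprn_ge0.
clearbody Ad.
have h0 := @hell_cst_ge0 R d; have l10 := @l1_cst_ge0 R d.
exists (hell_cst d * Ad * (l1_cst d * C3 + 1) + 2 ^+ d.+2), (5 * d%:R * (2 * M) ^+ 2).
have H0 : 0 <= hell_cst d * Ad * (l1_cst d * C3 + 1).
  by apply: mulr_ge0; [exact: mulr_ge0|apply: addr_ge0 => //; exact: mulr_ge0].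
split; first by rewrite ltr_wpDl// exprn_gt0.
split; first by apply: mulr_ge0; [exact: mulr_ge0|exact: sqr_ge0].
move=> n eta N c est fhat n2 eta12 mc estP densP eps prior P0 Q eps01
  priorM dP0 disp Omega Pr X iid K K0.
have n0 : (0 < n)%N by exact: leq_trans n2.
have [tau [B [u [tau0 u0 cov t2 tail]]]] := params n eta n2 eta12.
apply: (le_trans (yatracos_risk M0 n0 K0 tau0 u0 eps01 cov mc estP densP priorM dP0 iid)).
rewrite lee_fin; have {}t2 := t2 eps (andP eps01).1.
have s0 : 0 <= ln n%:R ^+ d.+1 / n%:R :> R.
  by rewrite divr_ge0// exprn_ge0// ln_ge0// ler1n.
rewrite -(mulrA (hell_cst d)); apply: risk_bookkeeping => //.
- exact: sqr_ge0.
- exact: sqr_ge0.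
- by rewrite -[leLHS]expR0 ler_expR mulr_ge0.
Qed.

End polylog_risk.

Section rates.
Context {R : realType}.

Lemma powR_expR (a x : R) : 0 < a -> a `^ x = expR (x * ln a).
Proof. by move=> a0; rewrite /powR gt_eqF. Qed.

Lemma expR2_le9 : expR 2 <= 9 :> R.
Proof.
have -> : expR 2 = expR 1 ^+ 2 :> R by rewrite -expRM_natl mulr1.
apply: (@le_trans _ _ (3 ^+ 2)); last by rewrite expr2; lra.
by rewrite lerXn2r ?nnegrE ?expR_ge0// expR1_le3.
Qed.

Lemma ln_le_sqrt (y : R) : 0 < y -> ln y <= 2 * Num.sqrt y.
Proof.
move=> y0; have s0 : 0 < Num.sqrt y by rewrite sqrtr_gt0.
rewrite -[X in ln X](sqr_sqrtr (ltW y0)) lnXn// mulr2n.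
by have := ln_sublinear s0; lra.
Qed.

(** Lets a cost exp (O(x / ln x)) with x <= ln n be charged to the second term of the rate.
    Monotonicity follows from ln y <= ln x + (y/x - 1) and ln x >= 1. *)
Lemma div_ln_le (x y : R) : expR 1 <= x -> x <= y -> x / ln x <= y / ln y.
Proof.
move=> ex xy; have x0 : 0 < x by apply: lt_le_trans ex; exact: expR_gt0.
have y0 : 0 < y by exact: lt_le_trans xy.
have lx : 1 <= ln x by rewrite -[leLHS]expRK ler_ln// posrE expR_gt0.
have lxy : ln x <= ln y by rewrite ler_ln.
have lx0 : 0 < ln x by exact: lt_le_trans lx.
have ly0 : 0 < ln y by exact: lt_le_trans lxy.
have h : ln y <= ln x + (y / x - 1).
  rewrite -lerBlDl -ln_div ?posrE//.
  have := expR_ge1Dx (ln (y / x)); rewrite lnK ?posrE ?divr_gt0//.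
  by rewrite lerBrDl.
have yx : 0 <= y / x - 1 by rewrite subr_ge0 ler_pdivlMr// mul1r.
rewrite ler_pdivrMr// mulrAC ler_pdivlMr//.
have -> : y * ln x = x * (ln x + (y / x - 1) * ln x).
  by have xn : x != 0 by [rewrite gt_eqF]; field; rewrite xn.
rewrite ler_wpM2l ?(ltW x0)// (le_trans h)// lerD2l.
by rewrite ler_peMr.
Qed.

(* K is of order x / ln x: then K ^ K overtakes expR (2 x) while a fixed
   exponential of K stays below expR (4 x / ln x). *)
Lemma degree_choice (c0 : R) : 0 <= c0 -> exists2 x0 : R, expR 1 <= x0 &
  forall x, x0 <= x -> exists2 K : nat, (0 < K)%N &
    expR (8 / 5 * K%:R) <= 9 * expR (18 / 5 * (x / ln x)) /\
    expR (8 / 5 * K%:R) * (K%:R ^- K * expR (c0 * K%:R)) <= expR (- (2 * x)).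
Proof.
move=> c00; pose c' := c0 + 8 / 5; have c'E : c' = c0 + 8 / 5 by [].
have c'0 : 0 <= c' by rewrite /c'; lra.
clearbody c'.
(* 1296 = 36^2 gives ln y <= 2 sqrt y <= y / 18, and 18 c' <= y gives c' <= y / 18; together they
   leave 8/9 of y. *)
exists (expR (1296 + 18 * c')); first by rewrite ler_expR; lra.
move=> x xx0; have x0 : 0 < x by apply: lt_le_trans xx0; exact: expR_gt0.
pose y := ln x; have yE : ln x = y by [].
have xE : x = expR y by rewrite lnK.
rewrite yE; clearbody y.
have y0 : 1296 + 18 * c' <= y by rewrite -ler_expR -xE.
have y1 : 0 < y by lra.
have lny : ln y + c' <= y / 9.
  have h1 := ln_le_sqrt y1.
  have h2 : Num.sqrt y ^+ 2 = y by rewrite sqr_sqrtr// ltW.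
  have h3 : 36 <= Num.sqrt y.
    rewrite -[36]ger0_norm// -sqrtr_sqr ler_sqrt ?(ltW y1)//.
    by apply: (@le_trans _ _ 1296); rewrite ?expr2; lra.
  have h4 : 36 * Num.sqrt y <= y by rewrite -{2}h2 expr2 ler_wpM2r// sqrtr_ge0.
  lra.
have z0 : 0 <= 9 / 4 * (x / y) by rewrite mulr_ge0// divr_ge0// ltW.
(* 9/4 is the inverse of 8/9, times the exponent 2 to be reached. *)
pose K := (truncn (9 / 4 * (x / y))).+1.
have [K1 K2] : 9 / 4 * (x / y) <= K%:R /\ K%:R <= 9 / 4 * (x / y) + 1.
  have /andP[h1 h2] := truncn_itv z0; rewrite /K; split; first exact: ltW.
  by rewrite -natr1 lerD2r.
have K0 : (0 < K)%N by [].
clearbody K; exists K => //.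
have KR : 0 < K%:R :> R by rewrite ltr0n.
split.
  apply: (@le_trans _ _ (expR 2 * expR (18 / 5 * (x / y)))).
    by rewrite -expRD ler_expR; lra.
  by rewrite ler_wpM2r ?expR_ge0// expR2_le9.
rewrite (_ : K%:R ^- K = expR (- (K%:R * ln K%:R))); last first.
  by rewrite expRN expRM_natl lnK// posrE.
rewrite -!expRD ler_expR.
have xy : x / y <= K%:R.
  apply: le_trans K1; rewrite ler_peMl ?divr_ge0 ?(ltW x0) ?(ltW y1)//; lra.
have lnK : y - ln y <= ln K%:R.
  have -> : y - ln y = ln (x / y) by rewrite ln_div ?posrE// yE.
  by rewrite ler_ln ?posrE ?divr_gt0.
have h1 : K%:R * (c' - ln K%:R) <= K%:R * (- (8 / 9 * y)).
  rewrite ler_wpM2l ?(ltW KR)//; lra.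
have h2 : K%:R * (- (8 / 9 * y)) <= 9 / 4 * (x / y) * (- (8 / 9 * y)).
  by rewrite ler_wnM2r// oppr_le0 mulr_ge0// ltW.
have h3 : 9 / 4 * (x / y) * (- (8 / 9 * y)) = - (2 * x).
  by have yn : y != 0 by [rewrite gt_eqF]; field; rewrite yn.
rewrite -h3; apply: le_trans h2; apply: le_trans h1.
by rewrite c'E le_eqVlt; apply/orP; left; apply/eqP; ring.
Qed.

(** 4d + 4 pays for the power d + 1 of ln n, and 4 covers the cost 18/5 of the degree. The maximum
    keeps the value positive when ln (ln n) is small or negative. *)
Definition rate_exponent (d n : nat) : R :=
  (4 * d%:R + 8) / Num.max 1 (ln (ln n%:R)).

Lemma rate_exponent_gt0 d n : 0 < rate_exponent d n.
Proof.
by apply: divr_gt0; [rewrite ltr_wpDl// mulr_ge0|rewrite lt_max ltr01].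
Qed.

Lemma cvg_rate_exponent d : rate_exponent d n @[n --> \oo] --> (0 : R).
Proof.
apply/cvgrPdist_le => e e0; near=> n.
rewrite sub0r normrN gtr0_norm ?rate_exponent_gt0// /rate_exponent.
rewrite ler_pdivrMr; last by rewrite lt_max ltr01.
rewrite -ler_pdivrMl// mulrC le_max; apply/orP; right.
set a := _ / e.
have en : expR (expR a) <= n%:R.
  apply: le_trans (ltW (truncnS_gt _)) _; rewrite ler_nat.
  by near: n; exact: nbhs_infty_ge.
have n0 : 0 < n%:R :> R by apply: lt_le_trans en; exact: expR_gt0.
have h1 : expR a <= ln n%:R by rewrite -[leLHS]expRK ler_ln ?posrE ?expR_gt0.
have l0 : 0 < ln n%:R :> R by apply: lt_le_trans h1; exact: expR_gt0.
by rewrite -[leLHS]expRK ler_ln ?posrE ?expR_gt0.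
Unshelve. all: by end_near. Qed.

Lemma log_power_le (d : nat) (L : R) : 3 <= L ->
  expR (18 / 5 * (L / ln L)) * (L ^+ d.+1 / expR L) <=
  expR (- (L * (1 - (4 * d%:R + 8) / ln L))).
Proof.
move=> L3; have L0 : 0 < L by lra.
have lnL0 : 0 < ln L by rewrite ln_gt0//; lra.
have -> : L ^+ d.+1 = expR (d.+1%:R * ln L) by rewrite expRM_natl lnK// posrE.
rewrite -expRN -!expRD ler_expR.
(* Powers of L are thus also exp (O(L / ln L)). *)
have lnLE : ln L <= 4 * (L / ln L).
  rewrite mulrA ler_pdivlMr//.
  rewrite -[X in 4 * X](sqr_sqrtr (ltW L0)).
  rewrite (_ : 4 * Num.sqrt L ^+ 2 = 2 * Num.sqrt L * (2 * Num.sqrt L)); last ring.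
  by apply: ler_pM; rewrite ?(ltW lnL0)// ln_le_sqrt.
have -> : - (L * (1 - (4 * d%:R + 8) / ln L)) = (4 * d%:R + 8) * (L / ln L) - L.
  ring.
have u0 : 0 < L / ln L by rewrite divr_gt0.
have h : d.+1%:R * ln L <= d.+1%:R * (4 * (L / ln L)) by rewrite ler_wpM2l.
move: h; rewrite -natr1; move: (ln L) (L / ln L) u0 => l u u0 h.
lra.
Qed.

Lemma rate_bound (d : nat) (C c0 delta : R) : 0 < C -> 0 <= c0 -> 0 < delta ->
  exists2 C' : R, 0 < C' & forall (n : nat) (eps : R), (2 <= n)%N -> 0 <= eps < 1 ->
  exists2 K : nat, (0 < K)%N &
    C * expR (8 / 5 * K%:R) *
      (eps ^+ 2 + ln n%:R ^+ d.+1 / n%:R + K%:R ^- K * expR (c0 * K%:R)) <=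
    C' * rate delta (rate_exponent d) eps n.
Proof.
move=> C0 c00 delta0; have [x0 ex0 xK] := degree_choice c00.
have x00 : 0 < x0 by apply: lt_le_trans ex0; exact: expR_gt0.
have e1 : 1 <= expR 1 :> R by rewrite -[leLHS]expR0 ler_expR.
pose A0 := 9 * (1 + (d.+1)`!%:R + expR c0).
have A0E : A0 = 9 * (1 + (d.+1)`!%:R + expR c0) by [].
have A00 : 0 <= A0 by rewrite /A0 mulr_ge0// addr_ge0 ?expR_ge0.
clearbody A0.
exists (C * (A0 * expR (2 * x0) + 19)).
  by rewrite mulr_gt0// ltr_wpDl// mulr_ge0// expR_ge0.
move=> n eps n2 /andP[eps0 eps1].
pose L := ln (n%:R : R); have LE : ln n%:R = L by [].
have n0 : 0 < n%:R :> R by rewrite ltr0n (leq_trans _ n2).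
have nE : n%:R = expR L by rewrite -LE lnK// posrE.
pose o := rate_exponent d n; have oE : rate_exponent d n = o by [].
have o0 : 0 < o by exact: rate_exponent_gt0.
pose rn := expR (- (L * (1 - o))); have rnE : rn = expR (- (L * (1 - o))) by [].
pose re := if eps == 0 then 0 else
  eps `^ (2 * (1 - (2 + delta) / ln (Num.max (ln (eps^-1)) (expR 1)))).
have rateE : rate delta (rate_exponent d) eps n = re + rn.
  rewrite /rate /re oE; congr (_ + _).
  by rewrite powR_expR// LE -expRN /rn mulrC.
have reE x : eps = expR (- x) ->
    re = expR (- (2 * x * (1 - (2 + delta) / ln (Num.max x (expR 1))))).
  move=> ex; rewrite /re gt_eqF; last by rewrite ex expR_gt0.
  rewrite powR_expR; last by rewrite ex expR_gt0.
  rewrite ex -expRN opprK !expRK; congr expR; ring.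
have re0 : 0 <= re by rewrite /re; case: ifP => // _; exact: powR_ge0.
have L0 : 0 < L by rewrite -LE ln_gt0// ltr1n.
have rnL : expR (- L) <= rn.
  by rewrite ler_expR lerN2 ler_piMr ?(ltW L0)// gerBl ltW.
have rn0 : 0 <= rn by exact: expR_ge0.
have oL : 3 <= L -> o = (4 * d%:R + 8) / ln L.
  move=> L3; rewrite -oE /rate_exponent LE; congr (_ / _).
  apply/max_idPr; rewrite -[leLHS]expRK ler_ln ?posrE ?expR_gt0//.
  exact: le_trans expR1_le3 L3.
rewrite LE rateE.
clearbody o rn re L.
(* For bounded parameters K = 1 suffices: the bound is then a constant, and [finish] applies since
   the rate is at least exp (-2 x0). *)
have small : C * expR (8 / 5 * 1%:R) *
      (eps ^+ 2 + L ^+ d.+1 / n%:R + 1%:R ^- 1 * expR (c0 * 1%:R)) <= C * A0.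
  rewrite -mulrA ler_wpM2l ?(ltW C0)// A0E expr1 invr1 mul1r !mulr1.
  apply: ler_pM; rewrite ?expR_ge0//.
  - by rewrite !addr_ge0 ?sqr_ge0 ?expR_ge0// divr_ge0 ?exprn_ge0 ?(ltW L0)// ltW.
  - by apply: le_trans expR2_le9; rewrite ler_expR; lra.
  - rewrite lerD2r; apply: lerD; first by rewrite expr_le1// ltW.
    rewrite ler_pdivrMr// mulrC -ler_pdivrMr ?ltr0n ?fact_gt0// nE.
    exact: exp_term_le (ltW L0).
have CA : 0 <= C * A0 by rewrite mulr_ge0// ltW.
have finish r : expR (- (2 * x0)) <= r -> r <= re + rn ->
    C * A0 <= C * (A0 * expR (2 * x0) + 19) * (re + rn).
  move=> h1 h2; have r0 : 0 <= r by apply: le_trans h1; exact: expR_ge0.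
  have h3 : C * A0 <= C * A0 * expR (2 * x0) * r.
    rewrite -mulrA ler_peMr// -[leLHS](expRxMexpNx_1 (2 * x0)).
    by rewrite ler_wpM2l ?expR_ge0.
  apply: (le_trans h3).
  apply: (@le_trans _ _ (C * A0 * expR (2 * x0) * (re + rn))).
    by rewrite ler_wpM2l// mulr_ge0 ?expR_ge0.
  rewrite ler_wpM2r ?addr_ge0// mulrDr mulrA lerDl mulr_ge0// ltW//.
have [Lx|Lx] := ltP L (2 * x0).
  exists 1%N => //; apply: (le_trans small); apply: (finish (expR (- L))).
    by rewrite ler_expR lerN2 ltW.
  by rewrite (le_trans rnL)// lerDr.
have L3 : 3 <= L.
  by have e2 : 2 <= expR 1 :> R by [apply: le_trans (expR_ge1Dx _); lra]; lra.
have L1 : 1 <= L by lra.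
have lnL1 : 0 < ln L by rewrite ln_gt0//; lra.
have Lrn : expR (18 / 5 * (L / ln L)) * (L ^+ d.+1 / n%:R) <= rn.
  by rewrite nE rnE oL//; exact: log_power_le.
have Ln0 : 0 <= L ^+ d.+1 / n%:R by rewrite divr_ge0 ?exprn_ge0// ltW.
have LnK (x : R) (K : nat) : expR 1 <= x -> x <= L ->
    expR (8 / 5 * K%:R) <= 9 * expR (18 / 5 * (x / ln x)) ->
    expR (8 / 5 * K%:R) * (L ^+ d.+1 / n%:R) <= 9 * rn.
  move=> ex xL /(ler_wpM2r Ln0)/le_trans; apply.
  rewrite -[leLHS]mulrA; apply: ler_wpM2l => //; apply: le_trans Lrn.
  by rewrite ler_wpM2r// ler_expR ler_wpM2l// ?div_ln_le//; lra.
(* 19 = 9 + 9 + 1: the contamination and sampling terms are each at most 9 times a term of the rate,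
   the truncation error at most once. *)
have conclude (K : nat) : expR (8 / 5 * K%:R) * (eps ^+ 2 + L ^+ d.+1 / n%:R +
      K%:R ^- K * expR (c0 * K%:R)) <= 19 * (re + rn) ->
    C * expR (8 / 5 * K%:R) * (eps ^+ 2 + L ^+ d.+1 / n%:R +
      K%:R ^- K * expR (c0 * K%:R)) <= C * (A0 * expR (2 * x0) + 19) * (re + rn).
  move=> h; rewrite -[leLHS]mulrA -[leRHS]mulrA.
  apply: ler_wpM2l; first exact: ltW.
  apply: (le_trans h).
  by rewrite ler_wpM2r ?addr_ge0// lerDr mulr_ge0// expR_ge0.
(* The threshold is n^(-1/2). Above it K is tuned to x = ln (1/eps), below it to x = L/2, where the
   contamination is dominated by the sampling error. *)
have [epsL|epsL] := leP (expR (- (L / 2))) eps.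
  have epsp : 0 < eps by apply: lt_le_trans epsL; exact: expR_gt0.
  pose x := - ln eps; have epsE : eps = expR (- x) by rewrite opprK lnK.
  clearbody x.
  have x1 : 0 < x by move: eps1; rewrite epsE -[ltRHS]expR0 ltr_expR oppr_lt0.
  have xL : x <= L / 2 by move: epsL; rewrite epsE ler_expR lerN2.
  have {}reE := reE _ epsE.
  have re2x : expR (- (2 * x)) <= re.
    rewrite reE ler_expR lerN2 ler_piMr ?mulr_ge0 ?(ltW x1)// gerBl.
    apply: divr_ge0; first by rewrite addr_ge0// ltW.
    apply: ln_ge0; apply: (le_trans e1); by rewrite le_max lexx orbT.
  have [xx0|xx0] := ltP x x0.
    exists 1%N => //; apply: (le_trans small); apply: (finish re).
      by apply: le_trans re2x; rewrite ler_expR lerN2 ler_wpM2l// ltW.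
    by rewrite lerDl.
  have [K K0 [K1 K2]] := xK _ xx0; exists K => //; apply: conclude.
  have ex : expR 1 <= x by exact: le_trans xx0.
  have lnx : 0 < ln x.
    by apply: (@lt_le_trans _ _ 1) => //; rewrite -[leLHS]expRK ler_ln ?posrE ?expR_gt0.
  have h1 : expR (8 / 5 * K%:R) * eps ^+ 2 <= 9 * re.
    apply: (le_trans (ler_wpM2r (sqr_ge0 _) K1)); rewrite -[leLHS]mulrA.
    apply: ler_wpM2l => //.
    rewrite epsE -expRM_natl -expRD reE (max_idPl ex) ler_expR.
    (* The coefficient 18/5 of x / ln x fits under 2 (2 + delta), the loss allowed by the exponent
       of the rate. *)
    have -> : - (2 * x * (1 - (2 + delta) / ln x)) =
      - (2 * x) + 2 * (2 + delta) * (x / ln x) by ring.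
    have u0 : 0 < x / ln x by rewrite divr_gt0.
    have du0 : 0 < delta * (x / ln x) by rewrite mulr_gt0.
    move: (x / ln x) u0 du0 => u u0 du0; lra.
  have h2 : expR (8 / 5 * K%:R) * (L ^+ d.+1 / n%:R) <= 9 * rn.
    by apply: (LnK x) => //; lra.
  have h3 := le_trans K2 re2x.
  rewrite !mulrDr; lra.
have xx0 : x0 <= L / 2 by lra.
have ex : expR 1 <= L / 2 by exact: le_trans xx0.
have [K K0 [K1 K2]] := xK _ xx0; exists K => //; apply: conclude.
have h2 : expR (8 / 5 * K%:R) * (L ^+ d.+1 / n%:R) <= 9 * rn.
  by apply: (LnK (L / 2)) => //; lra.
have h1 : eps ^+ 2 <= L ^+ d.+1 / n%:R.
  apply: (@le_trans _ _ (expR (- (L / 2)) ^+ 2)).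
    by rewrite lerXn2r ?nnegrE ?expR_ge0// ltW.
  rewrite -expRM_natl nE -expRN (_ : 2 * - (L / 2) = - L); last by field.
  by rewrite ler_peMl ?expR_ge0// exprn_ege1.
have h3 : expR (- (2 * (L / 2))) <= rn by rewrite (_ : 2 * (L / 2) = L)//; field.
have h4 := ler_wpM2l (expR_ge0 (8 / 5 * K%:R)) h1.
have h5 := le_trans K2 h3.
rewrite !mulrDr; lra.
Qed.

End rates.

Theorem theorem4p5 (R : realType) (d : nat) (d_gt0 : (0 < d)%N) :
  exists o : nat -> R,
    (forall n, 0 < o n) /\ (o n @[n --> \oo] --> (0 : R)) /\
    forall M delta c1 c2 : R, 0 < M -> 0 < delta -> 0 < c1 -> 0 < c2 ->
    exists2 C : R, 0 < C &
    forall (n : nat) (eta : R) (N : nat)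
      (c : 'I_N -> probability (rspace R d) R)
      (est : n.-tuple (rspace R d) -> probability (rspace R d) R)
      (fhat : n.-tuple (rspace R d) -> rspace R d -> R),
      (2 <= n)%N ->
      c1 * (ln n%:R `^ (d%:R / 2) / Num.sqrt n%:R) <= eta
        <= c2 * (ln n%:R `^ (d%:R / 2) / Num.sqrt n%:R) ->
      minimal_tv_covering (mixtures M) eta c ->
      yatracos_estimator (mixtures M) c est ->
      (forall s, is_density (est s) (fhat s)) ->
    forall (eps : R) (prior P0 Q : probability (rspace R d) R),
      0 <= eps < 1 ->
      supp prior `<=` cube M ->
      is_density P0 (mixture prior) ->
    forall (disp : measure_display) (Omega : measurableType disp)
      (Pr : probability Omega R) (X : 'I_n -> {RV Pr >-> rspace R d}),
      iid_from X (contaminated eps P0 Q) ->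
      ('E_Pr[fun w => (hellinger (mixture prior) (fhat (sample X w)) ^+ 2)%R]
        <= (C * rate delta o eps n)%:E)%E.
Proof.
exists (rate_exponent d); split; first exact: rate_exponent_gt0.
split; first exact: cvg_rate_exponent.
move=> M delta c1 c2 M0 delta0 c10 c20.
have [C [c0 [C0 [c00 risk]]]] := yatracos_polylog_risk d M0 c10 c20.
have [C' C'0 rateP] := rate_bound d C0 c00 delta0.
exists C' => // n eta N c est fhat n2 eta12 mc estP densP eps prior P0 Q eps01
  priorM dP0 disp Omega Pr X iid.
have [K K0 CK] := rateP n eps n2 eps01.
have := risk n eta N c est fhat n2 eta12 mc estP densP eps prior P0 Q eps01
  priorM dP0 disp Omega Pr X iid K K0.
by move=> /le_trans; apply; rewrite lee_fin.
Qed.
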